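(* Let $E$ be a directed graph, $R\subseteq E^0_{\mathrm{reg}}$, $N:E^1\to(1,\infty)$ a function, and $\beta\in[0,\infty)$. (1) $\{m^\beta_v\mid v\in E^0_{\beta\text{-reg}}\setminus R\}$ is the set of extreme points of $D^\beta_{\mathrm{fin}}$, and $D^\beta_{\mathrm{fin}}=\operatorname{Conv}\{m^\beta_v\mid v\in E^0_{\beta\text{-reg}}\setminus R\}$. (2) $\{m^\beta_{\mathfrak v}\mid \mathfrak v\in E^0_{\beta\text{-crit}}/_{\sim}\}$ is the set of extreme points of $D^\beta_{\mathrm{con}}$, and $D^\beta_{\mathrm{con}}=\operatorname{Conv}\{m^\beta_{\mathfrak v}\mid \mathfrak v\in E^0_{\beta\text{-crit}}/_{\sim}\}$. (3) If $D^\beta_{\mathrm{dis}}=\emptyset$ (in particular if $E^\infty_{\mathrm{wan}}=\emptyset$), then $\{m^\beta_v\mid v\in E^0_{\beta\text{-reg}}\setminus R\}\cup\{m^\beta_{\mathfrak v}\mid \mathfrak v\in E^0_{\beta\text{-crit}}/_{\sim}\}$ is the set of extreme points of $D^\beta$, and $$D^\beta=\operatorname{Conv}\bigl(\{m^\beta_v\mid v\in E^0_{\beta\text{-reg}}\setminus R\}\cup\{m^\beta_{\mathfrak v}\mid \mathfrak v\in E^0_{\beta\text{-crit}}/_{\sim}\}\bigr).$$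
   Context: **Graphs.** A directed graph $E=(E^0,E^1,s,r)$ consists of arbitrary (not necessarily countable) sets $E^0$ (vertices), $E^1$ (edges) and maps $s,r:E^1\to E^0$. A path of length $n\ge1$ is a sequence $e_1\cdots e_n$ of edges with $r(e_i)=s(e_{i+1})$; vertices are paths of length $0$. $E^*$ is the set of all finite paths; $s(u)=s(e_1)$, $r(u)=r(e_n)$ for $u=e_1\cdots e_n$, and $s(v)=r(v)=v$ for $v\in E^0$. $vE^1=\{e\in E^1:s(e)=v\}$; $E^0_{\mathrm{reg}}=\{v: vE^1\text{ finite and non-empty}\}$. For paths, $u'\le u$ means $u'$ is an initial segment of $u$ (the initial segment of length $0$ is $s(u)$), and $u'<u$ means $u'\le u$, $u'\ne u$. Sums of nonnegative terms over arbitrary index sets are suprema of finite partial sums, in $[0,\infty]$. **Path space.** $E^\infty$ is the set of infinite paths, $E^{\le\infty}=E^*\cup E^\infty$; $Z(u)=\{x\in E^{\le\infty}:u\le x\}$ for $u\in E^*$. $E^{\le\infty}$ has the topology generated by all $Z(u)$ and their complements, and $\partial_RE=E^\infty\cup\{u\in E^*:r(u)\notin R\}$ has the subspace topology. $E^\infty_{\mathrm{rec}}$ is the set of $x\in E^\infty$ such that for some $v\in E^0$ the set $\{u\in E^*:u<x,\ r(u)=v\}$ is infinite; $E^\infty_{\mathrm{wan}}=E^\infty\setminus E^\infty_{\mathrm{rec}}$. **Weights.** $N$ is extended to $E^*$ by $N(v)=1$ for $v\in E^0$ and $N(e_1\cdots e_n)=N(e_1)\cdots N(e_n)$. **$D^\beta$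 and associated measures.** $D^\beta$ is the set of functions $m:E^0\to[0,1]$ with $\sum_{v\in E^0}m(v)=1$; $m(v)=\sum_{e\in vE^1}N(e)^{-\beta}m(r(e))$ for $v\in R$; and $m(v)\ge\sum_{e\in vE^1}N(e)^{-\beta}m(r(e))$ for all $v\in E^0$. Each $m\in D^\beta$ has an associated measure: the unique regular Borel probability measure $\mu$ on $\partial_RE$ with $\mu(Z(v)\cap\partial_RE)=m(v)$ for all $v\in E^0$ and $\mu(eA)=N(e)^{-\beta}\mu(A)$ for all $e\in E^1$ and Borel $A\subseteq Z(r(e))\cap\partial_RE$, where $eA=\{ex:x\in A\}$. $D^\beta_{\mathrm{fin}}$, $D^\beta_{\mathrm{con}}$, $D^\beta_{\mathrm{dis}}$ are the sets of $m\in D^\beta$ with, respectively, $\mu(E^*\cap\partial_RE)=1$, $\mu$ supported on $E^\infty_{\mathrm{rec}}$ (that is, $\mu(E^\infty_{\mathrm{rec}})=1$), $\mu$ supported on $E^\infty_{\mathrm{wan}}$ (that is, $\mu(E^\infty_{\mathrm{wan}})=1$). **Partition functions.** For $v,v'\in E^0$: $vE_s^*v=\{u\in E^*: s(u)=r(u)=v,\ u\ne v,\ r(u')\ne v\text{ for any }v<u'<u\}$; $E_a^*v=\{u\in E^*: r(u)=v,\ r(u')\ne v\text{ for any }u'<u\}$; $v'E_a^*v=\{u\in E_a^*v: s(u)=v'\}$; $Z_v^s(\beta)=\sum_{u\in vE_s^*v}N(u)^{-\beta}$; $Z_v^a(\beta)=\sum_{u\in E_a^*v}N(u)^{-\beta}$.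 $E^0_{\beta\text{-reg}}=\{v: Z_v^a(\beta)<\infty,\ Z_v^s(\beta)<1\}$; $E^0_{\beta\text{-crit}}=\{v: Z_v^a(\beta)<\infty,\ Z_v^s(\beta)=1\}$. For $v$ in either set, $m_v^\beta(v')=\sum_{u\in v'E_a^*v}N(u)^{-\beta}(Z_v^a(\beta))^{-1}$ for $v'\in E^0$. **Equivalence.** $v_1\sim v_2$ means there are finite paths from $v_1$ to $v_2$ and from $v_2$ to $v_1$; $E^0_{\beta\text{-crit}}/_{\sim}$ is the set of equivalence classes in $E^0_{\beta\text{-crit}}$; $m^\beta_{\mathfrak v}:=m^\beta_v$ for any $v\in\mathfrak v$ (this is independent of $v\in\mathfrak v$). **Convex hull.** For $A\subseteq D^\beta$, $\operatorname{Conv}A$ denotes the convex hull of $A$.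
   Formalization: Conv is taken as the set of countable (possibly infinite) convex combinations; with finite convex combinations the equalities fail, e.g. for the graph with vertex set the natural numbers, no edges and R empty. *)

(* Defs.v *)
From HB Require Import structures.
From mathcomp Require Import all_boot all_order all_algebra.
From mathcomp Require Import all_classical all_reals all_analysis.

Set Implicit Arguments.
Unset Strict Implicit.
Unset Printing Implicit Defensive.

Import Order.TTheory GRing.Theory Num.Theory.

Local Open Scope classical_set_scope.
Local Open Scope ring_scope.

(* Classically every type carries a choiceType structure (see [classic] in
   boolp), so [choiceType] does not restrict the vertex and edge sets. *)
Record digraph := Digraph {
  vert : choiceType;
  edge : choiceType;
  src : edge -> vert;
  rng : edge -> vert
}.
Arguments src {d}.
Arguments rng {d}.

Section Paths.
Variable E : digraph.
Implicit Types (v w : vert E) (e : edge E).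

Definition out_edges v : set (edge E) := [set e | src e = v].

Definition regular_vertices : set (vert E) :=
  [set v | finite_set (out_edges v) /\ out_edges v !=set0].

Fixpoint chain v (es : seq (edge E)) : bool :=
  if es is e :: es' then (src e == v) && chain (rng e) es' else true.

(* A finite path is its source together with its sequence of edges, so that
   the paths of length 0 are the vertices. *)
Record finpath := Finpath {
  fpath_val : vert E * seq (edge E);
  fpath_valP : chain fpath_val.1 fpath_val.2
}.

HB.instance Definition _ := [isSub for fpath_val].
HB.instance Definition _ := [Choice of finpath by <:].

Definition fsrc (u : finpath) : vert E := (fpath_val u).1.
Definition fedges (u : finpath) : seq (edge E) := (fpath_val u).2.
Definition frng (u : finpath) : vert E := last (fsrc u) (map rng (fedges u)).
Definition fvertex v : finpath := @Finpath (v, [::]) isT.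

Record infpath := Infpath {
  iedge : nat -> edge E;
  iedgeP : forall n, rng (iedge n) = src (iedge n.+1)
}.

Inductive pathspace := Fin of finpath | Inf of infpath.

HB.instance Definition _ := gen_eqMixin pathspace.
HB.instance Definition _ := gen_choiceMixin pathspace.

Definition psrc (x : pathspace) : vert E :=
  match x with Fin u => fsrc u | Inf y => src (iedge y 0) end.

(* u is an initial segment of x, a proper one for [plt]. *)
Definition ple (u : finpath) (x : pathspace) : Prop :=
  match x with
  | Fin w => fsrc u = fsrc w /\ prefix (fedges u) (fedges w)
  | Inf y => fsrc u = src (iedge y 0) /\
             fedges u = mkseq (iedge y) (size (fedges u))
  end.

Definition plt (u : finpath) (x : pathspace) : Prop := ple u x /\ Fin u <> x.

Definition cylinder (u : finpath) : set pathspace := [set x | ple u x].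

HB.instance Definition _ := isSubBaseTopological.Build pathspace
  (range cylinder `|` range (fun u => ~` cylinder u)) id.

Definition finite_paths : set pathspace := range Fin.
Definition infinite_paths : set pathspace := range Inf.

Definition recurrent_paths : set pathspace :=
  [set x | infinite_paths x /\
     exists v, infinite_set [set u | plt u x /\ frng u = v]].

Definition wandering_paths : set pathspace :=
  infinite_paths `\` recurrent_paths.

(* Prepending an edge: e x, defined when r(e) = s(x). *)
Lemma fcons_subproof e (u : finpath) : rng e = fsrc u ->
  chain (src e, e :: fedges u).1 (src e, e :: fedges u).2.
Proof. by move=> eu /=; rewrite eqxx eu; case: u {eu} => -[]. Qed.

Definition fcons e (u : finpath) (eu : rng e = fsrc u) : finpath :=
  Finpath (fcons_subproof eu).

Definition icons_fun e (y : infpath) (n : nat) : edge E :=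
  if n is k.+1 then iedge y k else e.

Lemma icons_subproof e (y : infpath) : rng e = src (iedge y 0) ->
  forall n, rng (icons_fun e y n) = src (icons_fun e y n.+1).
Proof. by move=> ey [|n] //=; exact: iedgeP. Qed.

Definition icons e (y : infpath) (ey : rng e = src (iedge y 0)) : infpath :=
  Infpath (icons_subproof ey).

Definition pcons e (x : pathspace) : rng e = psrc x -> pathspace :=
  match x with
  | Fin u => fun eu => Fin (fcons eu)
  | Inf y => fun ey => Inf (icons ey)
  end.

Definition simple_loops v : set finpath :=
  [set u | [/\ fsrc u = v, frng u = v, u <> fvertex v &
     forall u', plt (fvertex v) (Fin u') -> plt u' (Fin u) -> frng u' <> v]].

Definition first_paths v : set finpath :=
  [set u | frng u = v /\ forall u', plt u' (Fin u) -> frng u' <> v].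

Definition first_paths_from w v : set finpath :=
  [set u | first_paths v u /\ fsrc u = w].

Definition connected_to v w : Prop := exists u, fsrc u = v /\ frng u = w.
Definition vequiv v w : Prop := connected_to v w /\ connected_to w v.

End Paths.

Section Boundary.
Variables (E : digraph) (Rg : set (vert E)).

Definition boundary_set : set (pathspace E) :=
  @infinite_paths E `|` [set Fin u | u in [set u : finpath E | ~ Rg (frng u)]].

(* [set_type] carries the subspace topology. *)
Definition boundary := set_type boundary_set.

(* MathComp-Analysis only has measures on pointed types, whereas the boundary
   is empty when the graph is. [boundary_at p] is the boundary with p as its
   distinguished point; neither its topology nor its Borel sets depend on p. *)
Definition boundary_at (p : boundary) : Type := boundary.

HB.instance Definition _ (p : boundary) :=
  Topological.copy (boundary_at p) (set_type boundary_set).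
HB.instance Definition _ (p : boundary) := isPointed.Build (boundary_at p) p.

Definition trace (p : boundary) (B : set (pathspace E)) : set (boundary_at p) :=
  [set x | B (set_val x)].

(* eA = { e x : x in A } *)
Definition edge_mul (p : boundary) (e : edge E) (A : set (boundary_at p)) :
    set (boundary_at p) :=
  [set y | exists x : boundary_at p, exists h : rng e = psrc (set_val x),
     A x /\ set_val y = pcons h].

End Boundary.
Arguments trace {E Rg} p B.

Section RegularMeasure.
Variables (R : realType) (T : ptopologicalType).

Definition borelType := g_sigma_algebraType (@open T).

Definition regular_measure (mu : probability borelType R) : Prop :=
  (forall A : set borelType, measurable A ->
     mu A = ereal_inf [set mu U | U in [set U : set T | open U /\ A `<=` U]]) /\
  (forall U : set T, open U ->
     mu U = ereal_sup [set mu K | K in [set K : set T | compact K /\ K `<=` U]]).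

End RegularMeasure.

Section Convexity.
Variables (R : realType) (V : choiceType).
Implicit Types (A : set (V -> R)) (m : V -> R).

(* Convex combinations here are sums over the possibly infinite set A, with
   only countably many nonzero weights. Finite combinations would not do: for
   the graph with vertex set nat and no edges, Dbeta consists of all probability
   vectors on nat, while the m_v are the unit vectors. *)
Definition conv_hull A : set (V -> R) :=
  [set m | exists t : (V -> R) -> R,
     [/\ forall a, A a -> 0 <= t a,
         (\esum_(a in A) (t a)%:E = 1)%E &
         forall v, ((m v)%:E = \esum_(a in A) (t a * a v)%:E)%E]].

Definition extreme_points A : set (V -> R) :=
  [set m | A m /\
     forall (a b : V -> R) (t : R), A a -> A b -> 0 < t -> t < 1 ->
       m = (fun v => t * a v + (1 - t) * b v) -> a = m /\ b = m].

End Convexity.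

Section KMS.
Variables (R : realType) (E : digraph) (Rg : set (vert E)).
Variables (N : edge E -> R) (beta : R).

Definition edge_weight (e : edge E) : R := N e `^ (- beta).
Definition path_weight (u : finpath E) : R :=
  (\prod_(e <- fedges u) N e) `^ (- beta).

Definition Dbeta : set (vert E -> R) :=
  [set m | [/\ forall v, 0 <= m v <= 1,
     (\esum_(v in [set: vert E]) (m v)%:E = 1)%E,
     forall v, Rg v ->
       ((m v)%:E = \esum_(e in out_edges v) (edge_weight e * m (rng e))%:E)%E &
     forall v,
       (\esum_(e in out_edges v) (edge_weight e * m (rng e))%:E <= (m v)%:E)%E]].

Definition associated_measure (m : vert E -> R) (p : boundary Rg)
    (mu : probability (borelType (boundary_at p)) R) : Prop :=
  [/\ regular_measure mu,
      forall v, mu (trace p (cylinder (fvertex v))) = (m v)%:E &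
      forall (e : edge E) (A : set (borelType (boundary_at p))),
        measurable A -> A `<=` trace p (cylinder (fvertex (rng e))) ->
        mu (edge_mul e A) = ((edge_weight e)%:E * mu A)%E].

(* The m in D whose associated measure gives full mass to B. *)
Definition D_supported (B : set (pathspace E)) : set (vert E -> R) :=
  [set m | Dbeta m /\
     exists (p : boundary Rg) (mu : probability (borelType (boundary_at p)) R),
       associated_measure m mu /\ mu (trace p B) = 1%E].

Definition D_fin := D_supported (@finite_paths E).
Definition D_con := D_supported (@recurrent_paths E).
Definition D_dis := D_supported (@wandering_paths E).

Definition Zs (v : vert E) : \bar R :=
  (\esum_(u in simple_loops v) (path_weight u)%:E)%E.
Definition Za (v : vert E) : \bar R :=
  (\esum_(u in first_paths v) (path_weight u)%:E)%E.

Definition beta_regular : set (vert E) :=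
  [set v | (Za v < +oo)%E /\ (Zs v < 1)%E].
Definition beta_critical : set (vert E) :=
  [set v | (Za v < +oo)%E /\ Zs v = 1%E].

Definition mbeta (v w : vert E) : R :=
  fine (\esum_(u in first_paths_from w v)
          (path_weight u * (fine (Za v))^-1)%:E)%E.

Definition critical_classes : set (set (vert E)) :=
  [set C | exists2 v, beta_critical v &
     C = [set w | beta_critical w /\ vequiv v w]].

(* [xget] picks some m^beta_v with v in C; they all coincide. *)
Definition mbeta_class (C : set (vert E)) : vert E -> R :=
  xget (fun=> 0) [set mbeta v | v in C].

Definition M_reg : set (vert E -> R) := mbeta @` (beta_regular `\` Rg).
Definition M_crit : set (vert E -> R) := mbeta_class @` critical_classes.

End KMS.

(* Main.v *)
(* Let P be the operator (P k)(v) = sum over e in vE^1 of N(e)^-beta k(r(e)), so that D^beta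
   consists of superharmonic probability vectors (P m <= m). Each m^beta_v with Z^s_v <= 1 is
   superharmonic, with charge m - P m concentrated at v and vanishing exactly when v is
   critical, and it spans an extreme ray: if k and m^beta_v - k are superharmonic, comparing
   both with first passages to v forces k to be a multiple of m^beta_v. Subtracting from m the
   largest possible multiples of these rays leaves a harmonic function vanishing at all
   critical vertices.
   On the measure side, mu(Z(u)) = N(u)^-beta m(r(u)), and inner regularity makes mu additive
   on unions of arbitrarily many disjoint cylinders. Hence mu(E^infty) is the limit of the
   masses of P^n m, paths visiting a non-critical vertex infinitely often are null, and those
   visiting a critical v infinitely often have mass m(v) Z^a_v; this identifies the parts of m
   seen by the finite, recurrent and wandering paths. Existence of mu for m in D^beta: assign to
   the finite paths u nested half-open intervals of lengths N(u)^-beta m(r(u)) tiling [0,1),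
   send x to the path whose segments have x in their intervals, and push Lebesgue measure
   forward. This map is continuous off countably many points, so regularity is inherited from
   Lebesgue measure even when the graph is uncountable. *)

Require Import Defs.
From HB Require Import structures.
From mathcomp Require Import all_boot all_order all_algebra finmap.
From mathcomp Require Import all_classical all_reals all_analysis.
From mathcomp Require Import measurable_realfun ring lra.

Set Implicit Arguments.
Unset Strict Implicit.
Unset Printing Implicit Defensive.

Import Order.TTheory GRing.Theory Num.Theory.
Import numFieldNormedType.Exports.

Local Open Scope classical_set_scope.
Local Open Scope ring_scope.

(** * Sums over arbitrary index sets *)

(** With uncountably many paths, countable additivity does not control unions of cylinders. Upper
    bounds on masses therefore come from compact sets covered by finitely many cylinders, lower
    bounds from finite disjoint subfamilies, and every sum over paths is bounded through its finite
    partial sums. In each case the extreme points follow from the identity between the simplex and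
    the hull: an extreme point of the hull is one of its generators, and a generator is extreme
    because it spans an extreme ray. To place a simplex inside the hull, the given measure is used
    to discard terms of the decomposition of m: a harmonic k <= m has total mass at most
    mu(E^infty). The converse inclusion is where a measure must be constructed. The vanishing of the
    harmonic remainder at critical vertices serves (3): its associated measure then gives no mass to
    recurrent paths, so a nonzero remainder, once normalized, would be an element of D^beta_dis. *)

Section ExtendedSums.
Variable R : realType.
Local Open Scope ereal_scope.

Lemma esum_leP (T : choiceType) (I : set T) (a : T -> \bar R) (x : \bar R) :
  (forall X, fsets I X -> \sum_(i \in X) a i <= x) -> \esum_(i in I) a i <= x.
Proof. by move=> h; rewrite ge_ereal_sup//= => _ [X IX <-]; exact: h. Qed.

Lemma esum_le_subset (T : choiceType) (I J : set T) (a : T -> \bar R) :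
  I `<=` J -> \esum_(i in I) a i <= \esum_(i in J) a i.
Proof.
move=> IJ; apply: esum_leP => X [fX XI]; apply: esum_ge; exists X => //.
by split => //; exact: subset_trans IJ.
Qed.

Lemma esum_ge1 (T : choiceType) (I : set T) (a : T -> \bar R) (i : T) :
  (forall i, I i -> 0 <= a i) -> I i -> a i <= \esum_(i in I) a i.
Proof.
move=> a0 Ii; rewrite -(esum_set1 (a0 i Ii)); apply: esum_le_subset.
by move=> _ ->.
Qed.

Lemma esum_eq0 (T : choiceType) (I : set T) (a : T -> \bar R) (i : T) :
  (forall i, I i -> 0 <= a i) -> \esum_(i in I) a i = 0 -> I i -> a i = 0.
Proof.
by move=> a0 s0 Ii; apply/eqP; rewrite eq_le a0// andbT -s0 esum_ge1.
Qed.

(** Only the inequality [le] needs an argument: applied to the inverse of [c] it gives the other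
    direction. *)
Lemma esumZl (T : choiceType) (I : set T) (a : T -> \bar R) (c : R) :
  (0 <= c)%R -> (forall i, I i -> 0 <= a i) ->
  \esum_(i in I) (c%:E * a i) = c%:E * \esum_(i in I) a i.
Proof.
have le (d : R) (b : T -> \bar R) : (0 <= d)%R -> (forall i, I i -> 0 <= b i) ->
    \esum_(i in I) (d%:E * b i) <= d%:E * \esum_(i in I) b i.
  move=> d0 b0; apply: esum_leP => X [fX XI].
  (* [ge0_mule_fsumr] asks for nonnegativity on the whole type, hence the extension of [b] by zero
     outside [I]. *)
  pose b' i := if i \in I then b i else 0.
  have Xb (f : \bar R -> \bar R) :
      \sum_(i \in X) f (b i) = \sum_(i \in X) f (b' i).
    by apply: eq_fsbigr => i /[!inE] /XI Ii; rewrite /b' ifT// inE.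
  rewrite (Xb (mule d%:E)) -ge0_mule_fsumr; last first.
    by move=> i; rewrite /b'; case: ifPn => // /[!inE] /b0.
  rewrite -(Xb id) lee_wpmul2l ?lee_fin//.
  by apply: esum_ge; exists X.
move=> c0 a0; apply/eqP; rewrite eq_le le//=.
move: c0; rewrite le0r => /orP[/eqP->|c0].
  by rewrite mul0e; apply: esum_ge0 => i _; rewrite mul0e.
have ca i : c^-1%:E * (c%:E * a i) = a i.
  by rewrite muleA -EFinM mulVf ?gt_eqF// mul1e.
rewrite -(@lee_pmul2l _ c^-1%:E) ?lte_fin ?invr_gt0//.
rewrite muleA -EFinM mulVf ?gt_eqF// mul1e.
rewrite (_ : esum I a = \esum_(i in I) (c^-1%:E * (c%:E * a i))); last first.
  by apply: eq_esum => i _; rewrite ca.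
apply: le => [|i Ii]; first by rewrite invr_ge0 ltW.
by rewrite mule_ge0 ?a0// lee_fin ltW.
Qed.

Lemma esum_exchange (T T' : choiceType) (I : set T) (J : set T')
    (a : T -> T' -> \bar R) : (forall i j, I i -> J j -> 0 <= a i j) ->
  \esum_(i in I) \esum_(j in J) a i j = \esum_(j in J) \esum_(i in I) a i j.
Proof.
move=> a0; rewrite esum_esum// esum_esum; last by move=> j i Jj Ii; exact: a0.
rewrite [LHS](@reindex_esum R _ _ (J `*`` (fun=> I)) _ (fun k => (k.2, k.1)))//.
split=> [[j i] /= [] //|[j i] [j' i'] _ _ /= [-> ->]//|[i j] [/= Ii Jj]].
by exists (j, i).
Qed.

(** Each level set of terms above 1/(n+1) is finite, since too many of them would sum to more than
    the total; the support is the union of these level sets. *)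
Lemma esum_lt_pinfty_countable (T : choiceType) (I : set T) (a : T -> R) :
  (forall i, (0 <= a i)%R) -> \esum_(i in I) (a i)%:E < +oo ->
  countable [set i | I i /\ a i != 0%R].
Proof.
move=> a0 aoo.
apply: (@sub_countable _ _ _ (\bigcup_n [set i | I i /\ n.+1%:R^-1 < a i]%R)).
  apply: subset_card_le => i [Ii ai0].
  have {}ai0 : (0 < a i)%R by rewrite lt_neqAle eq_sym ai0/=.
  exists (Num.truncn (a i)^-1) => //; split=> //.
  by rewrite invf_plt ?posrE// ?ltr0Sn// Num.Theory.truncnS_gt.
apply: bigcup_countable => // n _; apply: finite_set_countable.
apply: contrapT => inf.
have s0 : 0 <= \esum_(i in I) (a i)%:E by apply: esum_ge0 => i _; rewrite lee_fin.
have sfin : \esum_(i in I) (a i)%:E \is a fin_num by rewrite ge0_fin_numE.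
set s := fine (\esum_(i in I) (a i)%:E).
have [B BI nB] := infinite_set_fset ((Num.truncn s).+1 * n.+1) inf.
have : \sum_(i \in [set` B]) (a i)%:E <= s%:E.
  rewrite /s fineK//; apply: ereal_sup_ubound; exists [set` B] => //; split=> //.
  by move=> i /BI[].
apply/negP; rewrite -ltNge fsbig_finite// set_fsetK sumEFin lte_fin.
apply: (@lt_le_trans _ _ (\sum_(i <- finmap.enum_fset B) n.+1%:R^-1)%R); last first.
  rewrite big_seq [leRHS]big_seq; apply: ler_sum => i iB.
  by apply/ltW; have [] := BI i iB.
rewrite big_const_seq count_predT iter_addr_0 -[ltRHS]mulr_natr ltr_pdivlMl ?ltr0Sn// mulrC.
apply: (@lt_le_trans _ _ ((Num.truncn s).+1 * n.+1)%:R); last by rewrite ler_nat.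
by rewrite natrM ltr_pM2r ?ltr0Sn// Num.Theory.truncnS_gt.
Qed.
End ExtendedSums.

(** * Finite paths *)

Section PathCons.
Variable E : digraph.
Implicit Types (u : finpath E) (e : edge E) (v : vert E) (B : set (vert E)).

(* The path [e u] when [rng e = fsrc u]; the junk value [u] otherwise. *)
Definition tcons e u : finpath E := insubd u (src e, e :: fedges u).

Lemma tconsE e u (eu : rng e = fsrc u) : tcons e u = fcons eu.
Proof. by apply: val_inj; have := fcons_subproof eu; rewrite val_insubd/= => ->. Qed.

Lemma fsrc_tcons e u : rng e = fsrc u -> fsrc (tcons e u) = src e.
Proof. by move=> eu; rewrite tconsE. Qed.

Lemma fedges_tcons e u : rng e = fsrc u -> fedges (tcons e u) = e :: fedges u.
Proof. by move=> eu; rewrite tconsE. Qed.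

Lemma frng_tcons e u : rng e = fsrc u -> frng (tcons e u) = frng u.
Proof. by move=> eu; rewrite tconsE /frng/= eu. Qed.

Lemma finpath_eq u u' : fsrc u = fsrc u' -> fedges u = fedges u' -> u = u'.
Proof.
by case: u u' => [[a s] p] [[a' s'] p']; rewrite /fsrc /fedges /= => ? ?; apply: val_inj => /=; congr pair.
Qed.

Lemma finpath_case u : u = fvertex (fsrc u) \/
  exists e u', rng e = fsrc u' /\ u = tcons e u'.
Proof.
case: u => -[v [|e es]] p; first by left; exact: val_inj.
right; have /andP[/= /eqP ev ees] := p.
by exists e, (@Finpath E (rng e, es) ees); split=> //; rewrite tconsE; apply: val_inj => /=; rewrite ev.
Qed.

Lemma tcons_inj e u e' u' : rng e = fsrc u -> rng e' = fsrc u' ->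
  tcons e u = tcons e' u' -> e = e' /\ u = u'.
Proof.
move=> eu eu'; rewrite (tconsE eu) (tconsE eu') => -[_ ee uu]; split => //.
by apply: finpath_eq => //; rewrite -eu -eu' ee.
Qed.

(** Paths grow by prepending edges rather than appending them, because the transfer operator sums
    over the first edge. *)
Lemma finpath_ind (P : finpath E -> Prop) :
  (forall v, P (fvertex v)) ->
  (forall e u, rng e = fsrc u -> P u -> P (tcons e u)) -> forall u, P u.
Proof.
move=> P0 P1 u; have [n] := ubnP (size (fedges u)); elim: n u => // n IH u.
have [->//|[e [u' [eu' ->]]]] := finpath_case u.
by rewrite fedges_tcons//= ltnS => /IH; exact: P1.
Qed.

Definition len u := size (fedges u).

Lemma len_tcons e u : rng e = fsrc u -> len (tcons e u) = (len u).+1.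
Proof. by move=> eu; rewrite /len fedges_tcons. Qed.

Lemma ple_fvertex v (x : pathspace E) : ple (fvertex v) x <-> psrc x = v.
Proof. by case: x => [u|y]; split => [[]//|/= <-]; split => //; rewrite prefix0s. Qed.

Lemma ple_tcons e u e' u' : rng e = fsrc u -> rng e' = fsrc u' ->
  ple (tcons e u) (Fin (tcons e' u')) <-> e = e' /\ ple u (Fin u').
Proof.
move=> eu eu'; rewrite (tconsE eu) (tconsE eu')/=.
split=> [[se /andP[/eqP ee ps]]|[ee [su ps]]].
  by subst e'; split => //; split => //; rewrite -eu -eu'.
by subst e'; split => //; rewrite eqxx.
Qed.

Lemma ple_tcons_fvertex e u v : rng e = fsrc u -> ~ ple (tcons e u) (Fin (fvertex v)).
Proof. by move=> eu; rewrite (tconsE eu) /= => -[]. Qed.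

Lemma plt_fvertex u v : ~ plt u (Fin (fvertex v)).
Proof.
have [->|[e [u' [eu ->]]]] := finpath_case u.
  by move=> [/ple_fvertex/= <- ].
by move=> [/(ple_tcons_fvertex eu)].
Qed.

Lemma plt_tcons u' e u : rng e = fsrc u ->
  plt u' (Fin (tcons e u)) <->
  u' = fvertex (src e) \/ exists u'', [/\ rng e = fsrc u'', u' = tcons e u'' & plt u'' (Fin u)].
Proof.
move=> eu; split=> [[le ne]|[->|[u'' [eu'' -> [le ne]]]]].
- have [u'v|[e' [u'' [eu' u'E]]]] := finpath_case u'.
    left; rewrite u'v; move: le; rewrite u'v => /ple_fvertex/= <-.
    by rewrite fsrc_tcons.
  right; move: le; rewrite u'E => /(ple_tcons eu' eu)[ee le].
  subst e'; exists u''; split => //; split => // -[uu]; apply: ne.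
  by rewrite u'E uu.
- split; first by apply/ple_fvertex; rewrite /= fsrc_tcons.
  by move=> -[] /(congr1 len); rewrite len_tcons.
- split; first exact/ple_tcons.
  by move=> -[] /(tcons_inj eu'' eu) [_ uu]; apply: ne; rewrite uu.
Qed.

(* [first_paths v] is [hit [set v]]. *)
Definition hit B : set (finpath E) :=
  [set u | B (frng u) /\ forall u', plt u' (Fin u) -> ~ B (frng u')].

Lemma hit_fvertex B v : hit B (fvertex v) <-> B v.
Proof. by split=> [[]//|Bv]; split => // u' /plt_fvertex. Qed.

Lemma hit_tcons B e u : rng e = fsrc u ->
  hit B (tcons e u) <-> ~ B (src e) /\ hit B u.
Proof.
move=> eu; split=> [[Bu h]|[nB [Bu h]]].
  split; first by apply: (h (fvertex (src e))); apply/plt_tcons => //; left.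
  split; first by rewrite frng_tcons in Bu.
  move=> u' lt; have eu' : rng e = fsrc u' by have [[/= -> _] _] := lt.
  rewrite -(frng_tcons eu'); apply: h; apply/plt_tcons => //; right.
  by exists u'.
split; first by rewrite frng_tcons.
move=> u' /(plt_tcons _ eu)[->//|[u'' [eu'' -> lt]]].
by rewrite frng_tcons//; exact: h.
Qed.

Lemma hit_src B u : B (fsrc u) -> hit B u -> u = fvertex (fsrc u).
Proof.
by have [//|[e [u' [eu ->]]]] := finpath_case u; rewrite fsrc_tcons// => ? /hit_tcons[].
Qed.

Lemma simple_loops_fvertex v v' : ~ simple_loops v (fvertex v').
Proof. by case=> + _ ne _; rewrite {1}/fsrc/= => vv; apply: ne; rewrite vv. Qed.

Lemma simple_loops_tcons v e u : rng e = fsrc u ->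
  simple_loops v (tcons e u) <-> src e = v /\ first_paths v u.
Proof.
move=> eu; split=> [[sv rv _ h]|[sv [rv h]]].
  rewrite fsrc_tcons// in sv; rewrite frng_tcons// in rv; split => //; split=> // u' lt.
  have eu' : rng e = fsrc u' by have [[/= -> _] _] := lt.
  rewrite -(frng_tcons eu'); apply: h.
    by apply/plt_tcons => //; left; rewrite sv.
  by apply/plt_tcons => //; right; exists u'.
split; rewrite ?fsrc_tcons ?frng_tcons//.
  by move=> /(congr1 len); rewrite len_tcons.
move=> u' lt /(plt_tcons _ eu)[u'v|[u'' [eu'' u'E /h]]].
  by move: lt; rewrite u'v => /plt_fvertex.
by rewrite u'E frng_tcons.
Qed.

Definition visits v u : nat := count_mem v (fsrc u :: map rng (fedges u)).

Lemma visits_fvertex v v' : visits v (fvertex v') = (v' == v).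
Proof. by rewrite /visits/= addn0. Qed.

Lemma visits_tcons v e u : rng e = fsrc u ->
  visits v (tcons e u) = ((src e == v) + visits v u)%N.
Proof. by move=> eu; rewrite /visits fsrc_tcons// fedges_tcons//= eu. Qed.

Lemma visits_frng u : (0 < visits (frng u) u)%N.
Proof. by rewrite /visits -has_count has_pred1 /frng mem_last. Qed.

(** The endpoint counts among the [n.+1] visits, so [nth_visit v 0] is the set of first passages to
    [v]. *)
Definition nth_visit v n : set (finpath E) := [set u | frng u = v /\ visits v u = n.+1].

End PathCons.
Arguments len {E} u.

(** * Sums over paths and the transfer operator *)

Section PathSums.
Variables (R : realType) (E : digraph) (N : edge E -> R) (beta : R).
Hypothesis N_gt0 : forall e, 0 < N e.
Local Notation w := (edge_weight N beta).
Local Open Scope ereal_scope.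
Implicit Types (S T : set (finpath E)) (c k : vert E -> \bar R) (v : vert E) (B : set (vert E)).

Lemma edge_weight_gt0 e : (0 < w e)%R.
Proof. exact: powR_gt0. Qed.

Lemma path_weight_gt0 u : (0 < path_weight N beta u)%R.
Proof. by apply/powR_gt0/prodr_gt0 => e _. Qed.

Lemma path_weight_fvertex v : path_weight N beta (fvertex v) = 1%R.
Proof. by rewrite /path_weight/= big_nil powR1. Qed.

Lemma path_weight_tcons e u : rng e = fsrc u ->
  path_weight N beta (tcons e u) = (w e * path_weight N beta u)%R.
Proof.
move=> eu; rewrite /path_weight fedges_tcons// big_cons powRM ?ltW//.
by apply/prodr_gt0 => ? _.
Qed.

(** The common form of the potentials, passage sums and level sums: [S] selects the paths, and [c]
    is evaluated where they end. Values are extended reals, so that no finiteness is presupposed. *)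
Definition psum S c v : \bar R :=
  \esum_(u in S `&` [set u | fsrc u = v]) ((path_weight N beta u)%:E * c (frng u)).

Definition transfer k v : \bar R :=
  \esum_(e in out_edges v) ((w e)%:E * k (rng e)).

Lemma psum_ge0 S c v : (forall v, 0 <= c v) -> 0 <= psum S c v.
Proof. by move=> c0; apply: esum_ge0 => u _; rewrite mule_ge0// lee_fin ltW// path_weight_gt0. Qed.

Lemma transfer_ge0 k v : (forall v, 0 <= k v) -> 0 <= transfer k v.
Proof. by move=> k0; apply: esum_ge0 => u _; rewrite mule_ge0// lee_fin ltW// edge_weight_gt0. Qed.

Lemma le_transfer k k' v : (forall v, k v <= k' v) -> transfer k v <= transfer k' v.
Proof. by move=> kk; apply: le_esum => e _; rewrite lee_wpmul2l// lee_fin ltW// edge_weight_gt0. Qed.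

Lemma transferZ r k v : (0 <= r)%R -> (forall v, 0 <= k v) ->
  transfer (fun v => r%:E * k v) v = r%:E * transfer k v.
Proof.
move=> r0 k0; rewrite -esumZl//; last first.
  by move=> e; rewrite mule_ge0// lee_fin ltW// edge_weight_gt0.
by apply: eq_esum => e _; rewrite muleCA.
Qed.

Lemma transferD k k' v : (forall v, 0 <= k v) -> (forall v, 0 <= k' v) ->
  transfer (fun v => k v + k' v) v = transfer k v + transfer k' v.
Proof.
move=> k0 k0'; rewrite -esumD; last 2 first.
- by move=> e _; rewrite mule_ge0// lee_fin ltW// edge_weight_gt0.
- by move=> e _; rewrite mule_ge0// lee_fin ltW// edge_weight_gt0.
by apply: eq_esum => e _; rewrite ge0_muleDr.
Qed.

Lemma transfer_esum (I : choiceType) (A : set I) (k : I -> vert E -> \bar R) v :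
  (forall i v, A i -> 0 <= k i v) ->
  transfer (fun v => \esum_(i in A) k i v) v = \esum_(i in A) transfer (k i) v.
Proof.
move=> k0; rewrite /transfer esum_exchange; last first.
  by move=> i e Ai _; rewrite mule_ge0 ?k0// lee_fin ltW// edge_weight_gt0.
by apply: eq_esum => e _; rewrite esumZl// => [|i Ai]; [rewrite ltW// edge_weight_gt0|exact: k0].
Qed.

Lemma le_psum S T c c' v : (forall u, fsrc u = v -> S u -> T u) ->
  (forall v, c v <= c' v) -> psum S c v <= psum T c' v.
Proof.
move=> ST cc; apply: (@le_trans _ _ (psum S c' v)).
  by apply: le_esum => u _; rewrite lee_wpmul2l// lee_fin ltW// path_weight_gt0.
by apply: esum_le_subset => u [Su uv]; split => //; exact: ST uv Su.
Qed.

Lemma eq_psum S T c v : (forall u, fsrc u = v -> S u <-> T u) ->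
  psum S c v = psum T c v.
Proof. by move=> ST; apply/eqP; rewrite eq_le; apply/andP; split; apply: le_psum => // u /ST[]. Qed.

Lemma psumZ r S c v : (0 <= r)%R -> (forall v, 0 <= c v) ->
  psum S (fun v => r%:E * c v) v = r%:E * psum S c v.
Proof.
move=> r0 k0; rewrite -esumZl//; last first.
  by move=> e; rewrite mule_ge0// lee_fin ltW// path_weight_gt0.
by apply: eq_esum => e _; rewrite muleCA.
Qed.

Lemma psum_set1 S c v : (forall v, 0 <= c v) ->
  (forall u, fsrc u = v -> S u <-> u = fvertex v) -> psum S c v = c v.
Proof.
move=> c0 Sv; rewrite (@eq_psum _ [set fvertex v])// /psum.
rewrite (_ : _ `&` _ = [set fvertex v]); last first.
  by apply/seteqP; split => [u []//|u ->].
by rewrite esum_set1 path_weight_fvertex ?mul1e.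
Qed.

Lemma psum0 S c v : (forall u, fsrc u = v -> ~ S u) -> psum S c v = 0.
Proof. by move=> Sv; rewrite /psum esum1// => u [Su /Sv]. Qed.

(** Paths of positive length from [v] correspond to pairs of an edge out of [v] and a path from its
    range; the path of length 0 gives the separate first term. All recursions for [psum] are
    instances of this one. *)
Lemma psum_cons S c v : (forall v, 0 <= c v) ->
  psum S c v = (if fvertex v \in S then c v else 0) +
    \esum_(e in out_edges v) ((w e)%:E * psum [set u | S (tcons e u)] c (rng e)).
Proof.
move=> c0.
have pc0 u : 0 <= (path_weight N beta u)%:E * c (frng u).
  by rewrite mule_ge0// lee_fin ltW// path_weight_gt0.
rewrite /psum (esumID [set fvertex v])//; congr (_ + _).
  case: ifPn => [/[!inE] Sv|/negP Sv].
    rewrite (_ : _ `&` _ `&` _ = [set fvertex v]); last first.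
      by apply/seteqP; split => [u []//|u ->]; do 2!split.
    by rewrite esum_set1// path_weight_fvertex mul1e.
  rewrite esum1// => u [[Su sv] uv]; exfalso; apply: Sv.
  by rewrite inE -uv.
transitivity (\esum_(e in out_edges v)
   \esum_(u in [set u | S (tcons e u)] `&` [set u | fsrc u = rng e])
     ((w e)%:E * ((path_weight N beta u)%:E * c (frng u)))); last first.
  by apply: eq_esum => e _; rewrite esumZl// ltW// edge_weight_gt0.
rewrite esum_esum; last first.
  by move=> e u _ _; rewrite mule_ge0// lee_fin ltW// edge_weight_gt0.
rewrite (@reindex_esum _ _ _
  (out_edges v `*`` (fun e => [set u | S (tcons e u)] `&` [set u | fsrc u = rng e])) _
  (fun p => tcons p.1 p.2)).
  apply: eq_esum => -[e u] [/= ev [Seu eu]].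
  by rewrite path_weight_tcons// frng_tcons// EFinM muleA.
split.
- move=> [e u] [/= ev [Seu eu]]; split; first by split => //; rewrite /= fsrc_tcons.
  by move=> /= /(congr1 len); rewrite len_tcons.
- move=> [e u] [e' u'] /[!inE] -[/= ev [Seu eu]] [/= ev' [Seu' eu']] /(tcons_inj _ _)[]//.
  by move=> -> ->.
- move=> u [[Su sv] /= uv]; have [uE|[e [u' [eu uE]]]] := finpath_case u.
    by exfalso; apply: uv; rewrite uE -sv.
  exists (e, u') => //=; split => /=; last by rewrite -uE.
  by rewrite /out_edges/= -sv uE fsrc_tcons.
Qed.

Lemma psum_cons_out S T c v : (forall v, 0 <= c v) -> ~ S (fvertex v) ->
  (forall e u, src e = v -> rng e = fsrc u -> S (tcons e u) <-> T u) ->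
  psum S c v = transfer (psum T c) v.
Proof.
move=> c0 Sv ST; rewrite psum_cons// ifF ?add0e; last first.
  by apply/negP; rewrite inE.
apply: eq_esum => e ev; congr (_ * _); apply: eq_psum => u ue.
by apply: ST => //; rewrite ue.
Qed.

(** A finite set of paths has bounded lengths. This turns bounds on infinite path sums into
    inductions on the length. *)
Lemma psum_le_truncate S c v x :
  (forall n, psum (S `&` [set u | len u < n]%N) c v <= x) -> psum S c v <= x.
Proof.
move=> h; apply: esum_leP => X [fX XS].
have [n Xn] : exists n, forall u, X u -> (len u < n)%N.
  exists (\sum_(u <- finmap.enum_fset (fset_set X)) len u).+1 => u Xu.
  rewrite ltnS (big_fsetD1 u)/= ?leq_addr//.
  by rewrite in_fset_set// inE.
apply: le_trans (h n); apply: esum_ge; exists X => //; split=> // u Xu.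
by have [Su su] := XS u Xu; do 2!split => //; exact: Xn.
Qed.

(* With [S] the set of all paths this says that a superharmonic function dominates the
   potential of its charge; with [S = hit B] it is the maximum principle. *)
Lemma psum_le_superharmonic S B c k : (forall v, 0 <= c v) -> (forall v, 0 <= k v) ->
  (forall v, B v -> psum S c v <= k v) ->
  (forall e u, ~ B (src e) -> rng e = fsrc u -> S (tcons e u) -> S u) ->
  (forall v, ~ B v -> (if fvertex v \in S then c v else 0) + transfer k v <= k v) ->
  forall v, psum S c v <= k v.
Proof.
move=> c0 k0 SB Scons Sk v; apply: psum_le_truncate => n.
elim: n v => [|n IH] v; first by rewrite psum0// => u _ [].
have [Bv|nBv] := pselect (B v).
  by apply: le_trans (SB v Bv); apply: le_psum => // u _ [].
apply: le_trans (Sk v nBv); rewrite psum_cons//; apply: leeD.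
  case: ifPn => [/[!inE] -[Sv _]|_]; last by case: ifP.
  by rewrite ifT// inE.
apply: le_esum => e ev; rewrite lee_wpmul2l//.
  by rewrite lee_fin ltW// edge_weight_gt0.
apply: le_trans (IH _); apply: le_psum => // u ue [Su].
rewrite /= len_tcons// ltnS => lu; split => //.
by apply: Scons Su => //; rewrite ev.
Qed.

Lemma psum_hit_in B c v : (forall v, 0 <= c v) -> B v -> psum (hit B) c v = c v.
Proof.
move=> c0 Bv; apply: psum_set1 => // u uv; split => [hu|->]; last exact/hit_fvertex.
by rewrite -uv; apply: (hit_src _ hu); rewrite uv.
Qed.

Lemma psum_hit_out B c v : (forall v, 0 <= c v) -> ~ B v ->
  psum (hit B) c v = transfer (psum (hit B) c) v.
Proof.
move=> c0 Bv; apply: psum_cons_out => //; first by move/hit_fvertex.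
by move=> e u ev eu; split => [/(hit_tcons _ eu)[]//|hu]; apply/hit_tcons; rewrite ?ev.
Qed.

Lemma psum_hit_le B c k : (forall v, 0 <= c v) -> (forall v, 0 <= k v) ->
  (forall v, B v -> c v <= k v) -> (forall v, ~ B v -> transfer k v <= k v) ->
  forall v, psum (hit B) c v <= k v.
Proof.
move=> c0 k0 ck Pk; apply: (@psum_le_superharmonic _ B) => //.
- by move=> v Bv; rewrite psum_hit_in//; exact: ck.
- by move=> e u _ eu /(hit_tcons _ eu)[].
- move=> v Bv; rewrite ifF ?add0e ?Pk//.
  by apply/negP; rewrite inE => /hit_fvertex.
Qed.

(** As a function of the starting vertex this is the unnormalized m^beta_v, available before Z^a_v
    is known to be finite. *)
Definition first_passage v : vert E -> \bar R := psum (first_paths v) (cst 1).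

Lemma first_passage_ge0 v v' : 0 <= first_passage v v'.
Proof. by apply: psum_ge0 => ?; rewrite lee01. Qed.

Lemma first_passage_diag v : first_passage v v = 1.
Proof. by apply: (@psum_hit_in [set v]) => // ?; rewrite lee01. Qed.

Lemma first_passage_out v v' : v' <> v ->
  first_passage v v' = transfer (first_passage v) v'.
Proof. by apply: (@psum_hit_out [set v]) => // ?; rewrite lee01. Qed.

(** The maximum principle for the single target [v]: [first_passage v] is the least nonnegative
    function that is superharmonic off [v] and at least 1 at [v]. *)
Lemma first_passage_le v r k : (0 <= r)%R -> (forall v', 0 <= k v') ->
  r%:E <= k v -> (forall v', v' <> v -> transfer k v' <= k v') ->
  forall v', r%:E * first_passage v v' <= k v'.
Proof.
move=> r0 k0 rk Pk v'; rewrite -psumZ ?lee01//.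
apply: (@psum_hit_le [set v]) => //.
- by move=> ?; rewrite mule1 lee_fin.
- by move=> _ ->; rewrite mule1.
Qed.

(** Removing the first edge of a simple loop at [v] leaves a first passage back to [v]. *)
Lemma ZsE v : Zs N beta v = transfer (first_passage v) v.
Proof.
transitivity (psum (simple_loops v) (cst 1) v).
  rewrite /psum (_ : _ `&` _ = simple_loops v); last first.
    by apply/seteqP; split => [u []//|u Su]; split => //; case: Su.
  by apply: eq_esum => u _; rewrite mule1.
apply: psum_cons_out => //; first exact: simple_loops_fvertex.
by move=> e u ev eu; split => [/(simple_loops_tcons _ eu)[]//|hu]; exact/simple_loops_tcons.
Qed.

Lemma esum_psum S c : (forall v, 0 <= c v) ->
  \esum_(v in [set: vert E]) psum S c v =
  \esum_(u in S) ((path_weight N beta u)%:E * c (frng u)).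
Proof.
move=> c0; have pc0 u : 0 <= (path_weight N beta u)%:E * c (frng u).
  by rewrite mule_ge0// lee_fin ltW// path_weight_gt0.
rewrite /psum esum_esum//.
rewrite (@reindex_esum _ _ _ ([set: vert E] `*`` (fun v => S `&` [set u | fsrc u = v])) S snd)//.
split=> [[v u] /= [_ []]//|[v u] [v' u'] /[!inE] -[_ [/= _ vu]] [_ [/= _ vu']] /= uu|u Su].
  by rewrite -vu -vu' uu.
by exists (fsrc u, u).
Qed.

Lemma ZaE v : Za N beta v = \esum_(v' in [set: vert E]) first_passage v v'.
Proof. by rewrite esum_psum ?lee01//; apply: eq_esum => u _; rewrite mule1. Qed.

Definition nth_passage v n : vert E -> \bar R := psum (nth_visit v n) (cst 1).

Lemma nth_passage_ge0 v n v' : 0 <= nth_passage v n v'.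
Proof. by apply: psum_ge0 => ?; rewrite lee01. Qed.

Lemma nth_passage_out v n v' : v' <> v ->
  nth_passage v n v' = transfer (nth_passage v n) v'.
Proof.
move=> ne; apply: psum_cons_out => //; first by case.
move=> e u ev eu; rewrite /nth_visit/= frng_tcons// visits_tcons// ev.
by rewrite (introF eqP ne).
Qed.

Lemma nth_passage0_diag v : nth_passage v 0 v = 1.
Proof.
apply: psum_set1 => // u uv; split=> [[ru]|->]; last by split; rewrite // visits_fvertex eqxx.
have [->|[e [u' [eu uE]]]] := finpath_case u; first by rewrite uv.
move: uv ru; rewrite uE fsrc_tcons// frng_tcons// visits_tcons// => -> <-.
by rewrite eqxx add1n => -[]; have := visits_frng u'; case: visits.
Qed.

Lemma nth_passageS_diag v n : nth_passage v n.+1 v = transfer (nth_passage v n) v.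
Proof.
apply: psum_cons_out => //; first by case=> _; rewrite visits_fvertex; case: eqP.
move=> e u ev eu; rewrite /nth_visit/= frng_tcons// visits_tcons// ev eqxx add1n.
by split=> [[? []]|[? ->]].
Qed.

(** No decomposition of a path into loops is needed. Both sides satisfy the same recursion off [v],
    so agreement at [v] propagates: the lower bound is minimality of [first_passage], the upper
    bound the maximum principle. *)
Lemma nth_passageE v n z : Zs N beta v = z%:E ->
  forall v', nth_passage v n v' = (z ^+ n)%:E * first_passage v v'.
Proof.
move=> Zz; have z0 : (0 <= z)%R.
  by rewrite -lee_fin -Zz ZsE; apply: transfer_ge0; exact: first_passage_ge0.
have zn0 m : (0 <= z ^+ m)%R by rewrite exprn_ge0.
have step m : nth_passage v m v = (z ^+ m)%:E ->
    forall v', nth_passage v m v' = (z ^+ m)%:E * first_passage v v'.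
  move=> Kv v'; apply/eqP; rewrite eq_le; apply/andP; split; last first.
    apply: first_passage_le => //; first exact: nth_passage_ge0.
      by rewrite Kv.
    by move=> v'' ne; rewrite nth_passage_out.
  (* Off [v] the family [nth_visit v m] is stable under dropping the first edge, and at [v] the
     bound is [Kv]. *)
  apply: (@psum_le_superharmonic _ [set v] _ (fun v' => (z ^+ m)%:E * first_passage v v')) => //.
  - by move=> ?; rewrite mule_ge0 ?lee_fin// first_passage_ge0.
  - by move=> _ ->; rewrite -/(nth_passage v m v) Kv first_passage_diag mule1.
  - move=> e u ne eu; rewrite /nth_visit/= frng_tcons// visits_tcons//.
    by rewrite (introF eqP ne).
  - move=> v1 ne; rewrite ifF; last by apply/negP; rewrite inE => -[].
    by rewrite add0e transferZ ?first_passage_out//; exact: first_passage_ge0.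
elim: n => [|n IH]; apply: step; first by rewrite nth_passage0_diag.
(* Each further return to [v] contributes a factor [Zs v], the transfer of [first_passage v] at
   [v]. *)
rewrite nth_passageS_diag exprSr EFinM -Zz ZsE -transferZ//; last exact: first_passage_ge0.
by congr esum; apply/funext => e; rewrite IH.
Qed.

End PathSums.

(** * Superharmonic functions *)

Section Superharmonic.
Variables (R : realType) (E : digraph) (N : edge E -> R) (beta : R).
Hypothesis N_gt0 : forall e, 0 < N e.
Local Notation w := (edge_weight N beta).
Local Notation transfer := (transfer N beta).
Local Notation first_passage := (first_passage N beta).
Local Notation Za := (Za N beta).
Local Notation Zs := (Zs N beta).
Local Notation mbeta := (mbeta N beta).
Implicit Types (g h k l : vert E -> R) (v : vert E).

Definition superharmonic k :=
  (forall v, 0 <= k v) /\ (forall v, transfer (EFin \o k) v <= (k v)%:E)%E.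

(** For superharmonic [k] the transfer is bounded by the finite [k v], so [fine] loses nothing. *)
Definition charge k v : R := k v - fine (transfer (EFin \o k) v).

Lemma superharmonic_transferE k v : superharmonic k ->
  transfer (EFin \o k) v = (k v - charge k v)%:E.
Proof.
move=> [k0 Pk]; rewrite /charge opprB addrCA subrr addr0 fineK//.
rewrite ge0_fin_numE; last by apply: transfer_ge0 => // ?; rewrite lee_fin.
exact: le_lt_trans (Pk v) (ltry _).
Qed.

Lemma charge_ge0 k v : superharmonic k -> 0 <= charge k v.
Proof.
move=> sk; have [_ /(_ v)] := sk.
by rewrite superharmonic_transferE// lee_fin gerBl.
Qed.

Lemma charge_le k v : superharmonic k -> charge k v <= k v.
Proof.
move=> sk; rewrite -subr_ge0 -lee_fin -superharmonic_transferE//.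
by case: sk => k0 _; apply: transfer_ge0 => // ?; rewrite lee_fin.
Qed.

Lemma superharmonic_intro k c : (forall v, 0 <= k v) -> (forall v, 0 <= c v) ->
  (forall v, transfer (EFin \o k) v = (k v - c v)%:E) ->
  superharmonic k /\ charge k = c.
Proof.
move=> k0 c0 Pk; split.
  by split => // v; rewrite Pk lee_fin gerBl.
by apply/funext => v; rewrite /charge Pk/= opprB addrCA subrr addr0.
Qed.

Lemma superharmonicB k l : superharmonic k -> superharmonic l ->
  (forall v, l v <= k v) -> (forall v, charge l v <= charge k v) ->
  superharmonic (k \- l) /\ charge (k \- l) = charge k \- charge l.
Proof.
move=> sk sl lk clk; apply: superharmonic_intro => [v|v|v].
- by rewrite subr_ge0.
- by rewrite subr_ge0.
have kE : EFin \o k = (fun v => (k v - l v)%:E + (l v)%:E)%E.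
  by apply/funext => v' /=; rewrite -EFinD subrK.
have := superharmonic_transferE v sk; rewrite kE transferD//; last 2 first.
- by move=> v'; rewrite lee_fin subr_ge0.
- by move=> v'; rewrite lee_fin; case: sl.
rewrite (superharmonic_transferE v sl) => /(congr1 (fun x => x - (l v - charge l v)%:E)%E).
rewrite addeK// -EFinB => ->; congr EFin => /=; lra.
Qed.

Lemma superharmonicZ c k : 0 <= c -> superharmonic k ->
  superharmonic (fun v => c * k v) /\ charge (fun v => c * k v) = (fun v => c * charge k v).
Proof.
move=> c0 sk; apply: superharmonic_intro => [v|v|v].
- by rewrite mulr_ge0//; case: sk.
- by rewrite mulr_ge0// charge_ge0.
rewrite -mulrBr EFinM -superharmonic_transferE// -transferZ//.
by move=> v'; rewrite lee_fin; case: sk.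
Qed.

Lemma first_passage_superharmonic k v v' : superharmonic k ->
  ((k v)%:E * first_passage v v' <= (k v')%:E)%E.
Proof.
move=> [k0 Pk]; apply: (@first_passage_le _ _ _ _ N_gt0 _ _ (EFin \o k)) => //.
Qed.

(** Superharmonicity bounds k(s(e)) below by N(e)^-beta k(r(e)), so a zero propagates forward along
    every edge. *)
Lemma superharmonic_zero k v v' : superharmonic k -> connected_to v v' ->
  k v = 0 -> k v' = 0.
Proof.
move=> [k0 Pk] [u [<- <-]]; elim/finpath_ind: u => // e u eu IH.
rewrite fsrc_tcons// frng_tcons// => ke; apply: IH; rewrite -eu.
have t0 : transfer (EFin \o k) (src e) = 0%E.
  apply/eqP; rewrite eq_le (le_trans (Pk _)) ?ke//=.
  by apply: transfer_ge0 => // ?; rewrite lee_fin.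
have wk0 e' : (0 <= (w e')%:E * (EFin \o k) (rng e'))%E.
  by rewrite mule_ge0 ?lee_fin// ltW// edge_weight_gt0.
have /eqP := esum_eq0 (fun e' _ => wk0 e') t0 (erefl : out_edges (src e) e).
by rewrite -EFinM eqe mulf_eq0 gt_eqF ?edge_weight_gt0//= => /eqP.
Qed.

(** Summing the comparison of k(v) [first_passage v] with k over all starting vertices bounds k(v)
    Z^a_v by the total mass of k. *)
Lemma Za_lt_pinfty k v : superharmonic k ->
  (\esum_(v in [set: vert E]) (k v)%:E < +oo)%E -> 0 < k v -> (Za v < +oo)%E.
Proof.
move=> sk koo kv; have : ((k v)%:E * Za v < +oo)%E.
  rewrite ZaE// -esumZl ?ltW//; last by move=> v' _; exact: first_passage_ge0.
  by apply: le_lt_trans koo; apply: le_esum => v' _; exact: first_passage_superharmonic.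
rewrite !ltey; apply: contraNneq => ->; apply/eqP.
by rewrite gt0_muley// lte_fin.
Qed.

(** The vertices that are beta-regular or beta-critical, treated together. *)
Definition admissible v := (Za v < +oo)%E /\ (Zs v <= 1)%E.

Definition za v := fine (Za v).
Definition zs v := fine (Zs v).

Lemma Za_ge1 v : (1 <= Za v)%E.
Proof.
rewrite ZaE// -(first_passage_diag beta N_gt0 v); apply: esum_ge1 => // v' _.
exact: first_passage_ge0.
Qed.

Lemma za_gt0 v : (Za v < +oo)%E -> 0 < za v.
Proof.
by move=> Zoo; rewrite fine_gt0// Zoo andbT (lt_le_trans _ (Za_ge1 v))// lte01.
Qed.

Lemma zaE v : (Za v < +oo)%E -> Za v = (za v)%:E.
Proof.
by move=> Zoo; rewrite /za fineK// ge0_fin_numE// (le_trans _ (Za_ge1 v))// lee01.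
Qed.

Lemma Zs_ge0 v : (0 <= Zs v)%E.
Proof. by rewrite ZsE//; apply: transfer_ge0 => // v'; exact: first_passage_ge0. Qed.

Lemma zsE v : admissible v -> Zs v = (zs v)%:E.
Proof.
by move=> [_ Z1]; rewrite /zs fineK// ge0_fin_numE ?Zs_ge0// (le_lt_trans Z1)// ltry.
Qed.

Lemma zs_ge0 v : 0 <= zs v. Proof. by rewrite fine_ge0// Zs_ge0. Qed.

Lemma first_passageE v v' : (Za v < +oo)%E ->
  first_passage v v' = (za v * mbeta v v')%:E.
Proof.
move=> Zoo; have fp_fin : first_passage v v' \is a fin_num.
  rewrite ge0_fin_numE ?first_passage_ge0//; apply: le_lt_trans Zoo.
  by rewrite ZaE//; apply: (@esum_ge1 _ _ _ (first_passage v)) => // ? _; exact: first_passage_ge0.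
rewrite /mbeta (_ : esum _ _ = ((za v)^-1)%:E * first_passage v v')%E; last first.
  rewrite -esumZl ?invr_ge0 ?ltW ?za_gt0//; last first.
    by move=> u _; rewrite mule1 lee_fin ltW// path_weight_gt0.
  rewrite /first_paths_from (_ : mkset _ = first_paths v `&` [set u | fsrc u = v'])//.
  by apply: eq_esum => u _; rewrite mule1 -EFinM mulrC.
rewrite fineM// mulrA mulfV ?gt_eqF ?za_gt0// mul1r fineK//.
Qed.

Lemma mbeta_ge0 v v' : 0 <= mbeta v v'.
Proof.
apply/fine_ge0/esum_ge0 => u _; rewrite lee_fin mulr_ge0//.
  by rewrite ltW// path_weight_gt0.
by rewrite invr_ge0 fine_ge0// (le_trans _ (Za_ge1 v))// lee01.
Qed.

Lemma mbeta_diag v : (Za v < +oo)%E -> mbeta v v = (za v)^-1.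
Proof.
move=> Zoo; have := first_passageE v Zoo; rewrite first_passage_diag// => -[e].
by rewrite -[RHS]mulr1 e mulKf// gt_eqF// za_gt0.
Qed.

Lemma esum_mbeta v : (Za v < +oo)%E -> (\esum_(v' in [set: vert E]) (mbeta v v')%:E = 1)%E.
Proof.
move=> Zoo; rewrite (_ : esum _ _ = ((za v)^-1)%:E * Za v)%E.
  by rewrite zaE// -EFinM mulVf// gt_eqF// za_gt0.
rewrite ZaE// -esumZl ?invr_ge0 ?ltW ?za_gt0//; last first.
  by move=> v' _; exact: first_passage_ge0.
by apply: eq_esum => v' _; rewrite first_passageE// -EFinM mulKf// gt_eqF// za_gt0.
Qed.

Definition mbeta_charge v v' : R := if v' == v then (1 - zs v) / za v else 0.

(** Off [v], removing the first edge shows that first passages to [v] are harmonic. At [v] the first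
    passage sum is 1 while its transfer is Z^s_v, and division by Z^a_v gives the charge. *)
Lemma mbeta_superharmonic_charge v : admissible v ->
  superharmonic (mbeta v) /\ charge (mbeta v) = mbeta_charge v.
Proof.
move=> adm; have [Zoo Z1] := adm; have za0 := za_gt0 Zoo.
apply: superharmonic_intro => [v'|v'|v']; first exact: mbeta_ge0.
  rewrite /mbeta_charge; case: eqP => // _; rewrite divr_ge0 ?(ltW za0)// subr_ge0.
  by rewrite -lee_fin -zsE.
rewrite (_ : EFin \o mbeta v = (fun v' => ((za v)^-1)%:E * first_passage v v')%E); last first.
  by apply/funext => v1 /=; rewrite first_passageE// -EFinM mulKf// gt_eqF.
rewrite transferZ ?invr_ge0 ?ltW//; last exact: first_passage_ge0.
rewrite /mbeta_charge; case: eqP => [->|ne].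
  by rewrite -ZsE// zsE// mbeta_diag// -EFinM; congr EFin; field; rewrite gt_eqF.
by rewrite -first_passage_out// first_passageE// -EFinM mulKf ?gt_eqF// subr0.
Qed.

Lemma mbeta_superharmonic v : admissible v -> superharmonic (mbeta v).
Proof. by move=> /mbeta_superharmonic_charge[]. Qed.

Lemma charge_mbeta v : admissible v -> charge (mbeta v) = mbeta_charge v.
Proof. by move=> /mbeta_superharmonic_charge[]. Qed.

Lemma mbeta_le k v v' : superharmonic k -> (Za v < +oo)%E ->
  k v * za v * mbeta v v' <= k v'.
Proof.
move=> sk Zoo; rewrite -mulrA -lee_fin EFinM -first_passageE//.
exact: first_passage_superharmonic.
Qed.

Lemma mbeta_gt0P v v' : admissible v -> 0 < mbeta v v' <-> connected_to v' v.
Proof.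
move=> adm; have [Zoo Z1] := adm; split; last first.
  move=> vv; rewrite lt_neqAle mbeta_ge0 andbT eq_sym; apply/eqP => /(superharmonic_zero _ vv).
  by rewrite mbeta_diag// => /(_ (mbeta_superharmonic adm))/eqP; rewrite invr_eq0 gt_eqF// za_gt0.
move=> m0; apply: contrapT => nc; move: m0.
rewrite /mbeta (_ : first_paths_from v' v = set0) ?esum_set0 ?ltxx//.
by rewrite -subset0 => u [[ru _] su]; apply: nc; exists u.
Qed.

(* [mbeta v] spans an extreme ray of the cone of superharmonic functions. *)
Lemma mbeta_minimal k v : admissible v -> superharmonic k ->
  superharmonic (mbeta v \- k) -> forall v', k v' = k v * za v * mbeta v v'.
Proof.
move=> adm sk smk v'; have [Zoo Z1] := adm.
apply/eqP; rewrite eq_le (mbeta_le v' sk Zoo) andbT.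
have := mbeta_le v' smk Zoo => /=; rewrite mbeta_diag// mulrBl mulVf ?gt_eqF ?za_gt0//.
by rewrite mulrBl mul1r; lra.
Qed.

(** Both functions have total mass 1, so summation forces [c = c'] once [c'] is known to be
    nonnegative. *)
Lemma mbeta_scale_eq c c' v v' : (Za v < +oo)%E -> (Za v' < +oo)%E -> 0 < c ->
  (forall v1, c * mbeta v v1 = c' * mbeta v' v1) -> mbeta v = mbeta v'.
Proof.
move=> Zv Zv' c0 e.
have c'0 : 0 <= c'.
  rewrite leNgt; apply/negP => c'0; have := e v; rewrite mbeta_diag// => /eqP.
  apply/negP; rewrite gt_eqF//; apply: (@le_lt_trans _ _ 0).
    by rewrite mulr_le0_ge0// ?mbeta_ge0 ?(ltW c'0).
  by rewrite mulr_gt0// invr_gt0 za_gt0.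
have : (c%:E * (\esum_(v1 in [set: vert E]) (mbeta v v1)%:E) =
       c'%:E * (\esum_(v1 in [set: vert E]) (mbeta v' v1)%:E))%E.
  rewrite -!esumZl// ?(ltW c0)// => [|? _|? _]; rewrite ?lee_fin ?mbeta_ge0//.
  by apply: eq_esum => v1 _; rewrite -!EFinM e.
rewrite !esum_mbeta// !mule1 => -[cc]; apply/funext => v1.
by have := e v1; rewrite -cc => /mulfI; apply; rewrite gt_eqF.
Qed.

Definition critical v := (Za v < +oo)%E /\ Zs v = 1%E.

Lemma critical_admissible v : critical v -> admissible v.
Proof. by move=> [Zoo Z1]; split; rewrite // Z1. Qed.

Lemma charge_critical v v' : critical v -> charge (mbeta v) v' = 0.
Proof.
move=> cv; rewrite charge_mbeta ?/mbeta_charge; last exact: critical_admissible.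
by case: eqP => // _; rewrite /zs (proj2 cv) subrr mul0r.
Qed.

(** By minimality a positive multiple of [mbeta v] lies below [mbeta v']. Since [v] is critical this
    multiple has no charge, so the difference is still superharmonic, and extremality of the ray of
    [mbeta v'] makes the two proportional. *)
Lemma mbeta_eq v v' : critical v -> admissible v' -> connected_to v v' ->
  mbeta v = mbeta v'.
Proof.
move=> cv av' vv'; have av := critical_admissible cv.
have c0 : 0 < mbeta v' v by apply/mbeta_gt0P.
have zav := za_gt0 (proj1 cv).
have [sk ck] := @superharmonicZ (mbeta v' v * za v) (mbeta v)
  (mulr_ge0 (ltW c0) (ltW zav)) (mbeta_superharmonic av).
have [] := superharmonicB (mbeta_superharmonic av') sk.
- by move=> v1; apply: mbeta_le (proj1 cv); exact: mbeta_superharmonic.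
- move=> v1; rewrite ck charge_critical// mulr0.
  by apply: charge_ge0; exact: mbeta_superharmonic.
move=> smk _; have kE := mbeta_minimal av' sk smk.
apply: (mbeta_scale_eq (proj1 cv) (proj1 av') _ kE).
by rewrite mulr_gt0.
Qed.

End Superharmonic.

(** * Riesz decomposition *)

Section RieszDecomposition.
Variables (R : realType) (E : digraph) (N : edge E -> R) (beta : R).
Hypothesis N_gt0 : forall e, 0 < N e.
Local Notation transfer := (transfer N beta).
Local Notation first_passage := (first_passage N beta).
Local Notation Za := (Za N beta).
Local Notation Zs := (Zs N beta).
Local Notation za := (za N beta).
Local Notation zs := (zs N beta).
Local Notation mbeta := (mbeta N beta).
Local Notation superharmonic := (superharmonic N beta).
Local Notation charge := (charge N beta).
Local Notation admissible := (admissible N beta).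
Local Notation critical := (critical N beta).
Implicit Types (g h k l a : vert E -> R) (v : vert E).

(** Left open, because the decomposition is applied both to all the extremal vertices and to the
    regular ones alone. *)
Variable A : set (vert E).
Hypothesis admA : forall v, A v -> admissible v.
Let M := mbeta @` A.

Lemma admissible_critical v : admissible v -> zs v = 1 -> critical v.
Proof. by move=> adm z1; split; [case: adm | rewrite zsE// z1]. Qed.

Lemma zs_le1 v : admissible v -> zs v <= 1.
Proof. by move=> adm; rewrite -lee_fin -zsE//; case: adm. Qed.

(** Applying the transfer at [v] to the comparison of k(v) [first_passage v] with k gives k(v) Z^s_v
    <= k(v) - [charge k v]. *)
Lemma superharmonic_charge_le k v : superharmonic k -> admissible v ->
  charge k v <= k v * (1 - zs v).
Proof.
move=> sk adm; have [k0 _] := sk; rewrite mulrBr mulr1 lerBrDl -lerBrDr.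
rewrite -lee_fin EFinM -zsE// ZsE// -transferZ//; last exact: first_passage_ge0.
rewrite -superharmonic_transferE//; apply: le_transfer => // v'.
exact: first_passage_superharmonic.
Qed.

Lemma zs_lt1 k v : superharmonic k -> admissible v -> 0 < charge k v -> zs v < 1.
Proof.
move=> sk adm /lt_le_trans/(_ (superharmonic_charge_le sk adm)) h.
by rewrite ltNge; apply/negP => z1; move: h; rewrite ltNge mulr_ge0_le0// ?subr_le0//; case: sk.
Qed.

(* The weight of [mbeta v] in the decomposition of [g]; as a function of [mbeta v] it does
   not depend on [v]. *)
Definition ray_weight g v : R :=
  if zs v == 1 then g v * za v else charge g v * za v / (1 - zs v).

(** Indexed by the function and not by a vertex, because equivalent critical vertices span the same
    ray. The default 0 keeps it nonnegative off [M]. *)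
Definition ray_coef g a : R :=
  xget 0 [set r | exists v, [/\ A v, mbeta v = a & r = ray_weight g v]].

Lemma ray_coefE g a : M a -> exists v, [/\ A v, mbeta v = a & ray_coef g a = ray_weight g v].
Proof.
move=> [v Av va]; rewrite /ray_coef; case: xgetP => [r _ //|/(_ (ray_weight g v))[]].
by exists v.
Qed.

Lemma ray_weight_ge0 g v : superharmonic g -> admissible v -> 0 <= ray_weight g v.
Proof.
move=> sg adm; rewrite /ray_weight; have [Zoo _] := adm; have za0 := ltW (za_gt0 N_gt0 Zoo).
case: ifPn => [_|_]; first by rewrite mulr_ge0//; case: sg.
by rewrite divr_ge0 ?subr_ge0 ?zs_le1// mulr_ge0// charge_ge0.
Qed.

Lemma ray_coef_ge0 g a : superharmonic g -> 0 <= ray_coef g a.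
Proof.
move=> sg; rewrite /ray_coef; case: xgetP => // _ -> [v [Av _ ->]].
by apply: ray_weight_ge0 => //; exact: admA.
Qed.

Lemma M_superharmonic a : M a -> superharmonic a.
Proof. by move=> [v Av <-]; apply: mbeta_superharmonic => //; exact: admA. Qed.

(** The rays can be subtracted one after the other because they do not interfere: the coefficient of
    the ray of [v] is read off at [v], from the value if [v] is critical and from the charge
    otherwise, and the rays already removed do not change that quantity. *)
Lemma peel_rays g (s : seq (vert E -> R)) : superharmonic g -> uniq s ->
  (forall a, a \in s -> M a) ->
  superharmonic (fun v => g v - \sum_(a <- s) ray_coef g a * a v) /\
  charge (fun v => g v - \sum_(a <- s) ray_coef g a * a v) =
    (fun v => charge g v - \sum_(a <- s) ray_coef g a * charge a v).
Proof.
move=> sg; elim: s => [_ _|a s IH /= /andP[as_ us] sM].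
  rewrite [X in superharmonic X](_ : _ = g); last by apply/funext => v; rewrite big_nil subr0.
  by split => //; apply/funext => v; rewrite big_nil subr0; congr charge; apply/funext => ?; rewrite big_nil subr0.
have sM' b : b \in s -> M b by move=> bs; apply: sM; rewrite inE bs orbT.
have {IH}[sh ch] := IH us sM'.
set h := (fun v => g v - \sum_(a <- s) _) in sh ch.
have [v [Av va tE]] := ray_coefE g (sM a (mem_head _ _)).
have adm := admA Av; have [Zoo _] := adm; have za0 := za_gt0 N_gt0 Zoo.
have t0 := ray_coef_ge0 a sg; have sa := M_superharmonic (sM a (mem_head _ _)).
have [sta cta] := superharmonicZ N_gt0 t0 sa.
have [tah ctah] : (forall v', ray_coef g a * a v' <= h v') /\
    (forall v', ray_coef g a * charge a v' <= charge h v').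
  move: tE; rewrite /ray_weight; case: eqP => [z1|/eqP z1] tE.
    have crit := admissible_critical adm z1.
    (* A ray [mbeta w] positive at the critical vertex [v] has a path from [v] to [w], hence equals
       [mbeta v], which is not in the list. *)
    have hv : h v = g v.
      rewrite /h big_seq big1 ?subr0// => b bs; have [w Aw wb] := sM' b bs.
      apply/eqP; rewrite mulf_eq0; apply/orP; right; rewrite -wb.
      apply: contraNT as_ => mwv; have /mbeta_gt0P-/(_ N_gt0 (admA Aw)) vw : 0 < mbeta w v.
        by rewrite lt_neqAle eq_sym mwv mbeta_ge0.
      by rewrite -va (mbeta_eq N_gt0 crit (admA Aw) vw) wb.
    split => v'; rewrite tE -va -hv; first exact: mbeta_le.
    by rewrite charge_critical// mulr0 charge_ge0.
  have z1' : 0 < 1 - zs v by rewrite subr_gt0 lt_neqAle z1 zs_le1.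
  (* The other rays carry their charge at other vertices. *)
  have hv : charge h v = charge g v.
    rewrite ch big_seq big1 ?subr0// => b bs; have [w Aw wb] := sM' b bs.
    rewrite -wb charge_mbeta//; last exact: admA.
    rewrite /mbeta_charge; case: eqP => [vw|]; last by rewrite mulr0.
    by move: as_; rewrite -va vw wb bs.
  split => v'; rewrite tE -va.
    (* The charge of [h] at [v] is at most h(v) (1 - Z^s_v), so the coefficient is at most h(v)
       Z^a_v, the multiple that minimality allows. *)
    apply: le_trans (mbeta_le N_gt0 v' sh Zoo); rewrite ler_wpM2r ?mbeta_ge0//.
    rewrite mulrAC ler_wpM2r ?(ltW za0)// ler_pdivrMr// -hv.
    exact: superharmonic_charge_le.
  rewrite charge_mbeta// /mbeta_charge; case: eqP => [->|_]; last by rewrite mulr0 charge_ge0.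
  by rewrite hv mulrA divfK ?gt_eqF// mulfK// gt_eqF.
have [] := superharmonicB N_gt0 sh sta tah.
  by move=> v'; rewrite cta.
rewrite cta ch (_ : h \- _ = (fun v => g v - \sum_(a0 <- a :: s) ray_coef g a0 * a0 v)); last first.
  by apply/funext => v'; rewrite big_cons /h /=; lra.
move=> sh' ->; split => //; apply/funext => v'; rewrite big_cons /=; lra.
Qed.

Local Open Scope ereal_scope.

(** Finite peelings bound every partial sum by g and by its charge. Hence the full sum [f] and its
    charge [c] are finite, and [h] is what remains of g. *)
Lemma riesz_decomposition g : superharmonic g ->
  exists h, [/\ superharmonic h,
    forall v, (g v)%:E = \esum_(a in M) (ray_coef g a * a v)%:E + (h v)%:E &
    forall v, (charge g v)%:E = \esum_(a in M) (ray_coef g a * charge a v)%:E + (charge h v)%:E].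
Proof.
move=> sg; pose t := ray_coef g.
have fsum (X : set (vert E -> R)) (F : (vert E -> R) -> R) : fsets M X ->
    exists s, [/\ uniq s, (forall a, a \in s -> M a) &
      \sum_(a \in X) (F a)%:E = (\sum_(a <- s) F a)%:E].
  move=> [fX XM]; exists (finmap.enum_fset (fset_set X)); split.
  - exact: finmap.fset_uniq.
  - by move=> a; rewrite in_fset_set// inE; exact: XM.
  - by rewrite fsbig_finite// sumEFin.
pose f v := \esum_(a in M) (t a * a v)%:E.
pose c v := \esum_(a in M) (t a * charge a v)%:E.
have ta0 a v : M a -> (0 <= t a * a v)%R.
  by move=> Ma; rewrite mulr_ge0 ?ray_coef_ge0//; case: (M_superharmonic Ma).
have tca0 a v : M a -> (0 <= t a * charge a v)%R.
  by move=> Ma; rewrite mulr_ge0 ?ray_coef_ge0// charge_ge0//; exact: M_superharmonic.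
have fg v : f v <= (g v)%:E.
  apply: esum_leP => X /fsum-/(_ (fun a => t a * a v)%R)[s [us sM ->]].
  have [[h0 _] _] := peel_rays sg us sM.
  by rewrite lee_fin -subr_ge0; exact: h0.
have cg v : c v <= (charge g v)%:E.
  apply: esum_leP => X /fsum-/(_ (fun a => t a * charge a v)%R)[s [us sM ->]].
  have [sh ch] := peel_rays sg us sM.
  by rewrite lee_fin -subr_ge0; have := charge_ge0 N_gt0 v sh; rewrite ch.
have f0 v : 0 <= f v by apply: esum_ge0 => a Ma; rewrite lee_fin ta0.
have c0 v : 0 <= c v by apply: esum_ge0 => a Ma; rewrite lee_fin tca0.
have fE v : f v = (fine (f v))%:E.
  by rewrite fineK// ge0_fin_numE// (le_lt_trans (fg v))// ltry.
have cE v : c v = (fine (c v))%:E.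
  by rewrite fineK// ge0_fin_numE// (le_lt_trans (cg v))// ltry.
pose h v := (g v - fine (f v))%R.
have [sh ch] : superharmonic h /\ charge h = (fun v => charge g v - fine (c v))%R.
  apply: superharmonic_intro => v.
  - by rewrite subr_ge0 -lee_fin -fE.
  - by rewrite subr_ge0 -lee_fin -cE.
  (* The transfer commutes with sums of nonnegative functions, so this holds ray by ray. *)
  have tf : transfer f v + c v = f v.
    have -> : transfer f v = \esum_(a in M) transfer (fun v => (t a * a v)%:E) v.
      by apply: transfer_esum => // a v' Ma; rewrite lee_fin ta0.
    rewrite /f /c -esumD; last 2 first.
    - by move=> a Ma; apply: transfer_ge0 => // v'; rewrite lee_fin ta0.
    - by move=> a Ma; rewrite lee_fin tca0.
    apply: eq_esum => a Ma; have sa := M_superharmonic Ma.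
    rewrite [X in X + _](_ : _ = (t a)%:E * transfer (EFin \o a) v); last first.
      rewrite -transferZ ?ray_coef_ge0//.
      by move=> v'; rewrite lee_fin; case: sa.
    by rewrite superharmonic_transferE// -EFinM -EFinD; congr EFin; ring.
  have tg : transfer (EFin \o g) v = transfer (EFin \o h) v + transfer f v.
    rewrite -transferD//; last by move=> v'; rewrite /= lee_fin subr_ge0 -lee_fin -fE.
    by congr esum; apply/funext => e /=; rewrite fE -EFinD subrK.
  have tff : transfer f v \is a fin_num.
    rewrite ge0_fin_numE; last exact: transfer_ge0.
    apply: (@le_lt_trans _ _ (f v)); last by rewrite fE ltry.
    by rewrite -tf leeDl.
  move: tg; rewrite superharmonic_transferE// => /(congr1 (fun x => x - transfer f v)).
  have fe : fine (f v) = (fine (transfer f v) + fine (c v))%R.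
    by apply: EFin_inj; rewrite -fE -tf EFinD -cE fineK.
  by rewrite addeK// => <-; rewrite -(fineK tff) -EFinB /h fe; congr EFin => /=; lra.
exists h; split => // v.
- by rewrite -/(f v) fE -EFinD /h; congr EFin; lra.
- by rewrite -/(c v) cE ch -EFinD; congr EFin; lra.
Qed.

End RieszDecomposition.

(** * The path space *)

Lemma mkseq_cons (T : Type) (f : nat -> T) k :
  mkseq f k.+1 = f 0%N :: mkseq (fun n => f n.+1) k.
Proof. by rewrite /mkseq/= (iotaDl 1 0) -map_comp. Qed.

Section PathSpace.
Variable E : digraph.
Implicit Types (u : finpath E) (e : edge E) (v : vert E) (x : pathspace E) (y : infpath E).

Lemma chain_mkseq y v k : v = src (iedge y 0) -> chain v (mkseq (iedge y) k).
Proof.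
elim: k y v => // k IH y v vy; rewrite mkseq_cons/= vy eqxx/=.
pose y' := @Infpath E (fun n => iedge y n.+1) (fun n => iedgeP y n.+1).
exact: (IH y' (rng (iedge y 0)) (iedgeP y 0)).
Qed.

Definition ipre y k : finpath E := @Finpath E (src (iedge y 0), mkseq (iedge y) k) (chain_mkseq k erefl).

Lemma len_ipre y k : len (ipre y k) = k.
Proof. by rewrite /len size_mkseq. Qed.

Lemma ple_Inf u y : ple u (Inf y) <-> u = ipre y (len u).
Proof.
split => [[su eu]|->]; first exact: finpath_eq.
by split => //=; rewrite size_mkseq.
Qed.

Lemma ple_ipre y k : ple (ipre y k) (Inf y).
Proof. by apply/ple_Inf; rewrite len_ipre. Qed.

Lemma ple_refl u : ple u (Fin u).
Proof. by split => //; exact: prefix_refl. Qed.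

Lemma ple_len u u' : ple u (Fin u') -> (len u <= len u')%N.
Proof. by move=> [_]; exact: size_prefix. Qed.

Lemma ple_anti_len u u' : ple u (Fin u') -> (len u' <= len u)%N -> u = u'.
Proof.
move=> [su /prefixP[s es]]; rewrite /len es size_cat -leq_subRL// subnn leqn0 size_eq0 => /eqP s0.
by apply: finpath_eq => //; rewrite es s0 cats0.
Qed.

Lemma ple_trans u u' x : ple u (Fin u') -> ple u' x -> ple u x.
Proof.
case: x => [u''|y] /= [su pu] [su' pu'].
  by split; [rewrite su | exact: prefix_trans pu'].
split; first by rewrite su.
have la : (size (fedges u) <= size (fedges u'))%N by exact: size_prefix.
move: pu => /prefixP[s es].
have ue : fedges u = take (size (fedges u)) (fedges u') by rewrite es take_size_cat.
by rewrite {1}ue pu' /mkseq -map_take take_iota (minn_idPl la).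
Qed.

Lemma ple_total u u' x : ple u x -> ple u' x -> (len u <= len u')%N -> ple u (Fin u').
Proof.
case: x => [u''|y].
  move=> [su /prefixP[s es]] [su' /prefixP[s' es']] le; split; first by rewrite su su'.
  apply/prefixP; exists (drop (len u) (fedges u')).
  rewrite -{1}(cat_take_drop (len u) (fedges u')); congr (_ ++ _).
  have := congr1 (take (len u)) es'; rewrite es take_size_cat// => ->.
  by rewrite takel_cat.
move=> /ple_Inf -> /ple_Inf ->; rewrite !len_ipre => le; split => //=.
apply/prefixP; exists (drop (len u) (mkseq (iedge y) (len u'))).
rewrite [fedges (ipre y (len u))](_ : _ = take (len u) (mkseq (iedge y) (len u'))).
  by rewrite cat_take_drop.
by rewrite /= /mkseq -map_take take_iota (minn_idPl le).
Qed.

(** A finite path is the longest of its own initial segments, while an infinite path has segments of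
    every length. *)
Lemma pathspace_eq x x' : (forall u, ple u x <-> ple u x') -> x = x'.
Proof.
have ff w y : ~ (forall u, ple u (Fin w) <-> ple u (Inf y)).
  move=> /(_ (ipre y (len w).+1))[_ /(_ (ple_ipre _ _))/ple_len].
  by rewrite len_ipre ltnn.
case: x x' => [w|y] [w'|y'] h; last 1 first.
- have h' n : ipre y n = ipre y' n.
    by have /ple_Inf := (h _).1 (ple_ipre y n); rewrite len_ipre.
  have ee : iedge y = iedge y'.
    apply/funext => n; have := congr1 (fun u => nth (iedge y n) (fedges u) n) (h' n.+1).
    by rewrite /= !nth_mkseq.
  congr Inf; case: y y' ee {h h'} => [f p] [f' p'] /= ff'; subst f'; congr Infpath.
  exact: Prop_irrelevance.
- congr Fin; apply: ple_anti_len; first exact/(h w).1/ple_refl.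
  exact/ple_len/(h w').2/ple_refl.
- by case: (ff _ _ h).
- by case: (ff w' y) => u; rewrite h.
Qed.

(** If the lengths in [S] are bounded, its longest member is the path sought. Otherwise any two
    members long enough to have an edge number [n] agree on it, and these edges form an infinite
    path. *)
Lemma pathspace_of_segments (S : set (finpath E)) : S !=set0 ->
  (forall u u', S u' -> ple u (Fin u') -> S u) ->
  (forall u u', S u -> S u' -> (len u <= len u')%N -> ple u (Fin u')) ->
  exists x, forall u, ple u x <-> S u.
Proof.
move=> [u0 Su0] down comp.
have [[n Sn]|unb] := pselect (exists n, forall u, S u -> (len u < n)%N).
  have ex : exists i, `[< exists2 u, S u & len u = i >] by exists (len u0); apply/asboolP; exists u0.
  have bnd i : `[< exists2 u, S u & len u = i >] -> (i <= n)%N.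
    by move=> /asboolP[u Su <-]; apply/ltnW/Sn.
  have [k /asboolP[u1 Su1 lu1] max] := ex_maxnP ex bnd.
  exists (Fin u1) => u; split => [|Su]; first exact: down.
  apply: comp => //; rewrite lu1; apply: max; apply/asboolP.
  by exists u.
have ch n : exists u, S u /\ (n < len u)%N.
  apply: contrapT => h; apply: unb; exists n.+1 => u Su; rewrite ltnS leqNgt.
  by apply/negP => nu; apply: h; exists u.
have [e0 _] : exists e0 : edge E, True.
  by have [u [_]] := ch 0%N; rewrite /len; case: (fedges u) => // e; exists e.
(* [f n] is some member of [S] with more than [n] edges; [edE] shows that its edge number [n] does
   not depend on the choice. *)
pose f n := xget u0 [set u | S u /\ (n < len u)%N].
have fP n : S (f n) /\ (n < len (f n))%N.
  rewrite /f; case: xgetP => [u _ //|/(_ _)h].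
  by have [u /h] := ch n.
pose ed n := nth e0 (fedges (f n)) n.
have edE u n : S u -> (n < len u)%N -> nth e0 (fedges u) n = ed n.
  move=> Su nu; have [Sf nf] := fP n.
  have pre u1 u2 : (n < len u1)%N -> ple u1 (Fin u2) ->
      nth e0 (fedges u1) n = nth e0 (fedges u2) n.
    by move=> n1 [_ /prefixP[s ->]]; rewrite nth_cat ifT.
  by have /orP[|] := leq_total (len u) (len (f n)) => le; [|apply/esym];
    apply: pre => //; apply: comp.
have chn v s i : chain v s -> (i.+1 < size s)%N -> rng (nth e0 s i) = src (nth e0 s i.+1).
  elim: s v i => // e s IH v i /= /andP[_ cs]; rewrite ltnS => lt.
  case: i lt => [|i] lt; last exact: IH cs lt.
  by case: s {IH} cs lt => //= e' s /andP[/eqP].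
have edP n : rng (ed n) = src (ed n.+1).
  have [Sf nf] := fP n.+1.
  rewrite -(edE (f n.+1) n)// 1?ltnW// -(edE (f n.+1) n.+1)//.
  by apply: chn nf; exact: (fpath_valP (f n.+1)).
pose y := Infpath edP.
have Sy u : S u -> u = ipre y (len u).
  move=> Su; apply: finpath_eq => /=.
    have [Sf nf] := fP 0%N.
    have su u1 u2 : S u1 -> S u2 -> fsrc u1 = fsrc u2.
      by move=> S1 S2; have /orP[|] := leq_total (len u1) (len u2) => le; [|apply/esym];
        have [] := comp _ _ _ _ le.
    rewrite (su u (f 0%N))// -[RHS]/(src (nth e0 (fedges (f 0%N)) 0)).
    by case: (f 0%N) nf => -[v [|e s]] c //= _; have /= /andP[/eqP sv _] := c.
  apply: (@eq_from_nth _ e0); first by rewrite size_mkseq.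
  by move=> i iu; rewrite nth_mkseq// edE.
exists (Inf y) => u; split => [/ple_Inf uE|Su]; last exact/ple_Inf/Sy.
have [Sf nf] := fP (len u); apply: down (Sf) _.
apply: (@ple_total _ _ (Inf y)); [exact/ple_Inf|exact/ple_Inf/Sy|exact: ltnW].
Qed.

Lemma ple_pcons e u x (h : rng e = psrc x) : rng e = fsrc u ->
  ple (tcons e u) (pcons h) <-> ple u x.
Proof.
move=> eu; case: x h => [u'|y] h.
  by rewrite [pcons h]/= -(tconsE h) (ple_tcons eu h); split => [[]|].
rewrite /= (fsrc_tcons eu) (fedges_tcons eu) [size _]/= mkseq_cons/=.
split => [[_ [ue]]|[ue ee]]; last by split => //; congr cons.
by split => //; rewrite -eu h.
Qed.

Lemma ple_tcons_pcons e u x : rng e = fsrc u -> ple (tcons e u) x ->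
  exists x' (h : rng e = psrc x'), x = pcons h.
Proof.
move=> eu; case: x => [u'|y].
  have [->|[e' [u1 [eu' ->]]]] := finpath_case u'; first by move/(ple_tcons_fvertex eu).
  move=> /(ple_tcons eu eu')[ee _]; subst e'.
  by exists (Fin u1), eu' => /=; rewrite -tconsE.
rewrite /= (fsrc_tcons eu) (fedges_tcons eu) [size _]/= mkseq_cons => -[_ [ee _]].
pose y' := @Infpath E (fun n => iedge y n.+1) (fun n => iedgeP y n.+1).
have h : rng e = psrc (Inf y') by rewrite ee; exact: iedgeP.
exists (Inf y'), h; apply: pathspace_eq => u1; rewrite !ple_Inf /ipre.
have -> : icons h = y; last by [].
have ff : icons_fun e y' = iedge y by apply/funext => -[|n].
rewrite /icons; move: (icons_subproof h); rewrite ff => p'.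
case: y {y' h ee ff} p' => f p /= p'; congr Infpath; exact: Prop_irrelevance.
Qed.

Lemma ple_src u x : ple u x -> fsrc u = psrc x.
Proof. by case: x => [u'|y] []. Qed.

Lemma pcons_inj e x x' (h : rng e = psrc x) (h' : rng e = psrc x') :
  pcons h = pcons h' -> x = x'.
Proof.
move=> hh; apply: pathspace_eq => u.
have [eu|eu] := pselect (rng e = fsrc u).
  by rewrite -(ple_pcons h eu) -(ple_pcons h' eu) hh.
have aux x1 (h1 : rng e = psrc x1) : ~ ple u x1.
  by move=> p; apply: eu; rewrite h1; case: x1 h1 p => [u1|y1] ? [].
by split => p; [case: (aux x h p)|case: (aux x' h' p)].
Qed.

Lemma open_cylinder u : open (cylinder u).
Proof.
exists [set cylinder u]; last by rewrite bigcup_set1.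
move=> _ ->; exists [fset cylinder u]%fset.
  by move=> B /fset1P ->; rewrite inE; left; exists u.
by rewrite set_fset1 bigcap_set1.
Qed.

Lemma closed_cylinder u : closed (cylinder u).
Proof.
rewrite -openC; exists [set ~` cylinder u]; last by rewrite bigcup_set1.
move=> _ ->; exists [fset ~` cylinder u]%fset.
  by move=> B /fset1P ->; rewrite inE; right; exists u.
by rewrite set_fset1 bigcap_set1.
Qed.

(** Basic open sets are finite intersections of cylinders and complements of cylinders, so
    convergence can be tested on the subbase. *)
Lemma cvg_pathspace (F : set_system (pathspace E)) x : Filter F ->
  (forall u, ple u x -> F (cylinder u)) -> (forall u, ~ ple u x -> F (~` cylinder u)) ->
  F --> x.
Proof.
move=> FF Fin Fout U; rewrite nbhsE => -[V [[D DI <-] [B DB Bx]]] VU.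
apply: filterS VU _; have [D' D'I BE] := DI _ DB.
apply: (@filterS _ _ _ B); first by move=> z Bz; exists B.
rewrite -BE; apply: filter_bigI => C CD'; have := D'I _ CD'; rewrite inE.
have Cx : C x by move: Bx; rewrite -BE; apply.
by move=> [[u _ uC]|[u _ uC]]; move: Cx; rewrite /= -uC; [exact: Fin|exact: Fout].
Qed.

End PathSpace.

(** * The boundary and its Borel sets *)

Lemma chain_cat (E : digraph) (v : vert E) (l s : seq (edge E)) :
  chain v (l ++ s) = chain v l && chain (last v (map rng l)) s.
Proof. by elim: l v => //= e l IH v; rewrite IH andbA. Qed.

Section BoundaryTopology.
Variables (E : digraph) (Rg : set (vert E)) (p : boundary Rg).
Implicit Types (u : finpath E) (e : edge E) (v : vert E) (x : pathspace E) (y : infpath E) (S : set (finpath E)).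

Definition cyls S : set (pathspace E) := \bigcup_(u in S) cylinder u.

Lemma open_trace (B : set (pathspace E)) : open B -> open (trace p B).
Proof. by move=> oB; exists B. Qed.

Lemma open_trace_cyls S : open (trace p (cyls S)).
Proof. by apply: open_trace; apply: bigcup_open => u _; exact: open_cylinder. Qed.

(** Distinct points differ in an initial segment, and its cylinder is clopen. This makes compact
    sets closed, hence Borel. *)
Lemma boundary_hausdorff : hausdorff_space (boundary_at p).
Proof.
rewrite open_hausdorff => x1 x2 ne.
have [u [[h1 h2]|[h1 h2]]] : exists u,
    ple u (set_val x1) /\ ~ ple u (set_val x2) \/ ~ ple u (set_val x1) /\ ple u (set_val x2).
  apply: contrapT => h; move/eqP: ne; apply; apply/val_inj/pathspace_eq => u.
  split=> hu; apply: contrapT => hu'; apply: h; exists u; [by left|by right].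
- exists (trace p (cylinder u), trace p (~` cylinder u)); rewrite ?inE//; split.
  + exact/open_trace/open_cylinder.
  + exact/open_trace/closed_openC/closed_cylinder.
  + by apply/seteqP; split => z // [].
- exists (trace p (~` cylinder u), trace p (cylinder u)); rewrite ?inE//; split.
  + exact/open_trace/closed_openC/closed_cylinder.
  + exact/open_trace/open_cylinder.
  + by apply/seteqP; split => z // [].
Qed.

Definition borel_trace (B : set (pathspace E)) : set (borelType (boundary_at p)) := trace p B.

Lemma open_borel (U : set (boundary_at p)) : open U -> measurable (U : set (borelType (boundary_at p))).
Proof. by move=> oU; apply: sub_sigma_algebra. Qed.

Lemma measurable_trace_cyls S : measurable (borel_trace (cyls S)).
Proof. by apply: (@open_borel (trace p (cyls S))); exact: open_trace_cyls. Qed.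

Lemma measurable_trace_cylinder u : measurable (borel_trace (cylinder u)).
Proof. by apply: (@open_borel (trace p (cylinder u))); exact/open_trace/open_cylinder. Qed.

Lemma compact_borel (K : set (boundary_at p)) : compact K ->
  measurable (K : set (borelType (boundary_at p))).
Proof.
move=> cK; have clK : closed K by apply: compact_closed cK; exact: boundary_hausdorff.
rewrite -[X in measurable X]setCK; apply/measurableC.
by apply: (@open_borel (~` K)); exact: closed_openC.
Qed.

Lemma edge_mul_cylinder e u : rng e = fsrc u ->
  edge_mul e (trace p (cylinder u)) = trace p (cylinder (tcons e u)).
Proof.
move=> eu; apply/seteqP; split => [z [x [h [ux zx]]]|z zu].
  by rewrite /trace/= zx; exact/ple_pcons.
have [x [h zx]] := ple_tcons_pcons eu zu.
(* Removing the first edge does not change the range of a finite path, so the tail stays in the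
   boundary. *)
have bx : boundary_set Rg x.
  have : boundary_set Rg (set_val z) by exact: set_valP.
  rewrite zx; case: x h {zx} => [u'|y] h.
    move=> [[]//|[u1 /= nR [ru1]]]; right; exists u' => //.
    by move: nR; rewrite ru1 -tconsE frng_tcons.
  by left; exists y.
exists (SigSub (mem_set bx)), h; split => //=.
by rewrite /trace/=; move: zu; rewrite /trace/= zx; exact: (iffLR (ple_pcons h eu)).
Qed.

Lemma cyls_len_Inf n y : cyls [set u | len u = n] (Inf y).
Proof. by exists (ipre y n); [rewrite /= len_ipre | exact: ple_ipre]. Qed.

Lemma infinite_pathsE : @infinite_paths E = \bigcap_n cyls [set u | len u = n].
Proof.
apply/seteqP; split => [_ [y _ <-] n _|[u|y] h]; first exact: cyls_len_Inf.
  have [u' /= lu' /ple_len] := h (len u).+1 I.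
  by rewrite lu' ltnn.
by exists y.
Qed.

Lemma measurable_infinite_paths : measurable (borel_trace (@infinite_paths E)).
Proof.
rewrite infinite_pathsE (_ : borel_trace _ = \bigcap_n borel_trace (cyls [set u | len u = n]))//.
by apply: bigcap_measurable => // n _; exact: measurable_trace_cyls.
Qed.

Lemma finite_infinite_pathsC : @finite_paths E = ~` @infinite_paths E.
Proof.
apply/seteqP; split => [_ [u _ <-] [y]//|[u|y] h]; first by exists u.
by exfalso; apply: h; exists y.
Qed.

(** Having at least [n.+1] visits is an open condition, which exhibits this set as a countable
    intersection of open sets and gives decreasing approximations of known mass. *)
Definition infinitely_often v : set (pathspace E) := \bigcap_n cyls (nth_visit v n).

Lemma ipre0 y : ipre y 0 = fvertex (src (iedge y 0)).
Proof. exact: finpath_eq. Qed.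

Lemma frng_ipreS y k : frng (ipre y k.+1) = rng (iedge y k).
Proof.
by rewrite /frng (_ : fedges _ = mkseq (iedge y) k.+1)// mkseqS map_rcons last_rcons.
Qed.

Lemma visits_ipreS v y k :
  visits v (ipre y k.+1) = (visits v (ipre y k) + (frng (ipre y k.+1) == v))%N.
Proof.
by rewrite frng_ipreS /visits (_ : fedges _ = mkseq (iedge y) k.+1)// mkseqS map_rcons -rcons_cons -cats1 count_cat/= addn0.
Qed.

Lemma visits_le_len v u : (visits v u <= (len u).+1)%N.
Proof. by rewrite /visits (leq_trans (count_size _ _))//= size_map. Qed.

(** A finite path has boundedly many visits, which leaves the infinite ones. Conversely the segment
    for the next visit ends at the least later index where [y] is at [v]; minimality ensures that
    exactly one visit is added. *)
Lemma infinitely_oftenP v x : infinitely_often v x <->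
  exists2 y, x = Inf y & forall n, exists2 k, (n <= k)%N & frng (ipre y k) = v.
Proof.
split.
  case: x => [u|y] h.
    have [u' [ru' vu'] /ple_len lu] := h (len u).+1 I.
    by have := visits_le_len v u'; rewrite vu' leqNgt !ltnS lu.
  exists y => // n; have [u' [ru' vu'] /ple_Inf uE] := h n I.
  exists (len u'); last by rewrite -uE.
  by rewrite -ltnS -vu' visits_le_len.
move=> [y -> h] n _; elim: n => [|n [u [ru vu] /ple_Inf uE]].
  have [k0 _ rk0] := h 0%N.
  have ex : exists k, frng (ipre y k) == v by exists k0; apply/eqP.
  case: (ex_minnP ex) => k /eqP rk min; exists (ipre y k); last exact: ple_ipre.
  split=> //; case: k rk min => [<- _|k rk min]; first by rewrite ipre0 visits_fvertex eqxx.
  rewrite visits_ipreS rk eqxx addn1; congr S.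
  have : forall j, (j <= k)%N -> visits v (ipre y j) = 0%N.
    elim=> [_|j IH jk].
      have /negP : ~ frng (ipre y 0) == v by move=> /min.
      by rewrite ipre0 visits_fvertex; case: eqP.
    rewrite visits_ipreS IH ?(ltnW jk)// add0n.
    by case: eqP => // /eqP/min; rewrite ltnNge jk.
  exact.
have [k0 ltk0 rk0] := h (len u).+1.
have ex : exists k, (len u < k)%N && (frng (ipre y k) == v) by exists k0; rewrite ltk0 rk0/=.
case: (ex_minnP ex) => -[//|k] /andP[uk /eqP rk] min.
exists (ipre y k.+1); last exact: ple_ipre.
split => //; rewrite visits_ipreS rk eqxx addn1; congr S; rewrite -vu [in RHS]uE.
have : forall j, (len u <= j <= k)%N -> visits v (ipre y j) = visits v (ipre y (len u)).
  elim=> [|j IH]; first by rewrite leqn0 => /andP[/eqP ->].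
  move=> /andP[]; rewrite leq_eqVlt => /orP[/eqP <-//|uj jk].
  have IHj := IH (introT andP (conj (uj : (len u <= j)%N) (ltnW jk))).
  rewrite visits_ipreS IHj -[RHS]addn0; congr addn.
  case: eqP => // rj; have := min j.+1; rewrite uj rj eqxx.
  by move=> /(_ isT); rewrite ltnNge jk.
by apply; rewrite -ltnS uk leqnn.
Qed.

(** A segment of an infinite path is determined by its length, so infinitely many segments ending at
    [v] means arbitrarily long ones. *)
Lemma recurrent_pathsE : @recurrent_paths E = \bigcup_v infinitely_often v.
Proof.
apply/seteqP; split => [_ [[y _ <-] [v inf]]|x [v _ /infinitely_oftenP[y -> h]]].
  exists v => //; apply/infinitely_oftenP; exists y => // n.
  apply: contrapT => nk; apply: inf.
  apply: (@sub_finite_set _ _ ((ipre y) @` `I_n)); last exact/finite_image/finite_II.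
  move=> u [[/ple_Inf uE _] ru]; exists (len u) => //=.
  rewrite ltnNge; apply/negP => nu; apply: nk; exists (len u) => //.
  by rewrite -uE.
split; first by exists y.
exists v => fin.
have [n nP] : exists n, forall u, plt u (Inf y) -> frng u = v -> (len u < n)%N.
  exists (\sum_(u <- finmap.enum_fset (fset_set [set u | plt u (Inf y) /\ frng u = v])) len u).+1 => u lu ru.
  rewrite ltnS (big_fsetD1 u)/= ?leq_addr//.
  by rewrite in_fset_set// inE.
have [k nk rk] := h n.
have := nP (ipre y k); rewrite len_ipre ltnNge nk => /(_ _ rk) H.
by have := H (conj (ple_ipre _ _) _) => /(_ ltac:(by [])).
Qed.

(** The stretch of the path between a visit to [v] and a later visit to [v'] is the connecting path.
    Consequently vertices without a connecting path have disjoint [infinitely_often] sets. *)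
Lemma infinitely_often_connected v v' x : infinitely_often v x -> infinitely_often v' x ->
  connected_to v v'.
Proof.
move=> /infinitely_oftenP[y -> h] /infinitely_oftenP[y' [<-] h'].
have [k _ rk] := h 0%N; have [k' lk' rk'] := h' k.
have := ple_total (ple_ipre y k) (ple_ipre y k').
rewrite !len_ipre => /(_ lk')[_ /prefixP[s es]].
have c : chain v s.
  have : chain (src (iedge y 0)) (fedges (ipre y k')) := fpath_valP (ipre y k').
  by rewrite es chain_cat => /andP[_]; rewrite -rk.
exists (@Finpath E (v, s) c); split => //.
rewrite -rk' /frng es map_cat last_cat.
by rewrite [X in _ = last X _](rk : last (fsrc (ipre y k')) _ = v).
Qed.

(* [recurrent_paths] is a possibly uncountable union over the recurring vertex; naming that
   vertex by the time of a visit instead makes the set Borel. *)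
Definition return_segments n k : set (finpath E) :=
  [set u | len u = k /\ exists u0, [/\ ple u0 (Fin u), len u0 = n & frng u0 = frng u]].

Lemma recurrent_paths_borelE : @recurrent_paths E = @infinite_paths E `&`
  \bigcup_n \bigcap_l \bigcup_k cyls (return_segments n (k + l)).
Proof.
rewrite recurrent_pathsE; apply/seteqP; split => [_ [v _ /infinitely_oftenP[y -> h]]|].
  split; first by exists y.
  have [n _ rn] := h 0%N; exists n => // l _.
  have [k] := h (maxn n l); rewrite geq_max => /andP[nk lk] rk.
  exists (k - l)%N => //; exists (ipre y k); last exact: ple_ipre.
  split; first by rewrite len_ipre subnK.
  exists (ipre y n); split; rewrite ?len_ipre ?rn ?rk//.
  by apply: ple_total (ple_ipre y n) (ple_ipre y k) _; rewrite !len_ipre.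
move=> _ [[y _ <-] [n _ h]]; exists (frng (ipre y n)) => //; apply/infinitely_oftenP.
exists y => // l; have [k _ [u [lu [u0 [u0u lu0 r0]]] uy]] := h l I.
exists (k + l)%N; first exact: leq_addl.
have /ple_Inf uE := uy; have /ple_Inf u0E := ple_trans u0u uy.
by rewrite -lu -uE -r0 u0E lu0.
Qed.

Lemma measurable_recurrent_paths : measurable (borel_trace (@recurrent_paths E)).
Proof.
rewrite recurrent_paths_borelE.
rewrite (_ : borel_trace _ = borel_trace (@infinite_paths E) `&`
  \bigcup_n \bigcap_l \bigcup_k borel_trace (cyls (return_segments n (k + l))))//.
apply: measurableI; first exact: measurable_infinite_paths.
apply: bigcup_measurable => n _; apply: bigcap_measurable => // l _.
by apply: bigcup_measurable => k _; exact: measurable_trace_cyls.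
Qed.

Lemma measurable_infinitely_often v : measurable (borel_trace (infinitely_often v)).
Proof.
rewrite (_ : borel_trace _ = \bigcap_n borel_trace (cyls (nth_visit v n)))//.
by apply: bigcap_measurable => // n _; exact: measurable_trace_cyls.
Qed.

End BoundaryTopology.
Arguments borel_trace {E Rg} p B.

(** * Masses of unions of cylinders *)

Section VisitSegments.
Variable E : digraph.
Implicit Types (u : finpath E) (v : vert E).

Lemma chain_take n u : chain (fsrc u) (take n (fedges u)).
Proof.
have : chain (fsrc u) (fedges u) := fpath_valP u.
by rewrite -{1}(cat_take_drop n (fedges u)) chain_cat => /andP[].
Qed.

Definition ftake n u : finpath E := @Finpath E (fsrc u, take n (fedges u)) (chain_take n u).

Lemma ple_ftake n u : ple (ftake n u) (Fin u).
Proof. by split => //; apply/prefixP; exists (drop n (fedges u)); rewrite cat_take_drop. Qed.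

Lemma len_ftake n u : (n <= len u)%N -> len (ftake n u) = n.
Proof. by move=> nu; rewrite /len /fedges/= size_takel. Qed.

(** Dropping the last edge lowers the number of visits by at most one, so no intermediate count is
    skipped along the segments of [u]. *)
Lemma nth_visit_segment v n u : (n < visits v u)%N -> exists2 u', nth_visit v n u' & ple u' (Fin u).
Proof.
have [l] := ubnP (len u); elim: l u => // l IH u lu nv.
have [[ru vu]|nvis] := pselect (nth_visit v n u); first by exists u => //; exact: ple_refl.
case E0 : (len u) => [|k].
  have es : fedges u = [::] by apply/nilP; rewrite /nilp -/(len u) E0.
  exfalso; apply: nvis; move: nv; rewrite /nth_visit/= /visits /frng es/= addn0.
  by case: eqP => // ->; case: n {IH}.
have ku : (k <= len u)%N by rewrite E0.
have [||u' vu' u'u] := IH (ftake k u).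
- by rewrite len_ftake// -ltnS -E0.
- have [[e l'] es] : exists el, fedges u = rcons el.2 el.1.
    by move: E0; rewrite /len; case/lastP: (fedges u) => [//|s e _]; exists (e, s).
  have l'k : size l' = k by have := congr1 size es; rewrite size_rcons -/(len u) E0 => -[].
  have visE : visits v u = (visits v (ftake k u) + (frng u == v))%N.
    have te : fedges (ftake k u) = l'.
      by rewrite -[LHS]/(take k (fedges u)) es/= -cats1 take_cat l'k ltnn subnn take0 cats0.
    rewrite /visits /frng te (_ : fsrc (ftake k u) = fsrc u)// es/= map_rcons last_rcons.
    by rewrite -cats1 count_cat/= addn0 addnA.
  move: nv; rewrite visE; case: eqP => [ru|]; last by rewrite addn0.
  rewrite addn1 ltnS leq_eqVlt => /orP[/eqP nE|//].
  by exfalso; apply: nvis; split => //; rewrite visE -nE ru eqxx addn1.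
by exists u' => //; apply: ple_trans u'u (ple_ftake _ _).
Qed.

Lemma cyls_nth_visitS v n : cyls (nth_visit v n.+1) `<=` cyls (nth_visit v n).
Proof.
move=> x [u [ru vu] ux]; have [|u' nu' u'u] := @nth_visit_segment v n u; first by rewrite vu.
by exists u' => //; exact: ple_trans ux.
Qed.

End VisitSegments.

(** * Finite unions, decreasing intersections and null sets for general measures *)

Section FiniteUnions.
Variables (d : measure_display) (T : measurableType d) (R : realType).
Variables (mu : {measure set T -> \bar R}) (I : choiceType) (F : I -> set T).
Hypothesis mF : forall i, measurable (F i).
Local Open Scope ereal_scope.

Lemma measure_bigsetU_le (s : seq I) :
  mu (\big[setU/set0]_(i <- s) F i) <= \sum_(i <- s) mu (F i).
Proof.
elim: s => [|i s IH]; first by rewrite !big_nil measure0.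
rewrite !big_cons; apply: le_trans (measureU2 _ _ _) _ => //.
  by apply: bigsetU_measurable.
exact: leeD.
Qed.

Lemma measure_bigsetU_disjoint (s : seq I) : uniq s ->
  (forall i j, i \in s -> j \in s -> i != j -> F i `&` F j = set0) ->
  mu (\big[setU/set0]_(i <- s) F i) = \sum_(i <- s) mu (F i).
Proof.
elim: s => [|i s IH /= /andP[is_ us] dj]; first by rewrite !big_nil measure0.
have dj' : F i `&` \big[setU/set0]_(j <- s) F j = set0.
  rewrite -bigcup_seq setI_bigcupr bigcup0// => j /= js; apply: dj.
  - exact: mem_head.
  - by rewrite inE js orbT.
  - by apply: contraNneq is_ => ->.
rewrite !big_cons -IH//; last by move=> j k js ks; apply: dj; rewrite inE ?js ?ks orbT.
by apply: measureU => //; exact: bigsetU_measurable.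
Qed.

End FiniteUnions.

Section DecreasingLimit.
Variables (d : measure_display) (T : measurableType d) (R : realType) (mu : probability T R).
Local Open Scope ereal_scope.

Lemma measure_bigcap_ge (F : (set T)^nat) x : (forall n, measurable (F n)) ->
  (forall n, F n.+1 `<=` F n) -> (forall n, x <= mu (F n)) -> x <= mu (\bigcap_n F n).
Proof.
move=> mF dF xF.
have mI : measurable (\bigcap_n F n) by exact: bigcap_measurable.
have F0 : mu (F 0%N) < +oo by rewrite (le_lt_trans (probability_le1 _ _))// ltry.
have dF' : {homo F : n m / (n <= m)%N >-> (m <= n)%O}.
  move=> n m; move=> /subnK <-; rewrite subsetEset; elim: (m - n)%N => // k IH.
  by rewrite addSn; apply: subset_trans IH; exact: dF.
have cv := nonincreasing_cvg_mu F0 mF mI dF'.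
rewrite -(cvg_lim _ cv)//; apply: lime_ge; first by apply/cvg_ex; exists (mu (\bigcap_n F n)).
by apply: nearW => n; exact: xF.
Qed.

Lemma negligible_bigcup_countable (I : Type) (A : set I) (F : I -> set T) : countable A ->
  (forall i, A i -> mu.-negligible (F i)) -> mu.-negligible (\bigcup_(i in A) F i).
Proof.
move=> /countable_injP[f finj] h.
have : mu.-negligible (\bigcup_n (\bigcup_(i in A `&` [set i | f i = n]) F i)).
  apply: negligible_bigcup => n.
  have [[i [Ai fi]]|no] := pselect (exists i, A i /\ f i = n).
    apply: (negligibleS _ (h i Ai)) => x [j [Aj fj] Fj].
    by rewrite (finj i j) ?inE// fi fj.
  rewrite bigcup0; first exact: negligible_set0.
  move=> i [Ai fi].
  by exfalso; apply: no; exists i.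
by apply: negligibleS => x [i Ai Fi]; exists (f i) => //; exists i.
Qed.

End DecreasingLimit.

(** * Cylinder masses under the associated measure *)

Section AssociatedMeasure.
Variables (R : realType) (E : digraph) (Rg : set (vert E)) (N : edge E -> R) (beta : R).
Hypothesis N_gt0 : forall e, 0 < N e.
Variables (m : vert E -> R) (p : boundary Rg) (mu : probability (borelType (boundary_at p)) R).
Hypothesis assoc : associated_measure N beta m mu.
Implicit Types (u : finpath E) (e : edge E) (v : vert E) (S : set (finpath E)).
Local Notation pw := (path_weight N beta).
Local Notation tr := (borel_trace p).
Local Open Scope ereal_scope.

Lemma mu_cylinder u : mu (tr (cylinder u)) = (pw u)%:E * (m (frng u))%:E.
Proof.
have [_ mv me] := assoc.
elim/finpath_ind: u => [v|e u eu IH]; first by rewrite path_weight_fvertex mul1e; exact: mv.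
rewrite path_weight_tcons// frng_tcons// EFinM -muleA -IH -me.
- by rewrite /borel_trace -edge_mul_cylinder.
- exact: measurable_trace_cylinder.
- move=> x; rewrite /borel_trace/trace/= => ux.
  apply/ple_fvertex; rewrite eu; case: (set_val x) ux => [u'|y] []//.
Qed.

(** The union is open, so its mass is a supremum over compact subsets, each covered by finitely many
    of the cylinders. This reaches uncountable [S], beyond countable subadditivity. *)
Lemma mu_cyls_le S : mu (tr (cyls S)) <= \esum_(u in S) ((pw u)%:E * (m (frng u))%:E).
Proof.
have [[_ /(_ _ (open_trace_cyls p S)) inner] _ _] := assoc.
rewrite [X in X <= _]inner; apply: ge_ereal_sup => _ [K [cK KS] <-].
have cK' := cK; rewrite compact_cover in cK'.
have [u _|x /KS[u Su ux]|D DS KD] := cK' _ S (fun u => trace p (cylinder u)).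
- exact/open_trace/open_cylinder.
- by exists u.
have : mu K <= mu (\big[setU/set0]_(u <- D) tr (cylinder u)).
  apply: le_measure; rewrite ?inE.
  - exact: compact_borel.
  - by apply: bigsetU_measurable => u _; exact: measurable_trace_cylinder.
  - by rewrite -bigcup_fset.
move=> /le_trans; apply; apply: le_trans (measure_bigsetU_le _ _ _) _.
  by move=> u; exact: measurable_trace_cylinder.
apply: esum_ge; exists [set` D].
  by split => // u /DS; rewrite inE.
rewrite fsbig_finite// set_fsetK le_eqVlt; apply/orP; left; apply/eqP.
by apply: eq_bigr => u _; rewrite -mu_cylinder.
Qed.

(** Two cylinders meet only if one of the paths is a segment of the other, so distinct members of an
    antichain have disjoint cylinders. *)
Definition antichain S := forall u u', S u -> S u' -> ple u (Fin u') -> u = u'.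

Lemma mu_cyls_ge S : antichain S ->
  \esum_(u in S) ((pw u)%:E * (m (frng u))%:E) <= mu (tr (cyls S)).
Proof.
move=> aS; apply: esum_leP => X [fX XS].
rewrite fsbig_finite//.
rewrite (_ : \sum_(u <- _) _ = \sum_(u <- finmap.enum_fset (fset_set X)) mu (tr (cylinder u))); last first.
  by apply: eq_bigr => u _; rewrite -mu_cylinder.
rewrite -measure_bigsetU_disjoint.
- apply: le_measure; rewrite ?inE.
  + by apply: bigsetU_measurable => u _; exact: measurable_trace_cylinder.
  + exact: measurable_trace_cyls.
  + rewrite -bigcup_fset => x [u /=]; rewrite in_fset_set// inE => Xu ux.
    by exists u => //; exact: XS.
- by move=> u; exact: measurable_trace_cylinder.
- exact: finmap.fset_uniq.
move=> u u'; rewrite !in_fset_set// !inE => Xu Xu' /eqP ne; apply/seteqP; split => // x [ux ux'].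
apply: ne; have /orP[le|le] := leq_total (len u) (len u').
  by apply: aS; [exact: XS|exact: XS|exact: ple_total ux ux' le].
by apply/esym; apply: aS; [exact: XS|exact: XS|exact: ple_total ux' ux le].
Qed.

Lemma cyls_lenS n : cyls [set u : finpath E | len u = n.+1] `<=` cyls [set u | len u = n].
Proof.
move=> x [u /= lu ux]; exists (ftake n u); first by rewrite /= len_ftake// lu.
exact: ple_trans (ple_ftake n u) ux.
Qed.

Lemma antichain_len n : antichain [set u : finpath E | len u = n].
Proof. by move=> u u' /= lu lu' le; apply: ple_anti_len; rewrite // lu lu'. Qed.

Lemma mu_infinite_le n : mu (tr (@infinite_paths E)) <=
  \esum_(u in [set u | len u = n]) ((pw u)%:E * (m (frng u))%:E).
Proof.
apply: le_trans (mu_cyls_le _); apply: le_measure; rewrite ?inE.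
- exact: measurable_infinite_paths.
- exact: measurable_trace_cyls.
- by move=> x [y _ yx]; rewrite /borel_trace/trace/= -yx; exact: cyls_len_Inf.
Qed.

Lemma mu_infinite_ge x :
  (forall n, x <= \esum_(u in [set u | len u = n]) ((pw u)%:E * (m (frng u))%:E)) ->
  x <= mu (tr (@infinite_paths E)).
Proof.
move=> h; rewrite infinite_pathsE.
rewrite (_ : borel_trace _ _ = \bigcap_n tr (cyls [set u | len u = n]))//.
apply: measure_bigcap_ge => n.
- exact: measurable_trace_cyls.
- by move=> z; exact: cyls_lenS.
- apply: le_trans (h n) _; apply: mu_cyls_ge; exact: antichain_len.
Qed.

Lemma visits_ple v u u' : ple u (Fin u') -> visits v u = visits v u' -> frng u' = v -> u = u'.
Proof.
move=> [su /prefixP[s es]] vv ru; apply: finpath_eq => //.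
case/lastP: s es => [|s e] es; first by rewrite es cats0.
move: vv ru; rewrite /visits /frng es su map_cat map_rcons last_cat last_rcons -cat_cons count_cat.
by rewrite -[LHS]addn0 => /addnI/esym; rewrite -cats1 count_cat/= addn0 => + rv; rewrite rv eqxx addn1.
Qed.

Lemma antichain_nth_visit v n : antichain (nth_visit v n).
Proof.
move=> u u' [ru vu] [ru' vu'] le; apply: (visits_ple le _ ru').
by rewrite vu vu'.
Qed.

End AssociatedMeasure.

(** * Recurrence *)

Lemma le_geometric_eq0 (R : realType) (x : \bar R) (c z : R) : (0 <= z < 1)%R -> (0 <= x)%E ->
  (forall n, x <= (c * z ^+ n)%:E)%E -> x = 0%E.
Proof.
move=> /andP[z0 z1] x0 h; apply/eqP; rewrite eq_le x0 andbT.
have xfin : x \is a fin_num by rewrite ge0_fin_numE// (le_lt_trans (h 0%N))// ltry.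
rewrite -(fineK xfin) lee_fin.
have cv : (fun n => c * z ^+ n) @ \oo --> c * 0.
  by apply: cvgMr; apply: cvg_expr; rewrite ger0_norm.
rewrite -(mulr0 c) -(cvg_lim _ cv)//; apply: limr_ge; first by apply/cvg_ex; exists (c * 0).
by apply: nearW => n; rewrite -lee_fin fineK.
Qed.

Section MeasureOfRecurrence.
Variables (R : realType) (E : digraph) (Rg : set (vert E)) (N : edge E -> R) (beta : R).
Hypothesis N_gt0 : forall e, 0 < N e.
Local Notation transfer := (transfer N beta).
Local Notation psum := (psum N beta).
Local Notation Za := (Za N beta).
Local Notation Zs := (Zs N beta).
Local Notation za := (za N beta).
Local Notation zs := (zs N beta).
Local Notation mbeta := (mbeta N beta).
Local Notation superharmonic := (superharmonic N beta).
Local Notation charge := (charge N beta).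
Local Notation admissible := (admissible N beta).
Local Notation critical := (critical N beta).
Local Notation pw := (path_weight N beta).
Implicit Types (u : finpath E) (e : edge E) (v : vert E) (S : set (finpath E)).
Local Open Scope ereal_scope.

(** The value k(v) Z^s_v is the transfer at [v] of a function below k, hence at most k(v);
    finiteness of Z^a_v comes from summability. *)
Lemma superharmonic_admissible k v : superharmonic k ->
  \esum_(v in [set: vert E]) (k v)%:E < +oo -> (0 < k v)%R -> admissible v.
Proof.
move=> sk koo kv; split; first exact: Za_lt_pinfty koo kv.
have kZ : (k v)%:E * Zs v <= (k v)%:E * 1; last first.
  by move: kZ; rewrite lee_pmul2l// lte_fin.
rewrite mule1 ZsE// -transferZ ?(ltW kv)//; last exact: first_passage_ge0.
apply: le_trans (proj2 sk v); apply: le_transfer => // v'.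
exact: first_passage_superharmonic.
Qed.

(** The summand over paths of length [n] is P^n k, and P^n k = k for harmonic k. *)
Lemma esum_len_harmonic k n : superharmonic k -> (forall v, charge k v = 0%R) ->
  \esum_(u in [set u | len u = n]) ((pw u)%:E * (k (frng u))%:E) =
  \esum_(v in [set: vert E]) (k v)%:E.
Proof.
move=> sk k0; have kge0 v : 0 <= (EFin \o k) v by rewrite lee_fin; case: sk.
rewrite -(@esum_psum _ _ _ _ N_gt0 _ (EFin \o k))//; apply: eq_esum => v _.
elim: n v => [|n IH] v.
  apply: psum_set1 => // u uv; split => [/= /size0nil us|->//].
  exact: finpath_eq.
rewrite (@psum_cons_out _ _ _ _ N_gt0 _ [set u | len u = n])//; last first.
  by move=> e u _ eu /=; rewrite len_tcons//; split => [[]|->].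
rewrite (_ : psum _ _ = EFin \o k); last exact/funext.
by rewrite superharmonic_transferE// k0 subr0.
Qed.

(** The telescoping identity k = sum of P^i (k - P k) over i < n, plus P^n k, with the powers of P
    written as sums over paths of given length. *)
Lemma psum_charge_len k n v : superharmonic k ->
  psum [set u | (len u < n)%N] (EFin \o charge k) v + psum [set u | len u = n] (EFin \o k) v =
  (k v)%:E.
Proof.
move=> sk; have kge0 v' : 0 <= (EFin \o k) v' by rewrite lee_fin; case: sk.
have cge0 v' : 0 <= (EFin \o charge k) v' by rewrite lee_fin charge_ge0.
elim: n v => [|n IH] v.
  rewrite psum0// add0e; apply: psum_set1 => // u uv; split => [/= /size0nil us|->//].
  exact: finpath_eq.
rewrite [X in X + _]psum_cons// ifT ?inE//.
rewrite [X in _ + X](@psum_cons_out _ _ _ _ N_gt0 _ [set u | len u = n])//; last first.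
  by move=> e u _ eu /=; rewrite len_tcons//; split => [[]|->].
rewrite -addeA [X in _ + (X + _)](_ : _ = transfer (psum [set u | (len u < n)%N] (EFin \o charge k)) v); last first.
  apply: eq_esum => e ev; congr (_ * _); apply: eq_psum => // u ue /=.
  by rewrite len_tcons.
rewrite -transferD//; last 2 first.
- by move=> v'; exact: psum_ge0.
- by move=> v'; exact: psum_ge0.
rewrite (_ : (fun v => _ + _) = EFin \o k); last exact/funext.
by rewrite superharmonic_transferE// -EFinD /= addrC subrK.
Qed.

(** * The mass of the recurrent paths *)

Section WithMeasure.
Variables (m : vert E -> R) (p : boundary Rg) (mu : probability (borelType (boundary_at p)) R).
Hypotheses (m_sh : superharmonic m) (assoc : associated_measure N beta m mu).
Hypothesis m_sum : \esum_(v in [set: vert E]) (m v)%:E < +oo.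
Local Notation tr := (borel_trace p).

Let m_ge0 v : (0 <= m v)%R. Proof. by case: m_sh. Qed.

Lemma esum_nth_visit v n : admissible v ->
  \esum_(u in nth_visit v n) ((pw u)%:E * (m (frng u))%:E) = (m v * za v * zs v ^+ n)%:E.
Proof.
move=> adm; have [Zoo _] := adm.
rewrite (_ : esum _ _ = (m v)%:E * \esum_(v' in [set: vert E]) nth_passage N beta v n v'); last first.
  rewrite esum_psum ?lee01//= -esumZl//; last first.
    by move=> u _; rewrite mule1 lee_fin ltW// path_weight_gt0.
  by apply: eq_esum => u [ru _]; rewrite ru mule1 muleC.
rewrite (eq_esum (fun v' _ => nth_passageE N_gt0 n (zsE N_gt0 adm) v')) esumZl ?exprn_ge0 ?zs_ge0//; last first.
  by move=> v' _; exact: first_passage_ge0.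
by rewrite -ZaE// zaE// -!EFinM; congr EFin; ring.
Qed.

(** The set of paths with at least n + 1 visits to [v] has mass at most m(v) Z^a_v (Z^s_v)^n, and
    positivity of m(v) without criticality forces Z^s_v < 1. *)
Lemma infinitely_often_null v : (0 < m v)%R -> ~ critical v -> mu (tr (infinitely_often v)) = 0.
Proof.
move=> mv ncrit; have adm := superharmonic_admissible m_sh m_sum mv.
have z1 : (zs v < 1)%R.
  rewrite lt_neqAle zs_le1// andbT; apply/eqP => z1; apply: ncrit.
  exact: admissible_critical.
apply: (@le_geometric_eq0 _ _ (m v * za v) (zs v)) => //; first by rewrite zs_ge0.
move=> n; rewrite -esum_nth_visit//; apply: le_trans (mu_cyls_le N_gt0 assoc _).
apply: le_measure; rewrite ?inE.
- exact: measurable_infinitely_often.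
- exact: measurable_trace_cyls.
- by move=> x; apply.
Qed.

(** With Z^s_v = 1 the decreasing approximations all have at least the mass m(v) Z^a_v, so it
    survives in the limit. *)
Lemma mu_infinitely_often_ge v : critical v -> (m v * za v)%:E <= mu (tr (infinitely_often v)).
Proof.
move=> crit; rewrite (_ : tr _ = \bigcap_n tr (cyls (nth_visit v n)))//.
apply: measure_bigcap_ge => n.
- exact: measurable_trace_cyls.
- by move=> x; exact: cyls_nth_visitS.
apply: le_trans (mu_cyls_ge N_gt0 assoc (@antichain_nth_visit _ v n)).
rewrite esum_nth_visit//; last exact: critical_admissible.
by rewrite /zs (proj2 crit) expr1n mulr1.
Qed.

Lemma sum_infinitely_often_le (s : seq (vert E)) : uniq s -> (forall v, v \in s -> critical v) ->
  (forall v v', v \in s -> v' \in s -> connected_to v v' -> v = v') ->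
  (\sum_(v <- s) (m v * za v))%:E <= mu (tr (@recurrent_paths E)).
Proof.
move=> us sc sconn.
have mio v : measurable (tr (infinitely_often v)) by exact: measurable_infinitely_often.
apply: (@le_trans _ _ (mu (\big[setU/set0]_(v <- s) tr (infinitely_often v)))).
  rewrite (@measure_bigsetU_disjoint _ _ _ mu _ (fun v => tr (infinitely_often v)))//.
    by rewrite -sumEFin big_seq [leRHS]big_seq; apply: lee_sum => v /sc; exact: mu_infinitely_often_ge.
  move=> v v' vs vs' /eqP ne; apply/seteqP; split => // x [xv xv']; apply: ne.
  exact/sconn/(infinitely_often_connected xv xv').
apply: le_measure; rewrite ?inE.
- by apply: bigsetU_measurable => v _; exact: measurable_infinitely_often.
- exact: measurable_recurrent_paths.
- rewrite -bigcup_seq recurrent_pathsE => x [v _ xv].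
  by exists v.
Qed.

Lemma countable_support : countable [set v | m v != 0%R].
Proof.
have := esum_lt_pinfty_countable m_ge0 m_sum; apply: sub_countable.
by apply: subset_card_le => v mv; split.
Qed.

(** Up to a null set a recurrent path meets a critical vertex. Cylinders ending at zeros of m have
    null union even if uncountably many, by [mu_cyls_le]; the remaining non-critical vertices are
    countable in number and null one by one. *)
Lemma mu_recurrent_le : mu (tr (@recurrent_paths E)) <=
  \esum_(u in hit [set v | critical v]) ((pw u)%:E * (m (frng u))%:E).
Proof.
apply: le_trans (mu_cyls_le N_gt0 assoc _).
set C := hit _.
have neg : mu.-negligible (tr (cyls [set u | m (frng u) = 0%R]) `|`
    \bigcup_(v in [set v | m v != 0%R /\ ~ critical v]) tr (infinitely_often v)).
  apply: negligibleU.
    apply/negligibleP; first exact: measurable_trace_cyls.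
    apply/eqP; rewrite eq_le measure_ge0 andbT.
    apply: le_trans (mu_cyls_le N_gt0 assoc _) _.
    by rewrite esum1// => u /= ->; rewrite mule0.
  apply: (@negligible_bigcup_countable _ _ _ _ (vert E)).
    have := countable_support; apply: sub_countable; apply: subset_card_le.
    by move=> v [].
  move=> v [mv ncrit]; apply/negligibleP; first exact: measurable_infinitely_often.
  by apply: infinitely_often_null => //; rewrite lt_neqAle eq_sym mv m_ge0.
have [B [mB B0 NB]] := neg.
apply: (@le_trans _ _ (mu (tr (cyls C) `|` B))); last first.
  apply: le_trans (measureU2 _ _ _) _ => //; first exact: measurable_trace_cyls.
  by rewrite [X in _ + X](_ : _ = 0) ?adde0//.
apply: le_measure; rewrite ?inE.
- exact: measurable_recurrent_paths.
- by apply: measurableU => //; exact: measurable_trace_cyls.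
rewrite recurrent_pathsE => x [v _ xv].
have [mv|mv] := pselect (m v = 0%R).
  right; apply: NB; left; have [u [ru vu] ux] := xv 0%N I.
  by exists u => //=; rewrite ru.
have [crit|ncrit] := pselect (critical v); last first.
  by right; apply: NB; right; exists v => //; split => //; apply/eqP.
left; have [u [ru vu] ux] := xv 0%N I.
(* The shortest segment of [u] ending at a critical vertex is a first hit of the critical set. *)
have ex : exists n, `[< exists2 u', ple u' (Fin u) & critical (frng u') /\ len u' = n >].
  by exists (len u); apply/asboolP; exists u; [exact: ple_refl | rewrite ru].
case: (ex_minnP ex) => n /asboolP[u1 u1u [c1 l1]] min.
exists u1; last exact: ple_trans ux.
split => // u2 [u21 ne] c2; have : (n <= len u2)%N.
  by apply: min; apply/asboolP; exists u2 => //; exact: ple_trans u21 u1u.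
by rewrite -l1 => le; apply: ne; congr Fin; exact: ple_anti_len.
Qed.

End WithMeasure.
End MeasureOfRecurrence.

(** * Interval coding of paths *)

(* The intervals are laid out in the order of a numbering of the countably many [i] with
   [q i != 0]; having order type at most omega, they tile [0, sum of q). *)
Lemma interval_packing (R : realType) (I : choiceType) (A : set I) (q : I -> R) :
  (forall i, 0 <= q i) -> (\esum_(i in A) (q i)%:E < +oo)%E ->
  exists off : I -> R,
  [/\ forall i, A i -> 0 <= off i /\ ((off i + q i)%:E <= \esum_(i in A) (q i)%:E)%E,
      forall i j x, A i -> A j -> off i <= x < off i + q i -> off j <= x < off j + q j -> i = j &
      forall x, 0 <= x -> (x%:E < \esum_(i in A) (q i)%:E)%E ->
        exists2 i, A i & off i <= x < off i + q i].
Proof.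
move=> q0 qoo; pose A' := [set i | A i /\ q i != 0].
have /countable_injP[f finj] : countable A' by exact: esum_lt_pinfty_countable.
pose S n := (\esum_(i in A' `&` [set i | (f i < n)%N]) (q i)%:E)%E.
pose s n := fine (S n).
have qe0 i : (0 <= (q i)%:E)%E by rewrite lee_fin.
have SA n : (S n <= \esum_(i in A) (q i)%:E)%E by apply: esum_le_subset => i [[]].
have S0 n : (0 <= S n)%E by apply: esum_ge0.
have Sfin n : S n = (s n)%:E.
  by rewrite /s fineK// ge0_fin_numE//; exact: le_lt_trans qoo.
have s0 n : 0 <= s n by rewrite -lee_fin -Sfin.
have smono a b : (a <= b)%N -> s a <= s b.
  move=> ab; rewrite -lee_fin -!Sfin; apply: esum_le_subset => i [Ai /= fa]; split => //=.
  exact: leq_trans fa ab.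
have sS i : A' i -> s (f i).+1 = s (f i) + q i.
  move=> Ai; apply: EFin_inj; rewrite EFinD -!Sfin /S (esumID [set i])//.
  rewrite [X in (X + _)%E](_ : _ = (q i)%:E); last first.
    rewrite (_ : _ `&` _ = [set i]) ?esum_set1//; apply/seteqP; split => [j []//|_ ->].
    by do !split; rewrite /= ?ltnS//; case: Ai.
  rewrite addeC; congr (esum _ _ + _)%E; apply/seteqP; split => j.
    move=> [[Aj]]; rewrite /= ltnS leq_eqVlt => /orP[/eqP ff|//] ji; exfalso; apply: ji.
    by apply: finj; rewrite ?inE.
  move=> [Aj /= fj]; split; first by split => //=; exact: ltnW.
  by move=> /= ji; move: fj; rewrite ji ltnn.
(* An index of zero mass has an empty interval, so its position 0 is arbitrary. *)
exists (fun i => if q i == 0 then 0 else s (f i)); split.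
- move=> i Ai; case: ifPn => [/eqP ->|qi]; last by rewrite -sS// -Sfin.
  by rewrite addr0; split => //; apply: esum_ge0.
- have lt i j x : A' i -> A' j -> s (f i) <= x < s (f i) + q i -> s (f j) <= x -> (f j <= f i)%N.
    move=> Ai Aj /andP[_ xi] xj; rewrite leqNgt; apply/negP => ff.
    have := smono _ _ ff; rewrite sS// => h.
    by move: (lt_le_trans xi h); rewrite ltNge xj.
  move=> i j x Ai Aj; case: ifPn => [/eqP ->|qi].
    by rewrite addr0 => /andP[a b]; move: (le_lt_trans a b); rewrite ltxx.
  case: ifPn => [/eqP ->|qj].
    by rewrite addr0 => _ /andP[a b]; move: (le_lt_trans a b); rewrite ltxx.
  move=> xi xj; apply: finj; rewrite ?inE//; apply/eqP; rewrite eqn_leq.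
  by rewrite (lt j i x)// ?(lt i j x)//; [case/andP: xj | case/andP: xi].
move=> x x0 xA.
have ex : exists n, x < s n.
  move: xA; rewrite /esum => /ereal_sup_gt[_ [X [fX XA] <-] xX].
  exists (\sum_(i <- finmap.enum_fset (fset_set X)) f i).+1.
  rewrite -lte_fin -Sfin; apply: lt_le_trans xX _.
  rewrite -esum_fset// (esumID [set i | q i != 0])// [X in (_ + X)%E]esum1; last first.
    by move=> i [_ /= /negP/negPn/eqP ->].
  rewrite adde0; apply: esum_le_subset => i [Xi qi]; split; first by split; [exact: XA|].
  by rewrite /= ltnS (big_fsetD1 i)/= ?leq_addr// in_fset_set// inE.
case: (ex_minnP ex) => -[|n] xn min.
  by move: xn; rewrite /s /S (_ : _ `&` _ = set0) ?esum_set0/= ?ltNge ?x0//; apply/seteqP; split => i // [].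
have nx : s n <= x by rewrite leNgt; apply/negP => /min; rewrite ltnn.
have [[i [Ai fi]]|no] := pselect (exists i, A' i /\ f i = n).
  exists i; first by case: Ai.
  by rewrite (negbTE (proj2 Ai)) -sS// fi nx.
exfalso; move: (le_lt_trans nx xn); rewrite (_ : s n.+1 = s n) ?ltxx//.
congr fine; congr esum; apply/seteqP; split => i [Ai /=]; last by split => //=; exact: ltnW.
rewrite ltnS leq_eqVlt => /orP[/eqP fi|//]; exfalso; apply: no.
by exists i.
Qed.

Section CodingIntervals.
Variables (R : realType) (E : digraph) (Rg : set (vert E)) (N : edge E -> R) (beta : R).
Hypothesis N_gt0 : forall e, 0 < N e.
Variable m : vert E -> R.
Hypothesis mD : Dbeta Rg N beta m.
Local Notation w := (edge_weight N beta).
Local Notation pw := (path_weight N beta).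
Implicit Types (u : finpath E) (e : edge E) (v : vert E) (x : R).

Lemma Dbeta_superharmonic : superharmonic N beta m.
Proof.
have [m01 _ _ mle] := mD; split => [v|v]; first by case/andP: (m01 v).
exact: mle.
Qed.

Let m_ge0 v : 0 <= m v. Proof. by case: Dbeta_superharmonic. Qed.

Let child_mass e := w e * m (rng e).

Let child_mass_ge0 e : 0 <= child_mass e.
Proof. by rewrite mulr_ge0// ltW// edge_weight_gt0. Qed.

Let child_sum v : (\esum_(e in out_edges v) (child_mass e)%:E <= (m v)%:E)%E.
Proof. by have [_ _ _] := mD; exact. Qed.

(** Vertices tile [0,1). The edges out of [v] occupy disjoint pieces of [0, m v), positions being
    relative to the left end of the interval of [v]. They fill it when [v] is in [Rg]; whatever they
    leave free codes the path that stops at [v]. *)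
Record layout (offv : vert E -> R) (offe : edge E -> R) : Prop := Layout {
  offv_itv : forall v, 0 <= offv v /\ offv v + m v <= 1;
  offv_inj : forall v v' x, offv v <= x < offv v + m v -> offv v' <= x < offv v' + m v' -> v = v';
  offv_cover : forall x, 0 <= x < 1 -> exists v, offv v <= x < offv v + m v;
  offe_itv : forall e, 0 <= offe e /\ offe e + child_mass e <= m (src e);
  offe_inj : forall e e' x, src e = src e' -> offe e <= x < offe e + child_mass e ->
    offe e' <= x < offe e' + child_mass e' -> e = e';
  offe_cover : forall v x, Rg v -> 0 <= x < m v ->
    exists2 e, src e = v & offe e <= x < offe e + child_mass e }.

Lemma layout_exists : exists offv offe, layout offv offe.
Proof.
have [_ m1 mR _] := mD.
have [offv [v1 v2 v3]] := @interval_packing R (vert E) setT m m_ge0 (ltac:(by rewrite m1 ltry)).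
have pk v : exists off : edge E -> R,
  [/\ forall e, out_edges v e -> 0 <= off e /\ ((off e + child_mass e)%:E <= \esum_(e in out_edges v) (child_mass e)%:E)%E,
      forall e e' x, out_edges v e -> out_edges v e' -> off e <= x < off e + child_mass e ->
        off e' <= x < off e' + child_mass e' -> e = e' &
      forall x, 0 <= x -> (x%:E < \esum_(e in out_edges v) (child_mass e)%:E)%E ->
        exists2 e, out_edges v e & off e <= x < off e + child_mass e].
  by apply: interval_packing => //; rewrite (le_lt_trans (child_sum v))// ltry.
have [offe offeP] := choice pk.
exists offv, (fun e => offe (src e) e); split.
- by move=> v; have [] := v1 v I; rewrite m1 lee_fin.
- by move=> v v' x; exact: v2.
- by move=> x /andP[x0 x1]; have [|v _ vx] := v3 x x0; [rewrite m1 lte_fin|exists v].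
- move=> e; have [oe _ _] := offeP (src e); have [oe0 oe1] := oe e erefl; split => //.
  by rewrite -lee_fin; exact: le_trans oe1 (child_sum _).
- move=> e e' x ee; have [_ inj _] := offeP (src e); rewrite -ee; exact: inj.
- move=> v x Rv /andP[x0 xm]; have [_ _ cov] := offeP v.
  have [|e ev ex] := cov x x0; first by rewrite -mR// lte_fin.
  by exists e; rewrite ?ev.
Qed.

Variables (offv : vert E -> R) (offe : edge E -> R).
Hypothesis lay : layout offv offe.

(** The left end of the interval of a path relative to that of its source: each edge shifts by its
    offset and rescales what follows by its weight. *)
Fixpoint rel_start (s : seq (edge E)) : R :=
  if s is e :: s' then offe e + w e * rel_start s' else 0.

Definition itv_start u := offv (fsrc u) + rel_start (fedges u).
Definition itv_width u := pw u * m (frng u).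
Definition path_itv u : set R := [set x | itv_start u <= x < itv_start u + itv_width u].

(** Prepending [e] in the coding: the affine map of slope N(e)^-beta from the interval of r(e) onto
    the piece reserved for [e]. Its slope is the source of the scaling property of the measure. *)
Definition edge_affine e x := offv (src e) + offe e + w e * (x - offv (rng e)).

Lemma itv_width_ge0 u : 0 <= itv_width u.
Proof. by rewrite mulr_ge0// ltW// path_weight_gt0. Qed.

Lemma path_itv_fvertex v x : path_itv (fvertex v) x <-> offv v <= x < offv v + m v.
Proof. by rewrite /path_itv/= /itv_start/= addr0 /itv_width path_weight_fvertex mul1r. Qed.

Lemma itv_start_tcons e u : rng e = fsrc u -> itv_start (tcons e u) = edge_affine e (itv_start u).
Proof.
move=> eu; rewrite /itv_start /edge_affine fsrc_tcons// fedges_tcons//= eu.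
by ring.
Qed.

Lemma itv_width_tcons e u : rng e = fsrc u -> itv_width (tcons e u) = w e * itv_width u.
Proof. by move=> eu; rewrite /itv_width frng_tcons// path_weight_tcons// mulrA. Qed.

Lemma path_itv_tcons e u x : rng e = fsrc u ->
  path_itv (tcons e u) (edge_affine e x) <-> path_itv u x.
Proof.
move=> eu; rewrite /path_itv/= itv_start_tcons// itv_width_tcons//.
have w0 := edge_weight_gt0 beta N_gt0 e.
rewrite (_ : _ + w e * _ = edge_affine e (itv_start u + itv_width u)); last first.
  by rewrite /edge_affine; ring.
by rewrite /edge_affine lerD2l ler_pM2l// lerD2r ltrD2l ltr_pM2l// ltrD2r.
Qed.

Lemma edge_affine_surj e y : exists x, y = edge_affine e x.
Proof.
exists ((y - offv (src e) - offe e) / w e + offv (rng e)).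
by rewrite /edge_affine; field; rewrite gt_eqF// edge_weight_gt0.
Qed.

Lemma edge_affineB e x : edge_affine e x - offv (src e) = offe e + w e * (x - offv (rng e)).
Proof. by rewrite /edge_affine; ring. Qed.

Lemma edge_affine_itv e x : offv (rng e) <= x < offv (rng e) + m (rng e) ->
  offe e <= edge_affine e x - offv (src e) < offe e + child_mass e.
Proof.
have w0 := edge_weight_gt0 beta N_gt0 e.
move=> /andP[x0 x1]; rewrite edge_affineB /child_mass lerDl.
by rewrite mulr_ge0 ?subr_ge0 ?(ltW w0)//= ltrD2l ltr_pM2l// ltrBlDl.
Qed.

Lemma edge_itv_src e x : offe e <= x - offv (src e) < offe e + child_mass e ->
  offv (src e) <= x < offv (src e) + m (src e).
Proof. by have [e0 e1] := offe_itv lay e; move=> /andP[h1 h2]; apply/andP; split; lra. Qed.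

Lemma path_itv_edge e u x : rng e = fsrc u ->
  path_itv (tcons e u) x -> offe e <= x - offv (src e) < offe e + child_mass e.
Proof.
elim/finpath_ind: u e x => [v|e' u eu' IH] e x eu.
  have [y ->] := edge_affine_surj e x => /(path_itv_tcons _ eu).
  by rewrite path_itv_fvertex => h; apply: edge_affine_itv; rewrite eu.
have [y ->] := edge_affine_surj e x => /(path_itv_tcons _ eu)/(IH _ _ eu').
rewrite fsrc_tcons// in eu; move=> /edge_itv_src.
by rewrite -eu => /edge_affine_itv.
Qed.

Lemma path_itv_src u x : path_itv u x -> path_itv (fvertex (fsrc u)) x.
Proof.
elim/finpath_ind: u x => // e u eu _ x /(path_itv_edge eu)/edge_itv_src.
by rewrite fsrc_tcons// path_itv_fvertex.
Qed.

Lemma path_itv01 u x : path_itv u x -> 0 <= x < 1.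
Proof.
move=> /path_itv_src; rewrite path_itv_fvertex => /andP[h1 h2].
by have [v0 v1] := offv_itv lay (fsrc u); apply/andP; split; lra.
Qed.

Lemma path_itv_comparable u u' x : path_itv u x -> path_itv u' x -> (len u <= len u')%N ->
  ple u (Fin u').
Proof.
elim/finpath_ind: u u' x => [v|e u eu IH] u' x.
  rewrite path_itv_fvertex => xv /path_itv_src; rewrite path_itv_fvertex => xu _.
  by apply/ple_fvertex; rewrite (offv_inj lay xv xu).
have [->|[e' [u1 [eu1 ->]]]] := finpath_case u'; first by rewrite len_tcons.
rewrite !len_tcons// ltnS => h h' le.
have xe := path_itv_edge eu h; have xe' := path_itv_edge eu1 h'.
have se : src e = src e' by exact: (offv_inj lay (edge_itv_src xe) (edge_itv_src xe')).
have ee : e = e' by apply: (offe_inj lay se xe); rewrite se.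
subst e'; apply/ple_tcons => //; split => //.
have [y xy] := edge_affine_surj e x; move: h h'; rewrite xy.
by move=> /(path_itv_tcons _ eu) h /(path_itv_tcons _ eu1) h'; exact: IH h h' le.
Qed.

Lemma path_itv_segment u u' x : path_itv u' x -> ple u (Fin u') -> path_itv u x.
Proof.
elim/finpath_ind: u u' x => [v|e u eu IH] u' x.
  by move=> /path_itv_src + /ple_fvertex/= <-.
have [->|[e' [u1 [eu1 ->]]]] := finpath_case u'; first by move=> _ /(ple_tcons_fvertex eu).
move=> + /(ple_tcons eu eu1)[ee uu]; subst e'.
have [y ->] := edge_affine_surj e x => /(path_itv_tcons _ eu1) h.
by apply/(path_itv_tcons _ eu); exact: IH h uu.
Qed.

(** At a vertex of [Rg] the outgoing edges leave no gap, so a coded path never stops there; this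
    puts the codes in the boundary. *)
Lemma path_itv_extend u x : path_itv u x -> Rg (frng u) ->
  exists2 u', path_itv u' x & (len u < len u')%N.
Proof.
elim/finpath_ind: u x => [v|e u eu IH] x.
  rewrite path_itv_fvertex => /andP[x0 x1] Rv.
  have [|e ev ex] := offe_cover lay (x := x - offv v) Rv.
    by rewrite subr_ge0 x0/= ltrBlDl.
  exists (tcons e (fvertex (rng e))); last by rewrite len_tcons.
  have [y xy] := edge_affine_surj e x; rewrite xy; apply/path_itv_tcons => //.
  have {}ev : src e = v := ev.
  rewrite path_itv_fvertex; move: ex; rewrite xy -ev edge_affineB /child_mass.
  have w0 := edge_weight_gt0 beta N_gt0 e.
  rewrite lerDl ltrD2l ltr_pM2l// pmulr_rge0// subr_ge0.
  by rewrite ltrBlDl.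
rewrite frng_tcons//; have [y ->] := edge_affine_surj e x => /(path_itv_tcons _ eu) yu Ru.
have [u' yu' uu'] := IH _ yu Ru.
have eu' : rng e = fsrc u'.
  have /ltnW le := uu'; have [su _] := path_itv_comparable yu yu' le.
  by rewrite eu.
by exists (tcons e u'); [apply/path_itv_tcons | rewrite !len_tcons].
Qed.

Lemma boundary_coding x : 0 <= x < 1 ->
  exists b : boundary Rg, forall u, ple u (set_val b) <-> path_itv u x.
Proof.
move=> x01; have [v vx] := offv_cover lay x01.
have [||u u' x1 x2 le|y yP] := @pathspace_of_segments E [set u | path_itv u x].
- by exists (fvertex v); apply/path_itv_fvertex.
- by move=> u u'; exact: path_itv_segment.
- exact: path_itv_comparable x1 x2 le.
have by_ : boundary_set Rg y.
  case: y yP => [u|y] yP; last by left; exists y.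
  right; exists u => // Ru; have xu := (yP u).1 (ple_refl u).
  have [u' xu' lu] := path_itv_extend xu Ru.
  by have := ple_len ((yP u').2 xu'); rewrite leqNgt lu.
by exists (SigSub (mem_set by_)) => u; exact: yP.
Qed.

(** By [psum_charge_len], the widths belonging to a fixed length sum to at most the total mass 1 of
    m. *)
Lemma countable_charged : countable [set u | itv_width u != 0].
Proof.
have sm := Dbeta_superharmonic; have [_ m1 _ _] := mD.
apply: (@sub_countable _ _ _ (\bigcup_n [set u | len u = n /\ itv_width u != 0])).
  by apply: subset_card_le => u uw; exists (len u).
apply: bigcup_countable => // n _; apply: esum_lt_pinfty_countable; first exact: itv_width_ge0.
have m0 v : (0 <= (EFin \o m) v)%E by rewrite lee_fin.
rewrite (@eq_esum _ _ _ _ (fun u => (pw u)%:E * (EFin \o m) (frng u))%E)//.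
rewrite -esum_psum//; apply: (@le_lt_trans _ _ 1%E); last exact: ltry.
rewrite -m1; apply: le_esum => v _; rewrite -(psum_charge_len N_gt0 n v sm) leeDr//.
by apply: psum_ge0 => // v'; rewrite lee_fin charge_ge0.
Qed.

End CodingIntervals.

(** * Existence of the associated measure *)

Section UnitIntervalPushforward.
Variables (R : realType) (d : measure_display) (T : measurableType d).
Variable f : measurableTypeR R -> T.
Hypothesis mf : measurable_fun setT f.
Local Open Scope ereal_scope.
Let J : set (measurableTypeR R) := `[0%R, 1%R[%classic.
Let mJ : measurable J. Proof. exact: measurable_itv. Qed.

(** The pushforward of Lebesgue measure on [0,1). The measurability proof is an argument so that the
    measure instance can be attached to the function. *)
Definition unit_law & measurable_fun setT f := fun A : set T => lebesgue_measure (f @^-1` A `&` J).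
Let P := unit_law mf.

Let mfA (A : set T) : measurable A -> measurable (f @^-1` A `&` J).
Proof. by move=> mA; apply: measurableI => //; rewrite -[X in measurable X]setTI; exact: mf. Qed.

Let P0 : P set0 = 0. Proof. by rewrite /P /unit_law preimage_set0 set0I measure0. Qed.

Let Pge0 A : 0 <= P A. Proof. exact: measure_ge0. Qed.

Let Psigma : semi_sigma_additive P.
Proof.
move=> F mF tF mUF; rewrite /P /unit_law preimage_bigcup setI_bigcupl.
apply: measure_semi_sigma_additive.
- by move=> n; exact: mfA.
- apply/trivIsetP => /= i j _ _ ij; rewrite setIACA -preimage_setI.
  by move/trivIsetP : tF => /(_ _ _ _ _ ij) ->//; rewrite preimage_set0 set0I.
- by rewrite -setI_bigcupl -preimage_bigcup; exact: mfA.
Qed.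

HB.instance Definition _ :=
  isMeasure.Build _ _ _ (unit_law mf) P0 Pge0 Psigma.

Let P1 : unit_law mf setT = 1.
Proof.
rewrite /unit_law preimage_setT setTI /J lebesgue_measure_itv/= lte_fin ltr01.
by rewrite oppr0 adde0.
Qed.

HB.instance Definition _ := Measure_isProbability.Build _ _ _ (unit_law mf) P1.

End UnitIntervalPushforward.

(** The image is a preimage under the inverse map; its measure, rescaled, agrees with Lebesgue
    measure on half-open intervals, hence everywhere by uniqueness. *)
Lemma lebesgue_measure_affine (R : realType) (a b : R) (A : set (measurableTypeR R)) : 0 < a ->
  measurable A -> (lebesgue_measure [set (a * x + b)%R | x in A] = a%:E * lebesgue_measure A)%E.
Proof.
move=> a0 mA; pose f (x : measurableTypeR R) : measurableTypeR R := (x - b) / a.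
have mf : measurable_fun setT f.
  by apply: measurable_funM => //; apply: measurable_funB.
have fA (B : set (measurableTypeR R)) : [set a * x + b | x in B] = f @^-1` B.
  apply/seteqP; split => [_ [x Bx <-]|y By]; rewrite /preimage/f/=.
    by rewrite addrK mulrC mulKf ?gt_eqF.
  by exists ((y - b) / a) => //; rewrite mulrC divfK ?gt_eqF// subrK.
have a'0 : 0 <= a^-1 by rewrite invr_ge0 ltW.
pose nu := pushforward lebesgue_measure f.
have h := @lebesgue_measure_unique R (mscale (NngNum a'0) nu).
have {}h := h mf; rewrite fA (h _ A)//.
  by rewrite /mscale/= muleA -EFinM mulfV ?gt_eqF// mul1e.
move=> _ [[x y] _ <-].
transitivity (a^-1%:E * lebesgue_measure (f @^-1` `]x, y]%classic))%E; last by [].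
rewrite (_ : f @^-1` _ = `]a * x + b, a * y + b]%classic); last first.
  apply/seteqP; split => z; rewrite /f/= !in_itv/= => /andP[h1 h2]; apply/andP; split.
  - by move: h1; rewrite ltr_pdivlMr// ltrBrDr mulrC.
  - by move: h2; rewrite ler_pdivrMr// lerBlDr mulrC.
  - by rewrite ltr_pdivlMr// ltrBrDr mulrC.
  - by rewrite ler_pdivrMr// lerBlDr mulrC.
rewrite !lebesgue_measure_itv/= !lte_fin ltrD2r ltr_pM2l//.
case: ifPn => _; last by rewrite mule0.
by rewrite -!EFinB -EFinM; congr EFin; field; rewrite gt_eqF.
Qed.

(** * The law of the coded path *)

Section CodingMeasure.
Variables (R : realType) (E : digraph) (Rg : set (vert E)) (N : edge E -> R) (beta : R).
Hypothesis N_gt0 : forall e, 0 < N e.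
Variable m : vert E -> R.
Hypothesis mD : Dbeta Rg N beta m.
Variables (offv : vert E -> R) (offe : edge E -> R).
Hypothesis lay : layout Rg N beta m offv offe.
Local Notation w := (edge_weight N beta).
Local Notation itv_start := (itv_start N beta offv offe).
Local Notation itv_width := (itv_width N beta m).
Local Notation path_itv := (path_itv N beta m offv offe).
Local Notation edge_affine := (edge_affine N beta offv offe).
Variables (p : boundary Rg) (code : measurableTypeR R -> borelType (boundary_at p)).
Hypothesis code_in : forall x, 0 <= x < 1 ->
  forall u, ple u (set_val (code x : boundary_at p)) <-> path_itv u x.
Hypothesis code_out : forall x : R, ~ (0 <= x < 1) -> code x = p.
Implicit Types (u : finpath E) (e : edge E) (v : vert E) (x : R).

Let J : set (measurableTypeR R) := `[0, 1[%classic.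
Let mJ : measurable J. Proof. exact: measurable_itv. Qed.

(** Restricting to nonempty intervals keeps this set countable even when there are uncountably many
    paths. *)
Definition endpoints : set (measurableTypeR R) :=
  itv_start @` [set u | itv_width u != 0] `|`
  (fun u => itv_start u + itv_width u) @` [set u | itv_width u != 0].

Lemma countable_endpoints : countable endpoints.
Proof.
have c := countable_charged N_gt0 mD.
rewrite /endpoints -bigcup2E; apply: bigcup_countable => // -[|[|n]] _ /=.
- exact: sub_countable (card_image_le _ _) c.
- exact: sub_countable (card_image_le _ _) c.
- exact: countable0.
Qed.

Let G : set (measurableTypeR R) := J `\` endpoints.

Let mcountable (A : set (measurableTypeR R)) : countable A -> measurable A.
Proof. by apply: countable_measurable => t; exact: measurable_set1. Qed.

Let mG : measurable G.
Proof.
apply: measurableD; first exact: mJ.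
by apply: mcountable; exact: countable_endpoints.
Qed.

(* Away from the endpoints the intervals are relatively clopen. *)
Lemma code_continuous : {within (G : set R), continuous (code : R -> boundary_at p)}.
Proof.
apply/subspace_continuousP => x [Jx nx] U.
move=> [V [[W oW WV] Vx] VU].
have Wcx : W (set_val (code x : boundary_at p)) by move: Vx; rewrite -WV.
suff cv : (fun y => set_val (code y : boundary_at p)) @ within (G : set R) (nbhs (x : R)) -->
    set_val (code x : boundary_at p).
  have : nbhs (set_val (code x : boundary_at p)) W by exact: open_nbhs_nbhs.
  move=> /cv h; have {}h : nbhs (x : R) [set y | G y -> W (set_val (code y : boundary_at p))] by [].
  suff : nbhs (x : R) [set y | G y -> U (code y)] by [].
  by apply: filterS h => y h /h Wy; apply: VU; rewrite -WV.
have x01 : 0 <= x < 1 by move: Jx; rewrite /J/= in_itv.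
have y01 (y : R) : G y -> 0 <= y < 1 by move=> [+ _]; rewrite /J/= in_itv.
have ne u : itv_width u != 0 -> x != itv_start u /\ x != itv_start u + itv_width u.
  move=> uw; split; apply/eqP => xe; apply: nx; [left|right]; exists u => //.
apply: cvg_pathspace => u.
- move=> /(code_in x01); rewrite /path_itv/= => /andP[h1 h2].
  have uw : itv_width u != 0.
    by apply/eqP => uw; move: (le_lt_trans h1 h2); rewrite uw addr0 ltxx.
  have [n1 n2] := ne u uw.
  have : nbhs (x : R) `]itv_start u, (itv_start u + itv_width u)[%classic.
    by apply: open_nbhs_nbhs; split => //; rewrite /= in_itv/= h2 lt_neqAle eq_sym n1 h1.
  apply: filterS => y; rewrite /= in_itv/= => /andP[y1 y2] Gy.
  by apply/code_in; [exact: y01|rewrite /path_itv/= (ltW y1)].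
- move=> /(code_in x01) nux.
  have [uw|uw] := eqVneq (itv_width u) 0.
    apply: (@filterS _ (nbhs (x : R)) _ setT) => [y _ Gy|]; last exact: filterT.
    move=> uy; have := (code_in (y01 y Gy) u).1 uy; rewrite /path_itv/= => /andP[h1 h2].
    by move: (le_lt_trans h1 h2); rewrite uw addr0 ltxx.
  have [n1 n2] := ne u uw.
  have [xs|sx] := ltP x (itv_start u).
    have : nbhs (x : R) `]-oo, (itv_start u)[%classic.
      by apply: open_nbhs_nbhs; split => //; rewrite /= in_itv.
    apply: filterS => y; rewrite /= in_itv/= => yu Gy.
    by move=> uy; have := (code_in (y01 y Gy) u).1 uy; rewrite /path_itv/= leNgt yu.
  have sx' : itv_start u + itv_width u < x.
    rewrite lt_neqAle eq_sym n2 leNgt; apply/negP => xs; apply: nux.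
    by rewrite /path_itv/= sx.
  have : nbhs (x : R) `](itv_start u + itv_width u), +oo[%classic.
    by apply: open_nbhs_nbhs; split => //; rewrite /= in_itv/= sx'.
  apply: filterS => y; rewrite /= in_itv/= andbT => yu Gy.
  by move=> uy; have := (code_in (y01 y Gy) u).1 uy; rewrite /path_itv/= ltNge (ltW yu) andbF.
Qed.

Lemma measurable_code : measurable_fun setT code.
Proof.
have gen : @measurable _ (borelType (boundary_at p)) = <<s @open (boundary_at p) >> by [].
apply: (measurability _ gen) => _ [U oU <-].
rewrite setTI.
have [V oV VG] : exists2 V : set R, open V & V `&` (G : set R) = code @^-1` U `&` (G : set R).
  by apply/open_subspaceP; move/continuousP: code_continuous => /(_ U oU).
(* Three pieces: relatively open in [G] by continuity, countable, and the outside of [0,1), where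
   [code] is constant. *)
rewrite (_ : code @^-1` U = (code @^-1` U `&` G) `|`
    (code @^-1` U `&` endpoints) `|` (code @^-1` U `&` ~` J)); last first.
  apply/seteqP; split => [x Ux|x [[[]|[]]|[]]//].
  have [Jx|nJx] := pselect (J x); last by right.
  by left; have [ex|nex] := pselect (endpoints x); [right|left].
apply: measurableU; first apply: measurableU.
- rewrite -VG; apply: measurableI => //; exact: open_measurable.
- apply: mcountable; apply: sub_countable countable_endpoints.
  by apply: subset_card_le => x [].
- have nJ x : (~` J) x -> code x = p.
    by move=> nJx; apply: code_out => x01; apply: nJx; rewrite /J/= in_itv.
  have [Up|nUp] := pselect (U p).
    rewrite (_ : _ `&` _ = ~` J); first exact: measurableC.
    by apply/seteqP; split => [x []//|x nJx]; split; rewrite // /preimage/= nJ.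
  rewrite (_ : _ `&` _ = set0)//; apply/seteqP; split => // x [+ /nJ].
  by rewrite /preimage/= => Ux xp; apply: nUp; rewrite -xp.
Qed.

Definition code_law : probability (borelType (boundary_at p)) R := unit_law measurable_code.

Lemma code_lawE (A : set (borelType (boundary_at p))) :
  code_law A = lebesgue_measure (code @^-1` A `&` J).
Proof. by []. Qed.

Let mpre (A : set (borelType (boundary_at p))) : measurable A -> measurable (code @^-1` A).
Proof. by move=> mA; rewrite -[X in measurable X]setTI; exact: measurable_code. Qed.

Local Open Scope ereal_scope.

(** Lebesgue inner regularity provides a compact set inside the preimage of [A] within [G]; its
    image is compact since [code] is continuous on [G], and removing the countable [endpoints] costs
    no mass. *)
Lemma code_law_inner (A : set (borelType (boundary_at p))) (eps : R) : measurable A -> (0 < eps)%R ->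
  exists K : set (boundary_at p), [/\ compact K, K `<=` A & code_law A < code_law K + eps%:E].
Proof.
move=> mA eps0; pose B := code @^-1` A `&` G.
have mB : measurable B by apply: measurableI => //; exact: mpre.
have AB : code_law A = lebesgue_measure B.
  rewrite code_lawE; apply/eqP; rewrite eq_le; apply/andP; split; last first.
    apply: le_measure; rewrite ?inE//; first by apply: measurableI => //; exact: mpre.
    by move=> x [Ax []].
  have mE : measurable endpoints by apply: mcountable; exact: countable_endpoints.
  apply: (@le_trans _ _ (lebesgue_measure (B `|` endpoints))).
    apply: le_measure; rewrite ?inE.
    - by apply: measurableI => //; exact: mpre.
    - exact: measurableU.
    - move=> x [Ax Jx]; have [ex|nex] := pselect (endpoints x); first by right.
      by left.
  apply: le_trans (measureU2 _ _ _) _ => //.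
  by rewrite [X in _ + X](countable_lebesgue_measure0 countable_endpoints) adde0.
have Boo : lebesgue_measure B < +oo by rewrite -AB (le_lt_trans (probability_le1 _ _))// ltry.
have [V [cV VB BV]] := lebesgue_regularity_inner mB Boo eps0.
have mV : measurable V by exact: compact_measurable.
have cK : compact ((code : R -> boundary_at p) @` V).
  apply: continuous_compact cV; apply: continuous_subspaceW code_continuous.
  by move=> x /VB[].
exists (code @` V); split => //; first by move=> _ [x /VB[Ax _] <-].
have mK : measurable (code @` V : set (borelType (boundary_at p))) by exact: compact_borel.
have VK : lebesgue_measure V <= code_law (code @` V).
  rewrite code_lawE; apply: le_measure; rewrite ?inE//.
    by apply: measurableI => //; exact: mpre.
  by move=> x Vx; split; [exists x|have [_ []] := VB x Vx].
have BVE : lebesgue_measure B = lebesgue_measure V + lebesgue_measure (B `\` V).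
  rewrite -measureU//; last 2 first.
  - exact: measurableD.
  - by apply/seteqP; split => // x [Vx []].
  by congr lebesgue_measure; rewrite setDUK.
rewrite AB BVE; apply: (@lt_le_trans _ _ (lebesgue_measure V + eps%:E)).
  by rewrite lteD2lE// ge0_fin_numE// (le_lt_trans _ Boo)// le_measure ?inE.
exact: leeD.
Qed.

Lemma code_law_regular : regular_measure code_law.
Proof.
have fin (A : set (borelType (boundary_at p))) : measurable A -> code_law A \is a fin_num.
  by move=> mA; exact: fin_num_measure.
split => [A mA|U oU].
  apply/eqP; rewrite eq_le; apply/andP; split.
    apply: le_ereal_inf_tmp => _ [U [oU AU] <-].
    by apply: le_measure; rewrite ?inE//; exact: open_borel.
  apply/lee_addgt0Pr => eps eps0.
  (* Outer approximation of [A] is inner approximation of its complement, compact sets being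
     closed. *)
  have mAC : measurable (~` A) by exact: measurableC.
  have [K [cK KA lt]] := code_law_inner mAC eps0.
  have mK : measurable (K : set (borelType (boundary_at p))) by exact: compact_borel.
  have oK : open (~` K : set (boundary_at p)).
    by apply: closed_openC; apply: compact_closed cK; exact: boundary_hausdorff.
  apply: (@le_trans _ _ (code_law (~` K))).
    apply: ereal_inf_lbound; exists (~` K) => //; split => // x Ax Kx; exact: KA Kx Ax.
  move: lt; rewrite !probability_setC//.
  by rewrite -(fineK (fin _ mA)) -(fineK (fin _ mK)) -!EFinB -!EFinD lte_fin lee_fin; lra.
have mU : measurable (U : set (borelType (boundary_at p))) by exact: open_borel.
apply/eqP; rewrite eq_le; apply/andP; split; last first.
  apply: ge_ereal_sup => _ [K [cK KU] <-].
  by apply: le_measure; rewrite ?inE//; exact: compact_borel.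
apply/lee_addgt0Pr => eps eps0.
have [K [cK KU lt]] := code_law_inner mU eps0.
apply: (le_trans (ltW lt)); rewrite leeD2r//.
by apply: ereal_sup_ubound; exists K.
Qed.

Lemma code_law_vertex v : code_law (trace p (cylinder (fvertex v))) = (m v)%:E.
Proof.
rewrite code_lawE (_ : _ `&` _ = `[offv v, (offv v + m v)%R[%classic).
  have m0 : (0 <= m v)%R by have [m0 _] := Dbeta_superharmonic mD.
  rewrite lebesgue_measure_itv/= lte_fin ltrDl -EFinB addrAC subrr add0r.
  by case: ifPn => //; rewrite -leNgt => mv; congr EFin; apply/eqP; rewrite eq_le m0.
apply/seteqP; split => [x [vx Jx]|x]; rewrite /= in_itv/=.
  have x01 : (0 <= x < 1)%R by move: Jx; rewrite /J/= in_itv.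
  by have := (code_in x01 (fvertex v)).1 vx; rewrite path_itv_fvertex.
move=> vx; have pv : path_itv (fvertex v) x by rewrite path_itv_fvertex.
have x01 := path_itv01 N_gt0 lay pv.
by split; [exact/(code_in x01) | rewrite /J/= in_itv].
Qed.

(** By [step], coding after [edge_affine e] is prepending [e] to the coded path, so the preimage of
    eA is the affine image of the preimage of [A]. *)
Lemma code_law_edge e (A : set (borelType (boundary_at p))) : measurable A ->
  A `<=` trace p (cylinder (fvertex (rng e))) ->
  code_law (edge_mul e A) = (w e)%:E * code_law A.
Proof.
move=> mA Ae; rewrite !code_lawE.
have w0 := edge_weight_gt0 beta N_gt0 e.
pose b := (offv (src e) + offe e - w e * offv (rng e))%R.
have affE x : edge_affine e x = (w e * x + b)%R.
  by rewrite /edge_affine /b; ring.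
have mJA : measurable (code @^-1` A `&` J) by apply: measurableI => //; exact: mpre.
rewrite -(lebesgue_measure_affine b w0 mJA); congr lebesgue_measure.
have Jp x : J x -> (0 <= x < 1)%R by rewrite /J/= in_itv.
have step x : path_itv (fvertex (rng e)) x -> exists h : rng e = psrc (set_val (code x : boundary_at p)),
    set_val (code (edge_affine e x) : boundary_at p) = pcons h.
  move=> xe; have x01 := path_itv01 N_gt0 lay xe.
  have hx : rng e = psrc (set_val (code x : boundary_at p)).
    by apply/esym/ple_fvertex/(code_in x01).
  have exe : path_itv (tcons e (fvertex (rng e))) (edge_affine e x) by exact/path_itv_tcons.
  have ex01 := path_itv01 N_gt0 lay exe.
  have [x' [h' xx']] := ple_tcons_pcons (erefl : rng e = fsrc (fvertex (rng e))) ((code_in ex01 _).2 exe).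
  have e' : x' = set_val (code x : boundary_at p).
    apply: pathspace_eq => u; have [eu|neu] := pselect (rng e = fsrc u).
      by rewrite -(ple_pcons h' eu) -xx' (code_in x01) (code_in ex01); exact: path_itv_tcons.
    by split => /ple_src us; exfalso; apply: neu; rewrite us.
  by subst x'; exists h'.
apply/seteqP; split => [y [[z [h [Az yz]]] Jy]|_ [x [Ax Jx] <-]].
  have y01 := Jp y Jy; have [x yx] := edge_affine_surj beta N_gt0 offv offe e y.
  have xe : path_itv (fvertex (rng e)) x.
    have er : rng e = fsrc (fvertex (rng e)) by [].
    apply/(path_itv_tcons beta N_gt0 m offv offe x er); rewrite -yx; apply/(code_in y01).
    by rewrite yz; apply/(ple_pcons h er); exact: Ae.
  have [h' yh'] := step x xe; exists x; last by rewrite -affE.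
  split; last by rewrite /J/= in_itv/=; exact: (path_itv01 N_gt0 lay xe).
  have zx : z = code x :> boundary_at p.
    apply: val_inj; apply: (pcons_inj (h := h) (h' := h')).
    by rewrite -yz -yh' yx.
  by rewrite /preimage/= -zx.
have x01 := Jp x Jx; rewrite -affE.
have xe : path_itv (fvertex (rng e)) x by apply/(code_in x01); exact: Ae.
have [h hx] := step x xe; split; first by exists (code x : boundary_at p), h.
rewrite /J/= in_itv/=; apply: (path_itv01 N_gt0 lay).
by apply/(path_itv_tcons beta N_gt0 m offv offe x (erefl : rng e = fsrc (fvertex (rng e)))).
Qed.

Lemma code_law_associated : associated_measure N beta m code_law.
Proof.
split; [exact: code_law_regular|exact: code_law_vertex|exact: code_law_edge].
Qed.

End CodingMeasure.

Lemma associated_measure_exists (R : realType) (E : digraph) (Rg : set (vert E))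
    (N : edge E -> R) (beta : R) (m : vert E -> R) : (forall e, 0 < N e) ->
  Dbeta Rg N beta m ->
  exists (p : boundary Rg) (mu : probability (borelType (boundary_at p)) R),
    associated_measure N beta m mu.
Proof.
move=> N0 mD; have [offv [offe lay]] := layout_exists N0 mD.
(* The boundary is nonempty because the number 0 codes a point of it. *)
have [p _] : exists p : boundary Rg, True.
  by have [|p _] := boundary_coding N0 lay (x := 0); [rewrite lexx ltr01|exists p].
have ch (x : R) : exists b : boundary Rg,
    (0 <= x < 1 -> forall u, ple u (set_val b) <-> path_itv N beta m offv offe u x) /\
    (~ 0 <= x < 1 -> b = p).
  have [x01|nx] := pselect (0 <= x < 1).
    by have [b bP] := boundary_coding N0 lay x01; exists b.
  by exists p.
have [code codeP] := choice ch.
exists p, (@code_law R E Rg N beta N0 m mD offv offe p code (fun x => (codeP x).1) (fun x => (codeP x).2)).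
exact: code_law_associated.
Qed.

(** * Countable convex combinations *)

Section ConvexHull.
Variables (R : realType) (V : choiceType) (M : set (V -> R)).
Hypothesis M_ge0 : forall a v, M a -> 0 <= a v.
Implicit Types (a b m : V -> R) (t : (V -> R) -> R).
Local Open Scope ereal_scope.

Lemma esumD1 (I : choiceType) (A : set I) (F : I -> \bar R) i : (forall j, A j -> 0 <= F j) ->
  A i -> \esum_(j in A) F j = F i + \esum_(j in A `\ i) F j.
Proof.
move=> F0 Ai; rewrite (esumID [set i])//; congr (_ + _).
rewrite (_ : _ `&` _ = [set i]) ?esum_set1 ?F0//.
by apply/seteqP; split => [j []//|_ ->].
Qed.

Lemma esum_le_supp (I : choiceType) (A B : set I) (F : I -> \bar R) : A `<=` B ->
  (forall j, B j -> 0 <= F j) -> (forall j, B j -> ~ A j -> F j = 0) ->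
  \esum_(j in B) F j = \esum_(j in A) F j.
Proof.
move=> AB F0 Fz; rewrite (esumID A)// [X in _ + X]esum1 ?adde0; last by move=> j [] /Fz.
by congr esum; apply/seteqP; split => [j []//|j Aj]; split => //; exact: AB.
Qed.

Lemma conv_hull_incl a : M a -> conv_hull M a.
Proof.
move=> Ma; exists (fun b => (b == a)%:R)%R; split.
- by move=> b _; rewrite ler0n.
- rewrite (esumD1 _ Ma); last by move=> b _; rewrite lee_fin ler0n.
  by rewrite eqxx esum1 ?adde0// => b [_ /eqP/negbTE ->].
- move=> v; rewrite (esumD1 _ Ma); last first.
    by move=> b Mb; rewrite lee_fin mulr_ge0 ?ler0n ?M_ge0.
  by rewrite eqxx mul1r esum1 ?adde0// => b [_ /eqP/negbTE ->]; rewrite mul0r.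
Qed.

(** Deletes [a] from a convex combination and rescales the other weights. [F] is an evaluation at a
    vertex, or the constant 1 when the weights themselves are summed. *)
Lemma conv_weight_split t a (F : (V -> R) -> R) s : M a -> (forall b, M b -> 0 <= t b)%R ->
  (forall b, M b -> 0 <= F b)%R -> (t a < 1)%R ->
  s%:E = \esum_(b in M) (t b * F b)%:E ->
  ((s - t a * F a) / (1 - t a))%:E =
    \esum_(b in M) ((if b == a then 0 else t b / (1 - t a)) * F b)%:E.
Proof.
move=> Ma t0 F0 ta1 sE; have c0 : (0 < 1 - t a)%R by rewrite subr_gt0.
have tF0 b : M b -> 0 <= (t b * F b)%:E by move=> Mb; rewrite lee_fin mulr_ge0 ?t0 ?F0.
rewrite [RHS](esumD1 _ Ma); last first.
  move=> b Mb; rewrite lee_fin mulr_ge0 ?F0//; case: ifP => // _.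
  by rewrite divr_ge0 ?t0// ltW.
rewrite eqxx mul0r add0e.
rewrite (@eq_esum _ _ _ _ (fun b => (1 - t a)^-1%:E * (t b * F b)%:E)); last first.
  by move=> b [_ /eqP/negbTE ->]; rewrite -EFinM; congr EFin; ring.
rewrite esumZl ?invr_ge0 ?(ltW c0)//; last by move=> b [Mb _]; exact: tF0.
move: sE; rewrite (esumD1 tF0 Ma) => /(congr1 (fun x => x - (t a * F a)%:E)).
by rewrite [X in _ = X - _]addeC addeK// -EFinB => <-; rewrite -EFinM mulrC.
Qed.

(** Some generator [a] has positive weight. If the weight is 1 then [m = a]; otherwise [m] lies
    strictly between [a] and the rescaled rest [b], and extremality gives [a = m]. *)
Lemma extreme_conv_hull m : extreme_points (conv_hull M) m -> M m.
Proof.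
move=> [[t [t0 t1 mE]] ext].
have [a [Ma ta0]] : exists a, M a /\ (0 < t a)%R.
  apply: contrapT => no; have : \esum_(a in M) (t a)%:E = 0.
    rewrite esum1// => a Ma; congr EFin; apply/eqP; rewrite eq_le t0// andbT leNgt.
    by apply/negP => ta; apply: no; exists a.
  by rewrite t1 => -[/eqP]; rewrite oner_eq0.
have tE0 b : M b -> 0 <= (t b)%:E by move=> Mb; rewrite lee_fin t0.
have tv0 v b : M b -> 0 <= (t b * b v)%:E by move=> Mb; rewrite lee_fin mulr_ge0 ?t0 ?M_ge0.
have := t1; rewrite (esumD1 tE0 Ma) => t1'.
have ta1 : (t a <= 1)%R.
  rewrite -lee_fin -t1' leeDl//; apply: esum_ge0 => b [Mb _]; exact: tE0.
move: ta1; rewrite le_eqVlt => /orP[/eqP ta1|ta1].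
  have tb b : M b -> b != a -> t b = 0%R.
    move=> Mb ba; have s0 : \esum_(j in M `\ a) (t j)%:E = 0.
      by move: t1' => /(congr1 (fun x => x - 1)); rewrite ta1 [X in X - _]addeC addeK// subee.
    have := esum_eq0 (fun j (h : (M `\ a) j) => tE0 j h.1) s0 (conj Mb (elimN eqP ba)).
    by case.
  suff -> : m = a by [].
  apply/funext => v; apply: EFin_inj; rewrite mE (esumD1 (tv0 v) Ma) ta1 mul1r.
  by rewrite esum1 ?adde0// => b [Mb /eqP ba]; rewrite tb// mul0r.
pose b v := ((m v - t a * a v) / (1 - t a))%R.
have Kb : conv_hull M b.
  exists (fun c => if c == a then 0 else t c / (1 - t a))%R; split.
  - by move=> c Mc; case: ifP => // _; rewrite divr_ge0 ?t0// subr_ge0 ltW.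
  - transitivity (\esum_(c in M) ((if c == a then 0 else t c / (1 - t a)) * 1)%:E).
      by apply: eq_esum => c _; rewrite mulr1.
    rewrite -(@conv_weight_split t a (fun=> 1%R) 1%R)//.
      by rewrite mulr1 divff// subr_eq0 eq_sym lt_eqF.
    by rewrite -t1; apply: eq_esum => c _; rewrite mulr1.
  - by move=> v; apply: (@conv_weight_split t a (fun c => c v)) => // c Mc; exact: M_ge0.
have [] := ext a b (t a) (conv_hull_incl Ma) Kb ta0 ta1; last by move=> <-.
by apply/funext => v; rewrite /b; field; rewrite subr_eq0 eq_sym lt_eqF.
Qed.

End ConvexHull.

(** * Extreme points and decomposition in the simplex *)

Section Dbeta.
Variables (R : realType) (E : digraph) (Rg : set (vert E)) (N : edge E -> R) (beta : R).
Hypothesis N_gt0 : forall e, 0 < N e.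
Local Notation transfer := (transfer N beta).
Local Notation psum := (psum N beta).
Local Notation Za := (Za N beta).
Local Notation Zs := (Zs N beta).
Local Notation za := (za N beta).
Local Notation zs := (zs N beta).
Local Notation mbeta := (mbeta N beta).
Local Notation superharmonic := (superharmonic N beta).
Local Notation charge := (charge N beta).
Local Notation admissible := (admissible N beta).
Local Notation critical := (critical N beta).
Local Notation pw := (path_weight N beta).
Local Notation Dbeta := (Dbeta Rg N beta).
Local Notation M_reg := (M_reg Rg N beta).
Local Notation M_crit := (M_crit N beta).
Implicit Types (u : finpath E) (e : edge E) (v : vert E) (a m k h : vert E -> R).
Local Open Scope ereal_scope.

Definition extremal_vertices : set (vert E) := beta_regular N beta `\` Rg `|` beta_critical N beta.
Local Notation A := extremal_vertices.

Lemma extremal_admissible v : A v -> admissible v.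
Proof. by move=> [[[Zoo Z1] _]|[Zoo Z1]]; split; rewrite // ?Z1// ltW. Qed.

Lemma M_critE : M_crit = mbeta @` [set v | critical v].
Proof.
have cls v : critical v ->
    mbeta_class N beta [set w | beta_critical N beta w /\ vequiv v w] = mbeta v.
  move=> cv; rewrite /mbeta_class; case: xgetP => [_ -> [w [cw [vw wv]] <-]|/(_ (mbeta v))[]].
    by apply: mbeta_eq => //; exact: critical_admissible.
  by exists v => //; split => //; split; exists (fvertex v).
apply/seteqP; split => [_ [_ [v cv ->] <-]|_ [v cv <-]].
  by exists v => //; rewrite cls.
by exists [set w | beta_critical N beta w /\ vequiv v w]; [exists v | exact: cls].
Qed.

Lemma M_regcritE : M_reg `|` M_crit = mbeta @` A.
Proof. by rewrite M_critE -image_setU. Qed.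

(** Equality on [Rg] means zero charge there: the only charge sits at [v], which is outside [Rg] or
    critical. *)
Lemma mbeta_Dbeta v : A v -> Dbeta (mbeta v).
Proof.
move=> Av; have adm := extremal_admissible Av; have [Zoo _] := adm.
have m0 v' := mbeta_ge0 beta N_gt0 v v'.
have sm := mbeta_superharmonic N_gt0 adm.
split.
- move=> v'; rewrite m0/= -lee_fin -(esum_mbeta N_gt0 Zoo).
  by apply: (@esum_ge1 _ _ _ (fun v' => (mbeta v v')%:E)) => // ? _; rewrite lee_fin.
- exact: esum_mbeta.
- move=> v' Rv'; apply/esym; have := superharmonic_transferE N_gt0 v' sm.
  suff -> : charge (mbeta v) v' = 0%R by rewrite subr0.
  case: Av => [[_ nRv]|cv]; last exact: charge_critical.
  rewrite charge_mbeta// /mbeta_charge; case: eqP => // vv.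
  by exfalso; apply: nRv; rewrite -vv.
- exact: (proj2 sm).
Qed.

Lemma Dbeta_sum m : Dbeta m -> \esum_(v in [set: vert E]) (m v)%:E = 1.
Proof. by case. Qed.

Lemma Dbeta_sum_lt m : Dbeta m -> \esum_(v in [set: vert E]) (m v)%:E < +oo.
Proof. by move=> /Dbeta_sum ->; rewrite ltry. Qed.

Lemma Dbeta_intro m : superharmonic m -> \esum_(v in [set: vert E]) (m v)%:E = 1 ->
  (forall v, Rg v -> charge m v = 0%R) -> Dbeta m.
Proof.
move=> sm m1 mR; split => //.
- move=> v; have m0 := proj1 sm; rewrite m0/= -lee_fin -m1.
  by apply: (@esum_ge1 _ _ _ (fun v' => (m v')%:E)) => // ? _; rewrite lee_fin.
- by move=> v Rv; apply/esym; have := superharmonic_transferE N_gt0 v sm; rewrite mR// subr0.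
- exact: (proj2 sm).
Qed.

Lemma Dbeta_charge m v : Dbeta m -> Rg v -> charge m v = 0%R.
Proof.
move=> mD Rv; have [_ _ mR _] := mD.
have -> : charge m v = (m v - fine (m v)%:E)%R by rewrite /charge (mR v Rv).
by rewrite subrr.
Qed.

(** In a splitting of [mbeta v], the part [t x] and its complement are both superharmonic, so [x] is
    a multiple of [mbeta v]; total mass 1 fixes the factor. *)
Lemma mbeta_extreme v (D : set (vert E -> R)) : D `<=` Dbeta -> A v -> D (mbeta v) ->
  extreme_points D (mbeta v).
Proof.
move=> DD Av Dv; split=> // x y t Dx Dy t0 t1 mE.
have adm := extremal_admissible Av; have [Zoo _] := adm.
have t1' : (0 < 1 - t)%R by rewrite subr_gt0.
have [stx _] := superharmonicZ N_gt0 (ltW t0) (Dbeta_superharmonic (DD _ Dx)).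
have [sty _] := superharmonicZ N_gt0 (ltW t1') (Dbeta_superharmonic (DD _ Dy)).
have xE : x = mbeta v.
  have smx : superharmonic (mbeta v \- (fun v => t * x v))%R.
    rewrite (_ : _ \- _ = (fun v => (1 - t) * y v))%R//.
    by apply/funext => v'; rewrite /= {1}mE; ring.
  have kE := mbeta_minimal N_gt0 adm stx smx.
  set c := (_ * _ * za v)%R in kE.
  have c0 : (0 <= c)%R.
    by rewrite mulr_ge0// ?(ltW (za_gt0 N_gt0 Zoo))//; exact: (proj1 stx).
  have : t%:E * (\esum_(v' in setT) (x v')%:E) = c%:E * (\esum_(v' in setT) (mbeta v v')%:E).
    rewrite -!esumZl// ?(ltW t0)//; last 2 first.
    - by move=> v' _; rewrite lee_fin mbeta_ge0.
    - by move=> v' _; rewrite lee_fin; have [x0 _] := Dbeta_superharmonic (DD _ Dx).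
    by apply: eq_esum => v' _; rewrite -!EFinM kE.
  rewrite (Dbeta_sum (DD _ Dx)) esum_mbeta// !mule1 => -[tc].
  by apply/funext => v'; have := kE v'; rewrite -tc => /mulfI; apply; rewrite gt_eqF.
split => //; apply/funext => v'; have := congr1 (@^~ v') mE; rewrite /= xE => e.
by apply: (mulfI (lt0r_neq0 t1')); lra.
Qed.

Section ConvexCombinations.
Variable M : set (vert E -> R).
Hypothesis MD : M `<=` Dbeta.

Let M_ge0 a v : M a -> (0 <= a v)%R.
Proof. by move=> /MD/Dbeta_superharmonic[]. Qed.

Lemma esum_weights (t : (vert E -> R) -> R) : (forall a, M a -> 0 <= t a)%R ->
  \esum_(v in setT) \esum_(a in M) (t a * a v)%:E = \esum_(a in M) (t a)%:E.
Proof.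
move=> t0; rewrite esum_exchange; last first.
  by move=> v a _ Ma; rewrite lee_fin mulr_ge0 ?t0 ?M_ge0.
apply: eq_esum => a Ma; rewrite (@eq_esum _ _ _ _ (fun v => (t a)%:E * (a v)%:E))//.
rewrite esumZl ?t0//; last by move=> v _; rewrite lee_fin M_ge0.
by rewrite Dbeta_sum ?mule1//; exact: MD.
Qed.

Lemma esum_superharmonic (t : (vert E -> R) -> R) m : (forall a, M a -> 0 <= t a)%R ->
  (forall v, (m v)%:E = \esum_(a in M) (t a * a v)%:E) ->
  superharmonic m /\ forall v, (charge m v)%:E = \esum_(a in M) (t a * charge a v)%:E.
Proof.
move=> t0 mE; have sM a : M a -> superharmonic a by move=> /MD/Dbeta_superharmonic.
have m0 v : (0 <= m v)%R.
  by rewrite -lee_fin mE; apply: esum_ge0 => a Ma; rewrite lee_fin mulr_ge0 ?t0 ?M_ge0.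
have c0 v : 0 <= \esum_(a in M) (t a * charge a v)%:E.
  by apply: esum_ge0 => a Ma; rewrite lee_fin mulr_ge0 ?t0// charge_ge0//; exact: sM.
have tE v : transfer (EFin \o m) v + \esum_(a in M) (t a * charge a v)%:E = (m v)%:E.
  have -> : transfer (EFin \o m) v = \esum_(a in M) transfer (fun v => (t a * a v)%:E) v.
    rewrite -transfer_esum//; last by move=> a v' Ma; rewrite lee_fin mulr_ge0 ?t0 ?M_ge0.
    by apply: eq_esum => e _; rewrite /= mE.
  rewrite -esumD; last 2 first.
  - by move=> a Ma; apply: transfer_ge0 => // v'; rewrite lee_fin mulr_ge0 ?t0 ?M_ge0.
  - by move=> a Ma; rewrite lee_fin mulr_ge0 ?t0// charge_ge0//; exact: sM.
  rewrite mE; apply: eq_esum => a Ma; have sa := sM a Ma.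
  rewrite [X in X + _](_ : _ = (t a)%:E * transfer (EFin \o a) v); last first.
    rewrite -transferZ ?t0// => v'.
    by rewrite lee_fin; case: sa.
  by rewrite superharmonic_transferE// -EFinM -EFinD; congr EFin; ring.
have t_ge0 v : 0 <= transfer (EFin \o m) v by apply: transfer_ge0 => // v'; rewrite lee_fin.
have sm : superharmonic m by split => // v; rewrite -tE leeDl.
split => // v; move: (tE v); rewrite superharmonic_transferE//.
move=> /(congr1 (fun x => x - (m v - charge m v)%:E)); rewrite [X in X - _]addeC addeK// => ->.
by rewrite -EFinB; congr EFin; ring.
Qed.

Lemma conv_hull_Dbeta : conv_hull M `<=` Dbeta.
Proof.
move=> m [t [t0 t1 mE]]; have [sm cE] := esum_superharmonic t0 mE.
apply: Dbeta_intro => //.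
  by rewrite -t1 -esum_weights//; apply: eq_esum => v _; exact: mE.
move=> v Rv; apply: EFin_inj; rewrite cE esum1// => a Ma.
by rewrite Dbeta_charge ?mulr0//; exact: MD.
Qed.

Lemma conv_hull_intro (t : (vert E -> R) -> R) m : (forall a, M a -> 0 <= t a)%R ->
  Dbeta m -> (forall v, (m v)%:E = \esum_(a in M) (t a * a v)%:E) -> conv_hull M m.
Proof.
move=> t0 mD mE; exists t; split => //.
by rewrite -esum_weights// -(Dbeta_sum mD); apply: eq_esum => v _.
Qed.

End ConvexCombinations.

Lemma M_sub_Dbeta : mbeta @` A `<=` Dbeta.
Proof. by move=> _ [v Av <-]; exact: mbeta_Dbeta. Qed.

Lemma sub_M_Dbeta (B : set (vert E)) : B `<=` A -> mbeta @` B `<=` Dbeta.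
Proof. by move=> BA _ [v /BA Av <-]; exact: mbeta_Dbeta. Qed.

Lemma extreme_points_conv_hull (B : set (vert E)) : B `<=` A ->
  mbeta @` B = extreme_points (conv_hull (mbeta @` B)).
Proof.
move=> BA; have BD := sub_M_Dbeta BA.
have B0 a v : (mbeta @` B) a -> (0 <= a v)%R by move=> /BD/Dbeta_superharmonic[].
apply/seteqP; split => [_ [v Bv <-]|m]; last exact: extreme_conv_hull.
apply: mbeta_extreme; [exact: conv_hull_Dbeta|exact: BA|].
by apply: conv_hull_incl => //; exists v.
Qed.

(** Where m has charge, the ray of that vertex already absorbs all of it, so [h] has none. At a
    critical vertex the corresponding ray already attains the value of m, so [h] vanishes. *)
Lemma Dbeta_decomposition m : Dbeta m -> exists t h,
  [/\ forall a, (0 <= t a)%R, superharmonic h, forall v, charge h v = 0%R,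
      forall v, critical v -> h v = 0%R &
      forall v, (m v)%:E = \esum_(a in mbeta @` A) (t a * a v)%:E + (h v)%:E].
Proof.
move=> mD; have sm := Dbeta_superharmonic mD.
have [h [sh mE cE]] := riesz_decomposition N_gt0 extremal_admissible sm.
have t0 a := ray_coef_ge0 N_gt0 extremal_admissible a sm.
have Msup a : (mbeta @` A) a -> superharmonic a.
  by move=> [v Av <-]; apply: mbeta_superharmonic => //; exact: extremal_admissible.
have coefE := ray_coefE (N := N) (beta := beta) (A := A) m.
exists (ray_coef N beta A m), h; split => //.
- move=> v; apply/eqP; rewrite eq_le charge_ge0// andbT.
  have e0 : 0 <= \esum_(a in mbeta @` A) (ray_coef N beta A m a * charge a v)%:E.
    by apply: esum_ge0 => a Ma; rewrite lee_fin mulr_ge0// charge_ge0//; exact: Msup.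
  (* Positive charge makes [v] beta-regular and excludes it from [Rg], so [mbeta v] is among the
     rays. *)
  have [cv|ncv] := ltP 0%R (charge m v); last first.
    by rewrite -lee_fin; apply: le_trans (_ : (charge m v)%:E <= _) => //; rewrite cE leeDr.
  have adm : admissible v.
    apply: (superharmonic_admissible N_gt0 sm (Dbeta_sum_lt mD)).
    exact: lt_le_trans cv (charge_le N_gt0 v sm).
  have z1 := zs_lt1 N_gt0 sm adm cv.
  have Av : A v.
    left; split; first by split; [case: adm|rewrite zsE// lte_fin].
    by move=> Rv; move: cv; rewrite Dbeta_charge// ltxx.
  have Ma : (mbeta @` A) (mbeta v) by exists v.
  have [v' [Av' mv' tE]] := coefE _ Ma.
  have za0 := za_gt0 N_gt0 (proj1 adm).
  (* A ray with nonzero charge determines its vertex as the place of the charge. *)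
  have vv : v' = v.
    have := congr1 (charge^~ v) mv'; rewrite /= !charge_mbeta//; last exact: extremal_admissible.
    rewrite /mbeta_charge eqxx; case: eqP => [//|_ /esym/eqP].
    by rewrite mulf_eq0 subr_eq0 invr_eq0 (gt_eqF za0) (gt_eqF z1).
  have tc : (ray_coef N beta A m (mbeta v) * charge (mbeta v) v = charge m v)%R.
    rewrite tE vv /ray_weight (lt_eqF z1) charge_mbeta// /mbeta_charge eqxx.
    by field; rewrite gt_eqF//= subr_eq0 gt_eqF.
  have : (charge m v)%:E + (charge h v)%:E <= (charge m v)%:E.
    rewrite {2}cE leeD2r// -tc.
    apply: (@esum_ge1 _ _ _ (fun a => (ray_coef N beta A m a * charge a v)%:E)) => // a Ma'.
    by rewrite lee_fin mulr_ge0// charge_ge0//; exact: Msup.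
  by rewrite -EFinD lee_fin gerDl.
- move=> v crit; have Ma : (mbeta @` A) (mbeta v) by exists v => //; right.
  have [v' [Av' mv' tE]] := coefE _ Ma.
  have adm' := extremal_admissible Av'; have za0 := za_gt0 N_gt0 (proj1 adm').
  have z1 : zs v' = 1%R.
    have := congr1 (charge^~ v') mv'; rewrite /= charge_mbeta// charge_critical//.
    rewrite /mbeta_charge eqxx => /eqP; rewrite mulf_eq0 subr_eq0 invr_eq0 (gt_eqF za0) orbF.
    by move/eqP.
  have hv' : h v' = 0%R.
    have ta : (ray_coef N beta A m (mbeta v) * mbeta v v' = m v')%R.
      rewrite tE -mv' /ray_weight z1 eqxx mbeta_diag ?(proj1 adm')// mulfK//.
      by rewrite gt_eqF.
    apply/eqP; rewrite eq_le (proj1 sh) andbT.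
    have : (m v')%:E + (h v')%:E <= (m v')%:E.
      rewrite {2}mE leeD2r// -ta.
      apply: (@esum_ge1 _ _ _ (fun a => (ray_coef N beta A m a * a v')%:E)) => // a Ma'.
      by rewrite lee_fin mulr_ge0//; case: (Msup _ Ma').
    by rewrite -EFinD lee_fin gerDl.
  (* The coefficient may have been computed at another vertex [v'] of the class; the zero of [h] is
     transported from there. *)
  have conn : connected_to v' v.
    apply: (iffLR (mbeta_gt0P N_gt0 _ (critical_admissible crit))).
    by rewrite -mv' mbeta_diag ?(proj1 adm')// invr_gt0.
  exact: (superharmonic_zero N_gt0 sh conn hv').
Qed.

End Dbeta.

(** * The supported simplices *)

Lemma esum_squeeze (R : realType) (V : choiceType) (f g : V -> R) :
  (forall i, 0 <= f i <= g i) ->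
  (\esum_(i in setT) (g i)%:E <= \esum_(i in setT) (f i)%:E)%E ->
  (\esum_(i in setT) (g i)%:E < +oo)%E -> f = g.
Proof.
move=> fg le goo; apply/funext => j.
have f0 i : (0 <= (f i)%:E)%E by rewrite lee_fin; case/andP: (fg i).
have d0 i : (0 <= (g i - f i)%:E)%E by rewrite lee_fin subr_ge0; case/andP: (fg i).
have s : (\esum_(i in setT) (f i)%:E + \esum_(i in setT) (g i - f i)%:E)%E =
    \esum_(i in setT) (g i)%:E.
  by rewrite -esumD//; apply: eq_esum => i _; rewrite -EFinD addrC subrK.
have ds0 : (0 <= \esum_(i in setT) (g i - f i)%:E)%E by exact: esum_ge0.
have gfin : \esum_(i in setT) (g i)%:E \is a fin_num.
  by rewrite ge0_fin_numE// -s adde_ge0//; exact: esum_ge0.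
have : \esum_(i in setT) (g i - f i)%:E = 0%E.
  apply/eqP; rewrite eq_le ds0 andbT.
  have : (\esum_(i in setT) (g i)%:E + \esum_(i in setT) (g i - f i)%:E <=
      \esum_(i in setT) (g i)%:E)%E by rewrite -[leRHS]s leeD2r.
  by rewrite -[leRHS]adde0 leeD2lE.
move=> /(esum_eq0 (fun i _ => d0 i))/(_ (I : setT j)) => -[/eqP].
by rewrite subr_eq0 eq_sym => /eqP.
Qed.

Section SupportedSimplices.
Variables (R : realType) (E : digraph) (Rg : set (vert E)) (N : edge E -> R) (beta : R).
Hypothesis N_gt0 : forall e, 0 < N e.
Local Notation transfer := (transfer N beta).
Local Notation psum := (psum N beta).
Local Notation za := (za N beta).
Local Notation zs := (zs N beta).
Local Notation mbeta := (mbeta N beta).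
Local Notation superharmonic := (superharmonic N beta).
Local Notation charge := (charge N beta).
Local Notation admissible := (admissible N beta).
Local Notation critical := (critical N beta).
Local Notation pw := (path_weight N beta).
Local Notation Dbeta := (Dbeta Rg N beta).
Local Notation A := (extremal_vertices Rg N beta).
Local Notation A_reg := (beta_regular N beta `\` Rg).
Local Notation A_crit := (beta_critical N beta).
Implicit Types (u : finpath E) (e : edge E) (v : vert E) (a m k h : vert E -> R).
Local Open Scope ereal_scope.

Section Measure.
Variables (m : vert E -> R) (p : boundary Rg) (mu : probability (borelType (boundary_at p)) R).
Hypotheses (mD : Dbeta m) (assoc : associated_measure N beta m mu).
Let sm := Dbeta_superharmonic mD.

Lemma mu_finite_paths : mu (trace p (@finite_paths E)) = 1 - mu (borel_trace p (@infinite_paths E)).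
Proof.
rewrite -probability_setC; last exact: measurable_infinite_paths.
by rewrite finite_infinite_pathsC.
Qed.

(** Summed over paths of length [n], a harmonic k keeps its total mass and stays below m at every
    level. *)
Lemma harmonic_le_mu k : superharmonic k -> (forall v, charge k v = 0%R) ->
  (forall v, k v <= m v)%R ->
  \esum_(v in setT) (k v)%:E <= mu (borel_trace p (@infinite_paths E)).
Proof.
move=> sk ck km; apply: (mu_infinite_ge N_gt0 assoc) => n.
rewrite -(esum_len_harmonic N_gt0 n sk ck); apply: le_esum => u _.
by rewrite lee_wpmul2l ?lee_fin// ltW// path_weight_gt0.
Qed.

(** For each n the mass 1 splits into the potential of the charge up to length n and the mass of m
    at level n; the latter is at least mu(E^infty). *)
Lemma charge_potential_le :
  \esum_(u in setT) ((pw u)%:E * (charge m (frng u))%:E) <= mu (trace p (@finite_paths E)).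
Proof.
have m0 v : 0 <= (EFin \o m) v by rewrite lee_fin; case: sm.
have c0 v : 0 <= (EFin \o charge m) v by rewrite lee_fin charge_ge0.
have mifin : mu (borel_trace p (@infinite_paths E)) \is a fin_num.
  by apply: fin_num_measure; exact: measurable_infinite_paths.
rewrite mu_finite_paths; apply: esum_leP => X [fX _].
pose n := (\sum_(u <- finmap.enum_fset (fset_set X)) len u).+1.
have Xn u : X u -> (len u < n)%N.
  by move=> Xu; rewrite ltnS (big_fsetD1 u)/= ?leq_addr// in_fset_set// inE.
apply: (@le_trans _ _ (\esum_(v in setT) psum [set u | (len u < n)%N] (EFin \o charge m) v)).
  by rewrite esum_psum//; apply: esum_ge; exists X.
rewrite leeBrDr//.
have -> : 1 = \esum_(v in setT) (psum [set u | (len u < n)%N] (EFin \o charge m) v +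
    psum [set u | len u = n] (EFin \o m) v).
  rewrite -(Dbeta_sum mD); apply: eq_esum => v _.
  by rewrite psum_charge_len.
rewrite esumD; last 2 first.
- by move=> v _; exact: psum_ge0.
- by move=> v _; exact: psum_ge0.
rewrite leeD2l//; rewrite [leRHS]esum_psum//.
exact: mu_infinite_le.
Qed.

End Measure.

(** With mu(E^infty) = 0 every harmonic function below m vanishes. This kills the remainder [h] and
    each term of the decomposition along a critical ray. *)
Lemma D_fin_sub : D_fin Rg N beta `<=` conv_hull (mbeta @` A_reg).
Proof.
move=> m [mD [p [mu [assoc mu1]]]].
have mui : mu (borel_trace p (@infinite_paths E)) = 0.
  have mifin : mu (borel_trace p (@infinite_paths E)) \is a fin_num.
    by apply: fin_num_measure; exact: measurable_infinite_paths.
  move: mu1; rewrite mu_finite_paths => /eqP; rewrite -(fineK mifin) -EFinB eqe.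
  by rewrite -subr_eq0 addrAC subrr add0r oppr_eq0 => /eqP ->.
have [t [h [t0 sh ch _ mE]]] := Dbeta_decomposition N_gt0 mD.
have M0 a v : (mbeta @` A) a -> (0 <= a v)%R.
  by move=> /(M_sub_Dbeta N_gt0)/Dbeta_superharmonic[].
have tM0 v a : (mbeta @` A) a -> 0 <= (t a * a v)%:E.
  by move=> Ma; rewrite lee_fin mulr_ge0 ?M0.
have h0 v : h v = 0%R.
  have hm v' : (h v' <= m v')%R.
    by rewrite -lee_fin mE leeDr//; apply: esum_ge0 => a; exact: tM0.
  have hs : \esum_(v in setT) (h v)%:E = 0.
    apply/eqP; rewrite eq_le -{1}mui (harmonic_le_mu assoc sh ch hm)/=.
    by apply: esum_ge0 => v' _; rewrite lee_fin; case: sh.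
  have := esum_eq0 (i := v) _ hs I => H; apply: EFin_inj; apply: H => v' _.
  by rewrite lee_fin; case: sh.
have mE' v : (m v)%:E = \esum_(a in mbeta @` A) (t a * a v)%:E by rewrite mE h0 adde0.
have tcrit v : critical v -> t (mbeta v) = 0%R.
  move=> cv; have adm := critical_admissible cv.
  have [sk ck] := superharmonicZ N_gt0 (t0 (mbeta v)) (mbeta_superharmonic N_gt0 adm).
  have km v' : (t (mbeta v) * mbeta v v' <= m v')%R.
    rewrite -lee_fin mE'.
    apply: (@esum_ge1 _ _ _ (fun a => (t a * a v')%:E)); first exact: tM0.
    by exists v => //; right.
  have ck0 v' : charge (fun v' => t (mbeta v) * mbeta v v')%R v' = 0%R.
    by rewrite ck charge_critical// mulr0.
  have := harmonic_le_mu assoc sk ck0 km; rewrite mui.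
  rewrite (@eq_esum _ _ _ _ (fun v' => (t (mbeta v))%:E * (mbeta v v')%:E))//.
  rewrite esumZl//; last by move=> v' _; rewrite lee_fin mbeta_ge0.
  rewrite (esum_mbeta N_gt0 (proj1 cv)) mule1 lee_fin => tle.
  by apply/eqP; rewrite eq_le tle t0.
have AA : A_reg `<=` A by move=> v; left.
apply: (conv_hull_intro (sub_M_Dbeta N_gt0 AA) (t := t)) => // v.
rewrite mE'; apply: esum_le_supp => //.
- by apply: image_subset => v'; left.
- by move=> a; exact: tM0.
- move=> _ [v' [rv'|cv'] <-] na; first by exfalso; apply: na; exists v'.
  by rewrite tcrit// mul0r.
Qed.

(** The mass of the finite paths is bounded below by the total potential of the charge, so it
    suffices that this potential [G] dominates m. [G] is superharmonic with the same charge as m,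
    and the ray coefficients at regular vertices depend on the charge only. *)
Lemma conv_hull_sub_D_fin : conv_hull (mbeta @` A_reg) `<=` D_fin Rg N beta.
Proof.
move=> m mK; have AA : A_reg `<=` A by move=> v; left.
have MD := sub_M_Dbeta N_gt0 AA.
have mD : Dbeta m by exact: (conv_hull_Dbeta N_gt0 MD).
split => //; have [p [mu assoc]] := associated_measure_exists N_gt0 mD.
exists p, mu; split => //; apply/eqP; rewrite eq_le; apply/andP; split.
  by rewrite mu_finite_paths leeBlDr ?leeDl// fin_num_measure//; exact: measurable_infinite_paths.
apply: le_trans (charge_potential_le mD assoc).
have sm := Dbeta_superharmonic mD.
have m0 v : 0 <= (EFin \o m) v by rewrite lee_fin; case: sm.
have c0 v : 0 <= (EFin \o charge m) v by rewrite lee_fin charge_ge0.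
pose G v := psum setT (EFin \o charge m) v.
have G0 v : 0 <= G v by exact: psum_ge0.
have Gm v : G v <= (m v)%:E.
  apply: psum_le_truncate => // n; rewrite setTI -(psum_charge_len N_gt0 n v sm) leeDl//.
  exact: psum_ge0.
have GE v : G v = (fine (G v))%:E by rewrite fineK// ge0_fin_numE// (le_lt_trans (Gm v))// ltry.
have GP v : G v = (charge m v)%:E + transfer G v.
  by rewrite {1}/G psum_cons// ifT ?inE.
have [sg cg] : superharmonic (fine \o G) /\ charge (fine \o G) = charge m.
  apply: superharmonic_intro => v; first by rewrite fine_ge0.
    exact: charge_ge0.
  have -> : transfer (EFin \o (fine \o G)) v = transfer G v.
    by apply: eq_esum => e _; rewrite /= -GE.
  have tfin : transfer G v \is a fin_num.
    rewrite ge0_fin_numE; last exact: transfer_ge0.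
    by apply: (@le_lt_trans _ _ (G v)); [rewrite GP leeDr// lee_fin charge_ge0|rewrite GE ltry].
  have fE : (fine \o G) v = (charge m v + fine (transfer G v))%R by rewrite /= {1}GP fineD.
  by rewrite fE -[LHS](fineK tfin); congr EFin; ring.
have mG v : (m v)%:E <= G v; last first.
  by rewrite -(Dbeta_sum mD) -(@esum_psum _ _ _ _ N_gt0 setT _ c0); apply: le_esum => v _; exact: mG.
have [t [t0 _ mE]] := mK.
have [_ cE] := esum_superharmonic N_gt0 MD t0 mE.
have admreg v1 : A_reg v1 -> admissible v1 by move=> /AA; exact: extremal_admissible.
have [h [sh gE _]] := riesz_decomposition N_gt0 admreg sg.
rewrite GE gE mE; apply: (@le_trans _ _ (\esum_(a in mbeta @` A_reg) (ray_coef N beta A_reg (fine \o G) a * a v)%:E)); last first.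
  by rewrite leeDl// lee_fin; case: sh.
apply: le_esum => a Ma; rewrite lee_fin ler_wpM2r//.
  by case: (Dbeta_superharmonic (MD _ Ma)).
have [v' [Av' va ->]] := ray_coefE (fine \o G) Ma.
have adm := admreg _ Av'; have za0 := za_gt0 N_gt0 (proj1 adm).
have z1 : (zs v' < 1)%R by rewrite -lte_fin -zsE//; case: Av' => -[].
have z1' : (0 < 1 - zs v')%R by rewrite subr_gt0.
(* The coefficient of [a] in [G] is at least [t a] because the charge of m at [v'] includes the term
   of [a]. *)
rewrite /ray_weight lt_eqF// cg ler_pdivlMr// -ler_pdivrMr// -mulrA.
have -> : ((1 - zs v') / za v' = charge a v')%R.
  by rewrite -va charge_mbeta// /mbeta_charge eqxx.
rewrite -lee_fin cE; apply: (@esum_ge1 _ _ _ (fun a => (t a * charge a v')%:E)) => // b Mb.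
by rewrite lee_fin mulr_ge0 ?t0// charge_ge0//; exact: Dbeta_superharmonic (MD _ Mb).
Qed.

(** The critical part [F] of the decomposition agrees with m at critical vertices. By the maximum
    principle it dominates the sum over first hits of the critical set, whose total is at least
    mu(E^infty_rec) = 1; as [F] lies below m, the two coincide. *)
Lemma D_con_sub : D_con Rg N beta `<=` conv_hull (mbeta @` A_crit).
Proof.
move=> m [mD [p [mu [assoc mu1]]]].
have sm := Dbeta_superharmonic mD.
have [t [h [t0 sh ch hcrit mE]]] := Dbeta_decomposition N_gt0 mD.
have AA : A_crit `<=` A by move=> v; right.
have MD := sub_M_Dbeta N_gt0 AA.
have Mincl : mbeta @` A_crit `<=` mbeta @` A by exact: image_subset.
have M0 a v : (mbeta @` A) a -> (0 <= a v)%R.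
  by move=> /(M_sub_Dbeta N_gt0)/Dbeta_superharmonic[].
have tM0 v a : (mbeta @` A) a -> 0 <= (t a * a v)%:E.
  by move=> Ma; rewrite lee_fin mulr_ge0 ?M0.
pose F v := \esum_(a in mbeta @` A_crit) (t a * a v)%:E.
have F0 v : 0 <= F v by apply: esum_ge0 => a /Mincl; exact: tM0.
have Fm v : F v <= (m v)%:E.
  rewrite mE; apply: (@le_trans _ _ (\esum_(a in mbeta @` A) (t a * a v)%:E)).
    exact: esum_le_subset.
  by rewrite leeDl// lee_fin; case: sh.
have FE v : F v = (fine (F v))%:E by rewrite fineK// ge0_fin_numE// (le_lt_trans (Fm v))// ltry.
have [sf _] := esum_superharmonic N_gt0 MD (fun a _ => t0 a) (m := fine \o F) (fun v => esym (FE v)).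
(* A ray that is positive at a critical vertex is itself a critical ray, by [mbeta_eq]. *)
have mF v : critical v -> (m v)%:E = F v.
  move=> cv; rewrite mE hcrit// adde0; apply: esum_le_supp => //.
    by move=> a; exact: tM0.
  move=> _ [v' Av' <-] na; congr EFin; apply/eqP; rewrite mulf_eq0; apply/orP; right.
  apply/negPn/negP => mv; apply: na; exists v => //.
  apply: mbeta_eq => //; first exact: extremal_admissible Av'.
  apply: (iffLR (mbeta_gt0P N_gt0 _ (extremal_admissible Av'))).
  by rewrite lt_neqAle eq_sym mv mbeta_ge0.
suff fm : fine \o F = m.
  by apply: (conv_hull_intro MD (t := t)) => // v; rewrite -fm /= -FE.
apply: esum_squeeze.
- by move=> v; rewrite /= fine_ge0//= -lee_fin -FE.
- rewrite (Dbeta_sum mD) -mu1.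
  apply: le_trans (mu_recurrent_le N_gt0 sm assoc (Dbeta_sum_lt mD)) _.
  have m0 v : 0 <= (EFin \o m) v by rewrite lee_fin; case: sm.
  rewrite -(@esum_psum _ _ _ _ N_gt0 _ (EFin \o m))//; apply: le_esum => v _.
  apply: (@psum_hit_le _ _ _ _ N_gt0 _ (EFin \o m) (EFin \o (fine \o F))) => //.
  + by move=> v'; rewrite lee_fin fine_ge0.
  + by move=> v' cv'; rewrite /= mF// -FE.
  + by move=> v' _; exact: (proj2 sf).
- exact: (Dbeta_sum_lt mD).
Qed.

(** For finitely many generators, the paths recurring at one chosen vertex of each form disjoint
    sets, of mass at least the weight of that generator; these weights add up to 1. *)
Lemma conv_hull_sub_D_con : conv_hull (mbeta @` A_crit) `<=` D_con Rg N beta.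
Proof.
move=> m mK; have AA : A_crit `<=` A by move=> v; right.
have MD := sub_M_Dbeta N_gt0 AA.
have mD : Dbeta m by exact: (conv_hull_Dbeta N_gt0 MD).
have sm := Dbeta_superharmonic mD.
split => //; have [p [mu assoc]] := associated_measure_exists N_gt0 mD.
exists p, mu; split => //; apply/eqP; rewrite eq_le probability_le1/=; last exact: measurable_recurrent_paths.
have [t [t0 t1 mE]] := mK.
rewrite -t1; apply: esum_leP => X [fX XM].
have [->|/set0P[a0 /XM[v0 cv0 _]]] := eqVneq X set0; first by rewrite fsbig_set0.
(* One vertex per generator: by [mbeta_eq] two chosen vertices joined by a path give the same
   generator, hence are the same vertex. *)
pose f a := xget v0 [set v | critical v /\ mbeta v = a].
have fP a : X a -> critical (f a) /\ mbeta (f a) = a.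
  move=> /XM[v cv va]; rewrite /f; case: xgetP => [_ -> //|/(_ v)h].
  by exfalso; apply: h.
have fX' a : a \in finmap.enum_fset (fset_set X) -> X a by rewrite in_fset_set// inE.
rewrite fsbig_finite// sumEFin.
pose s := map f (finmap.enum_fset (fset_set X)).
have us : uniq s.
  rewrite map_inj_in_uniq ?finmap.fset_uniq// => a b /fX' Xa /fX' Xb fab.
  by rewrite -(fP a Xa).2 -(fP b Xb).2 fab.
have cs v : v \in s -> critical v by move=> /mapP[a /fX' Xa ->]; exact: (fP a Xa).1.
have conns v v' : v \in s -> v' \in s -> connected_to v v' -> v = v'.
  move=> /mapP[a /fX' Xa ->] /mapP[b /fX' Xb ->] conn.
  congr f; rewrite -(fP a Xa).2 -(fP b Xb).2; apply: mbeta_eq => //.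
    exact: (fP a Xa).1.
  exact: critical_admissible (fP b Xb).1.
apply: le_trans (sum_infinitely_often_le N_gt0 sm assoc us cs conns).
rewrite big_map lee_fin big_seq [leRHS]big_seq; apply: ler_sum => a /fX' Xa.
have [cv fa] := fP a Xa; have za0 := za_gt0 N_gt0 (proj1 cv).
rewrite -ler_pdivrMr// -lee_fin mE.
apply: le_trans (@esum_ge1 _ _ _ (fun b => (t b * b (f a))%:E) a _ (XM _ Xa)).
  by have := mbeta_diag N_gt0 (proj1 cv); rewrite fa => ->.
move=> b Mb; rewrite lee_fin mulr_ge0 ?t0//.
by case: (Dbeta_superharmonic (MD _ Mb)).
Qed.

(** By contradiction: a nonzero remainder [h], normalized to [k], lies in [D_dis]. Harmonicity gives
    full mass to the infinite paths, and vanishing at critical vertices gives none to the recurrent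
    ones. *)
Lemma Dbeta_sub : D_dis Rg N beta = set0 -> Dbeta `<=` conv_hull (mbeta @` A).
Proof.
move=> dis0 m mD; have [t [h [t0 sh ch hcrit mE]]] := Dbeta_decomposition N_gt0 mD.
have sm := Dbeta_superharmonic mD.
have MD := M_sub_Dbeta N_gt0 (Rg := Rg) (beta := beta).
have hm v : (h v <= m v)%R.
  rewrite -lee_fin mE leeDr//; apply: esum_ge0 => a Ma; rewrite lee_fin mulr_ge0//.
  by case: (Dbeta_superharmonic (MD _ Ma)).
have h0 v : 0 <= (h v)%:E by rewrite lee_fin; case: sh.
suff hs : \esum_(v in setT) (h v)%:E = 0.
  apply: (conv_hull_intro MD (t := t)) => // v.
  by rewrite mE (esum_eq0 (fun v _ => h0 v) hs (I : setT v)) adde0.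
have s1 : \esum_(v in setT) (h v)%:E <= 1.
  by rewrite -(Dbeta_sum mD); apply: le_esum => v _; rewrite lee_fin.
have s0 : 0 <= \esum_(v in setT) (h v)%:E by exact: esum_ge0.
pose s := fine (\esum_(v in setT) (h v)%:E).
have sE : \esum_(v in setT) (h v)%:E = s%:E.
  by rewrite /s fineK// ge0_fin_numE// (le_lt_trans s1)// ltry.
rewrite sE; congr EFin; apply: contrapT => /eqP sn0.
have sp : (0 < s)%R by rewrite lt_neqAle eq_sym sn0 -lee_fin -sE.
pose k v := (s^-1 * h v)%R.
have si0 : (0 <= s^-1)%R by rewrite invr_ge0 ltW.
have [sk ck] := superharmonicZ N_gt0 si0 sh.
have ck0 v : charge k v = 0%R by rewrite ck ch mulr0.
have kD : Dbeta k.
  apply: (Dbeta_intro N_gt0) => //.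
  rewrite (@eq_esum _ _ _ _ (fun v => s^-1%:E * (h v)%:E))// esumZl ?invr_ge0 ?ltW//.
  by rewrite sE -EFinM mulVf.
have [p [mu assoc]] := associated_measure_exists N_gt0 kD.
have mi : 1 <= mu (borel_trace p (@infinite_paths E)).
  by rewrite -(Dbeta_sum kD); exact: (harmonic_le_mu assoc sk ck0 (fun v => lexx _)).
have mr : mu (borel_trace p (@recurrent_paths E)) = 0.
  apply/eqP; rewrite eq_le measure_ge0 andbT.
  apply: le_trans (mu_recurrent_le N_gt0 sk assoc (Dbeta_sum_lt kD)) _.
  by rewrite esum1// => u [cu _]; rewrite /k hcrit// mulr0 mule0.
have mW : measurable (borel_trace p (@wandering_paths E)).
  rewrite (_ : borel_trace p _ = borel_trace p (@infinite_paths E) `\` borel_trace p (@recurrent_paths E))//.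
  by apply: measurableD; [exact: measurable_infinite_paths|exact: measurable_recurrent_paths].
have : D_dis Rg N beta k.
  split => //; exists p, mu; split => //.
  apply/eqP; rewrite eq_le probability_le1//=.
  apply: (le_trans mi); rewrite -[leRHS]adde0 -mr.
  apply: le_trans (measureU2 _ _ _) => //; last exact: measurable_recurrent_paths.
  apply: le_measure; rewrite ?inE.
  - exact: measurable_infinite_paths.
  - by apply: measurableU => //; exact: measurable_recurrent_paths.
  - move=> x ix; have [rx|nrx] := pselect (borel_trace p (@recurrent_paths E) x); first by right.
    by left; split.
by rewrite dis0.
Qed.

Lemma D_dis_eq0 : @wandering_paths E = set0 -> D_dis Rg N beta = set0.
Proof.
move=> w0; rewrite -subset0 => m [_ [p [mu [_]]]].
rewrite w0 (_ : trace p set0 = set0)// measure0 => -[/eqP].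
by rewrite eq_sym oner_eq0.
Qed.

End SupportedSimplices.

Theorem corollary5p18 (R : realType) (E : digraph) (Rg : set (vert E))
  (hRg : Rg `<=` @regular_vertices E)
  (N : edge E -> R) (hN : forall e, 1 < N e)
  (beta : R) (hbeta : 0 <= beta) :
  [/\ M_reg Rg N beta = extreme_points (D_fin Rg N beta) /\
      D_fin Rg N beta = conv_hull (M_reg Rg N beta),
      M_crit N beta = extreme_points (D_con Rg N beta) /\
      D_con Rg N beta = conv_hull (M_crit N beta),
      @wandering_paths E = set0 -> D_dis Rg N beta = set0 &
      D_dis Rg N beta = set0 ->
      M_reg Rg N beta `|` M_crit N beta = extreme_points (Dbeta Rg N beta) /\
      Dbeta Rg N beta = conv_hull (M_reg Rg N beta `|` M_crit N beta)].
Proof.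
have N_gt0 e : 0 < N e by rewrite (lt_trans ltr01).
have regA : beta_regular N beta `\` Rg `<=` extremal_vertices Rg N beta by move=> v; left.
have critA : beta_critical N beta `<=` extremal_vertices Rg N beta by move=> v; right.
have finE : D_fin Rg N beta = conv_hull (M_reg Rg N beta).
  by apply/seteqP; split; [exact: D_fin_sub|exact: conv_hull_sub_D_fin].
have conE : D_con Rg N beta = conv_hull (M_crit N beta).
  by rewrite M_critE//; apply/seteqP; split; [exact: D_con_sub|exact: conv_hull_sub_D_con].
split.
- by split => //; rewrite finE; exact: (extreme_points_conv_hull N_gt0 regA).
- by split => //; rewrite conE M_critE//; exact: (extreme_points_conv_hull N_gt0 critA).
- exact: D_dis_eq0.
- move=> dis0; rewrite M_regcritE//.
  have DE : Dbeta Rg N beta = conv_hull (mbeta N beta @` extremal_vertices Rg N beta).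
    apply/seteqP; split; first exact: Dbeta_sub.
    by apply: conv_hull_Dbeta => //; exact: M_sub_Dbeta.
  by split => //; rewrite DE; exact: (extreme_points_conv_hull N_gt0 (@subset_refl _ (extremal_vertices Rg N beta))).
Qed.
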